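(* Let $\mathbb S_1=\{|z|=1\}$ and $\mathbb S_3=\{|z-\tfrac23|=\tfrac13\}$. Consider the family of piecewise polynomial holomorphic systems $$\dot z = -i(z-1)+\varepsilon h^{\sigma}(z),\qquad z\in\Sigma_\sigma^I,\quad \sigma\in\{+,c,-\},$$ where $\Sigma_+^I=\{|z-\tfrac23|<\tfrac13\}$, $\Sigma_c^I=\{|z-\tfrac23|>\tfrac13,\ |z|<1\}$, $\Sigma_-^I=\{|z|>1\}$, and $$h^{\sigma}(z)=\sum_{j=0}^{3}(a_j^{\sigma}+ib_j^{\sigma})z^j,\qquad a_j^\sigma,b_j^\sigma\in\mathbb R .$$ Then, for $\varepsilon$ sufficiently small, a lower bound for the (maximum) number of limit cycles bifurcating from the periodic solutions of the unperturbed center $\dot z=-i(z-1)$ is: (i) $4$, for the periodic orbits that cross only $\mathbb S_1$: the coefficients can be chosen so that for all sufficiently small $\varepsilon\ne0$ at least $4$ limit cycles bifurcate from periodic orbits of the unperturbed center crossing $\mathbb S_1$ but not $\mathbb S_3$; (ii) $8$, for the periodic orbits that cross both $\mathbb S_1$ and $\mathbb S_3$: the coefficients can be chosen so that for all sufficiently small $\varepsilon\ne0$ at least $8$ limit cycles bifurcate from periodic orbits of the unperturbed center crossing both $\mathbb S_1$ and $\mathbb S_3$.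
   Context: The system is a planar piecewise-smooth system ($z=x+iy\in\mathbb C\cong\mathbb R^2$) with three zones separated by the internally tangent circles $\mathbb S_1$ and $\mathbb S_3$; the dynamics on the circles follows Filippov's convention (where both adjacent vector fields cross the curve transversally in the same direction, trajectories are obtained by concatenation). The periodic orbits of the unperturbed center are the circles centered at $z=1$. A limit cycle is an isolated periodic orbit. A limit cycle $\gamma_\varepsilon$ bifurcates from a periodic orbit $L$ of the unperturbed ($\varepsilon=0$) system if $\gamma_\varepsilon\to L$ as $\varepsilon\to0$. *)

(* Defs.v *)
(* Stdlib reals with Coquelicot: the plane is Coquelicot's [C] = R * R. *)
From Stdlib Require Export Reals List.
From Coquelicot Require Export Coquelicot.

Open Scope R_scope.

Definition S1 (z : C) : Prop := Cmod z = 1.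
Definition S3 (z : C) : Prop := Cmod (z - RtoC (2 / 3))%C = 1 / 3.

(* The two circles are internally tangent at z = 1, so there are three zones:
   [Zplus] is inside S3, [Zcenter] is between the circles, [Zminus] is
   outside S1. *)
Inductive zone : Set := Zplus | Zcenter | Zminus.

Definition in_zone (s : zone) (z : C) : Prop :=
  match s with
  | Zplus => Cmod (z - RtoC (2 / 3))%C < 1 / 3
  | Zcenter => Cmod (z - RtoC (2 / 3))%C > 1 / 3 /\ Cmod z < 1
  | Zminus => Cmod z > 1
  end.

Definition in_closure (A : C -> Prop) (z : C) : Prop :=
  forall d : R, 0 < d -> exists w : C, A w /\ Cmod (w - z)%C < d.

(* A piecewise system is given by one globally defined field per zone. *)
Definition pw_field : Type := zone -> C -> C.

(* Filippov's set-valued field: the convex hull of the values at [z] of the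
   fields of the zones adherent to [z].  As the fields are continuous on C,
   these values are the limits at [z] of the piecewise field.  It is the
   singleton {X s z} when [z] lies in the open zone [s]. *)
Definition filippov (X : pw_field) (z v : C) : Prop :=
  exists l : zone -> R,
    (forall s, 0 <= l s) /\
    l Zplus + l Zcenter + l Zminus = 1 /\
    (forall s, ~ in_closure (in_zone s) z -> l s = 0) /\
    v = (RtoC (l Zplus) * X Zplus z + RtoC (l Zcenter) * X Zcenter z
         + RtoC (l Zminus) * X Zminus z)%C.

Definition locally_finite (D : R -> Prop) : Prop :=
  forall t1 t2 : R, exists ts : list R,
    forall t : R, t1 <= t <= t2 -> D t -> In t ts.

(* A Filippov trajectory is a continuous concatenation of arcs, finitely many
   on each bounded time interval; [D] is the set of junction times.  Crossing
   arcs, sliding arcs and pseudo-equilibria are all allowed. *)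
Definition trajectory (X : pw_field) (z : R -> C) : Prop :=
  (forall t : R, continuous z t) /\
  exists D : R -> Prop,
    locally_finite D /\
    forall t : R, ~ D t -> exists v : C, is_derive z t v /\ filippov X (z t) v.

Definition periodic_orbit (X : pw_field) (g : C -> Prop) : Prop :=
  exists (z : R -> C) (T : R),
    0 < T /\
    trajectory X z /\
    (forall t : R, z (t + T) = z t) /\
    (exists t : R, z t <> z 0) /\
    (forall w : C, g w <-> exists t : R, z t = w).

Definition same_set (A B : C -> Prop) : Prop := forall w : C, A w <-> B w.

Definition within_dist (d : R) (A B : C -> Prop) : Prop :=
  forall w : C, A w -> exists w' : C, B w' /\ Cmod (w - w')%C < d.

Definition limit_cycle (X : pw_field) (g : C -> Prop) : Prop :=
  periodic_orbit X g /\
  exists d : R, 0 < d /\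
    forall g' : C -> Prop,
      periodic_orbit X g' -> within_dist d g' g -> same_set g' g.

(* g e -> L in the Hausdorff distance, as e -> 0 with e <> 0. *)
Definition orbits_tend_to (g : R -> C -> Prop) (L : C -> Prop) : Prop :=
  forall d : R, 0 < d ->
    exists e1 : R, 0 < e1 /\
      forall e : R, 0 < Rabs e < e1 -> within_dist d (g e) L /\ within_dist d L (g e).

Definition h (a b : zone -> nat -> R) (s : zone) (z : C) : C :=
  sum_n (fun j : nat => ((RtoC (a s j) + Ci * RtoC (b s j)) * z ^ j)%C) 3.

Definition perturbed (a b : zone -> nat -> R) (e : R) : pw_field :=
  fun (s : zone) (z : C) => (- Ci * (z - 1) + RtoC e * h a b s z)%C.

(* A periodic orbit of the center crosses a circle when it has points strictly
   on both sides of it. *)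
Definition crosses_S1 (L : C -> Prop) : Prop :=
  (exists z : C, L z /\ Cmod z < 1) /\ (exists z : C, L z /\ Cmod z > 1).

Definition crosses_S3 (L : C -> Prop) : Prop :=
  (exists z : C, L z /\ Cmod (z - RtoC (2 / 3))%C < 1 / 3) /\
  (exists z : C, L z /\ Cmod (z - RtoC (2 / 3))%C > 1 / 3).

(* Orbits that are merely tangent to S3 are excluded too. *)
Definition crosses_only_S1 (L : C -> Prop) : Prop :=
  crosses_S1 L /\ forall z : C, L z -> ~ S3 z.

Definition crosses_S1_and_S3 (L : C -> Prop) : Prop :=
  crosses_S1 L /\ crosses_S3 L.

(* For every small e <> 0 the system has [n] pairwise distinct limit cycles
   g 0 e, ..., g (n-1) e, the k-th one bifurcating from the periodic orbit
   L k of the unperturbed system, which is of the kind [P]. *)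
Definition limit_cycles_bifurcate
    (X : R -> pw_field) (P : (C -> Prop) -> Prop) (n : nat) : Prop :=
  exists (L : nat -> C -> Prop) (g : nat -> R -> C -> Prop) (e0 : R),
    0 < e0 /\
    (forall k, (k < n)%nat ->
       periodic_orbit (X 0) (L k) /\ P (L k) /\ orbits_tend_to (g k) (L k)) /\
    (forall e : R, 0 < Rabs e < e0 ->
       (forall k, (k < n)%nat -> limit_cycle (X e) (g k e)) /\
       (forall j k, (j < n)%nat -> (k < n)%nat -> j <> k ->
          ~ same_set (g j e) (g k e))).

(* Main.v *)
Require Import Defs.
From Stdlib Require Import Lra Lia Psatz ClassicalChoice.

(** Put [z - 1 = exp (- i zeta)], [zeta = x + i y]:
    in each zone [zeta' = 1 + eps k(zeta)], so the holomorphic map [F = int dzeta / (1 + eps k)], a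
    perturbation of the identity, carries the flow to a translation; [Im F] is a first
    integral and [F^-1] gives the trajectories.  Near a radius [exp y0] the circles are graphs
    [x = xi_i(y)] crossed transversally, in a fixed order, by every Filippov trajectory, and matching
    [Im F] at consecutive crossings yields a return map [y + eps (M(y) + o(1))] in the C^1 sense, [M]
    being the Melnikov function.  A simple zero of [M] therefore gives, for small [eps <> 0], a unique
    periodic orbit in a fixed tube: existence by the intermediate value theorem, uniqueness because
    two orbits separate or approach geometrically.
    For real coefficients in powers of [z - 1], a rotation adds an arbitrary constant to [M], and
    [M'(r) = 2 N(r^2) / r^2] with [N(u) = P(u) / sqrt (1 - u/4)] for the orbits crossing only S1 and
    [N(u) = P(u) / sqrt (1 - u/4) + Q(u) / sqrt (1 - 9u/4)] for the others, [P] and [Q] arbitrary cubics.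
    Rescaling near [r = 2], respectively near [r = 0] with Hermite-Pade approximants, makes [M'] close to
    the derivative of an explicit function with 4, respectively 8, simple zeros. *)

(** * Calculus on a strip *)

(** [limit_cycle] asks for isolation among all Filippov periodic orbits, including those that slide
    or wind several times, so a return map along crossing orbits alone would not suffice. In the
    coordinate [zeta] every convex combination of the fields has [x' = 1 + O(eps)] and
    [y' = O(eps)]; relative to a curve [x = xi(y)] any Filippov solution moves forward, which
    excludes sliding and fixes the itinerary. Multiple winding is why uniqueness is proved for
    periodic points of the return map and not only for fixed points. Neither a flow nor an implicit
    function theorem is invoked: trajectories are preimages of horizontal segments under a map close
    to the identity, and return maps are handled by Lipschitz estimates on differences, which
    survive composition and inversion. The counts come from dimensions: the constant and the
    coefficients of [P] give five functions, hence four zeros; the constant and the coefficients of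
    [P] and [Q] give nine, hence eight. Approximating an explicit function with integer zeros makes
    every slope computable. *)

Lemma derive_ge_increment_aux (f : R -> R) (c a b : R) :
  a < b ->
  (forall t, a <= t <= b -> continuous f t) ->
  (forall t, a < t < b -> exists d, is_derive f t d /\ c <= d) ->
  c * (b - a) <= f b - f a.
Proof.
intros Hab Hc Hd.
(* [MVT_gen] may return an endpoint, where [f] need not be differentiable. *)
pose (df := fun t => if Rlt_dec a t then if Rlt_dec t b then Derive f t else c else c).
destruct (MVT_gen f a b df) as [x [Hx He]].
- intros x Hx. rewrite Rmin_left, Rmax_right in Hx by lra.
  destruct (Hd x Hx) as [d [H1 _]]. unfold df.
  destruct (Rlt_dec a x); [|lra]. destruct (Rlt_dec x b); [|lra].
  rewrite (is_derive_unique _ _ _ H1). exact H1.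
- intros x Hx. rewrite Rmin_left, Rmax_right in Hx by lra.
  apply continuity_pt_filterlim, Hc, Hx.
- rewrite He. apply Rmult_le_compat_r; [lra|]. unfold df.
  destruct (Rlt_dec a x); [|lra]. destruct (Rlt_dec x b); [|lra].
  destruct (Hd x) as [d [H1 H2]]; [lra|].
  rewrite (is_derive_unique _ _ _ H1). exact H2.
Qed.

(** Trajectories are differentiable only off a locally finite set of times. Cutting the interval at
    each exceptional point reduces to the mean value inequality, which needs only continuity at the
    end points. *)
Lemma derive_ge_increment (f : R -> R) (c : R) (ts : list R) : forall a b : R,
  a <= b ->
  (forall t, a <= t <= b -> continuous f t) ->
  (forall t, a < t < b -> ~ In t ts -> exists d, is_derive f t d /\ c <= d) ->
  c * (b - a) <= f b - f a.
Proof.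
induction ts as [|p ts IH]; intros a b Hab Hc Hd.
- destruct (Req_dec a b) as [->|Hne]; [lra|].
  apply derive_ge_increment_aux; [lra|exact Hc|].
  intros t Ht. apply Hd; auto.
- destruct (Rlt_dec a p) as [H1|H1].
  + destruct (Rlt_dec p b) as [H2|H2].
    * assert (c * (p - a) <= f p - f a).
      { apply IH; [lra|intros; apply Hc; lra|].
        intros t Ht Hn. apply Hd; [lra|]. intros [->|Hi]; [lra|auto]. }
      assert (c * (b - p) <= f b - f p).
      { apply IH; [lra|intros; apply Hc; lra|].
        intros t Ht Hn. apply Hd; [lra|]. intros [->|Hi]; [lra|auto]. }
      lra.
    * apply IH; [lra|exact Hc|].
      intros t Ht Hn. apply Hd; [lra|]. intros [->|Hi]; [lra|auto].
  + apply IH; [lra|exact Hc|].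
    intros t Ht Hn. apply Hd; [lra|]. intros [->|Hi]; [lra|auto].
Qed.

Lemma derive_eq_increment (f : R -> R) (c : R) (ts : list R) (a b : R) :
  a <= b ->
  (forall t, a <= t <= b -> continuous f t) ->
  (forall t, a < t < b -> ~ In t ts -> is_derive f t c) ->
  f b - f a = c * (b - a).
Proof.
intros Hab Hc Hd. apply Rle_antisym.
- cut (- c * (b - a) <= (fun t => - f t) b - (fun t => - f t) a); [cbv beta; lra|].
  apply derive_ge_increment with ts; [exact Hab| |].
  + intros t Ht. apply (continuous_opp f), Hc, Ht.
  + intros t Ht Hn. exists (- c). split; [|lra].
    apply (is_derive_opp f), Hd; auto.
- apply derive_ge_increment with ts; [exact Hab|exact Hc|].
  intros t Ht Hn. exists c. split; [apply Hd; auto|lra].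
Qed.

Lemma continuous_lip (f : R -> R) (K : R) :
  (forall s t, Rabs (f s - f t) <= K * Rabs (s - t)) -> forall t, continuous f t.
Proof.
intros Hf t. apply continuity_pt_filterlim. intros eps He.
assert (HK := Rabs_pos K).
exists (eps / (Rabs K + 1)). split; [apply Rdiv_lt_0_compat; lra|].
intros s [_ Hs]. change (Rabs (s - t) < eps / (Rabs K + 1)) in Hs. change (Rabs (f s - f t) < eps).
apply Rlt_div_r in Hs; [|lra]. eapply Rle_lt_trans; [apply Hf|]. eapply Rle_lt_trans; [|exact Hs].
rewrite (Rmult_comm (Rabs (s - t))). apply Rmult_le_compat_r; [apply Rabs_pos|]. generalize (Rle_abs K). lra.
Qed.

Lemma continuity_2d_pt_sections (f : R -> R -> R) (x y : R) : continuity_2d_pt f x y ->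
  continuous (fun t => f t y) x /\ continuous (fun t => f x t) y.
Proof.
intros Hc. split; apply continuity_pt_filterlim; intros eps He;
destruct (Hc (mkposreal eps He)) as [de Hde]; exists de; (split; [apply de|]);
intros t [_ Ht]; apply Hde; try exact Ht; rewrite Rminus_diag, Rabs_R0; apply de.
Qed.

Lemma locally_strip (y0 d y : R) : Rabs (y - y0) < d -> locally y (fun t => Rabs (t - y0) < d).
Proof.
intros Hy. exists (mkposreal (d - Rabs (y - y0)) ltac:(lra)). intros t Ht.
change (Rabs (t - y) < d - Rabs (y - y0)) in Ht.
replace (t - y0) with ((t - y) + (y - y0)) by ring.
eapply Rle_lt_trans; [apply Rabs_triang|lra].
Qed.

(** A strip is simply connected, so a closed form on it is exact: the potential integrates [g] along
    [x = 0] and then [f] along a horizontal line. Differentiating under the integral sign turns [fy]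
    into [gx], whose integral restores [g]. *)
Lemma strip_potential (f g fy gx : R -> R -> R) (y0 d : R) :
  0 < d ->
  (forall x y, Rabs (y - y0) < d ->
     is_derive (fun t => f x t) y (fy x y) /\ is_derive (fun t => g t y) x (gx x y) /\
     fy x y = gx x y /\ continuity_2d_pt f x y /\ continuity_2d_pt g x y /\
     continuity_2d_pt fy x y) ->
  exists phi : R -> R -> R,
    forall x y, Rabs (y - y0) < d ->
      is_derive (fun t => phi t y) x (f x y) /\ is_derive (fun t => phi x t) y (g x y).
Proof.
intros Hd H.
assert (Hcx : forall x y, Rabs (y - y0) < d -> continuous (fun t => f t y) x).
{ intros x y Hy. apply continuity_2d_pt_sections, H, Hy. }
assert (Hcy : forall x y, Rabs (y - y0) < d -> continuous (fun t => g x t) y).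
{ intros x y Hy. apply continuity_2d_pt_sections, H, Hy. }
assert (Hcgx : forall x y, Rabs (y - y0) < d -> continuous (fun t => gx t y) x).
{ intros x y Hy. apply continuous_ext with (fun t => fy t y).
  { intros t. apply (H t y Hy). }
  apply continuity_2d_pt_sections, H, Hy. }
assert (Hloc := locally_strip y0 d).
exists (fun x y => RInt (fun s => f s y) 0 x + RInt (fun s => g 0 s) y0 y).
intros x y Hy. split.
- rewrite <- (Rplus_0_r (f x y)).
  apply (is_derive_plus (fun t => RInt (fun s => f s y) 0 t) (fun _ => RInt (fun s => g 0 s) y0 y));
    [|apply (is_derive_const (V := R_NormedModule))].
  apply (is_derive_RInt (fun s => f s y)) with 0; [|apply Hcx, Hy].
  apply filter_forall. intros b. apply (RInt_correct (V := R_CompleteNormedModule)).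
  apply (ex_RInt_continuous (V := R_CompleteNormedModule)). intros; apply Hcx, Hy.
- replace (g x y) with ((g x y - g 0 y) + g 0 y) by ring.
  apply (is_derive_plus (fun t => RInt (fun s => f s t) 0 x) (fun t => RInt (fun s => g 0 s) y0 t)).
  + replace (g x y - g 0 y) with (RInt (fun s => Derive (fun u => f s u) y) 0 x).
    * apply (is_derive_RInt_param (fun u s => f s u) 0 x y).
      -- generalize (Hloc y Hy). apply filter_imp. intros u Hu t _.
         exists (fy t u). apply (H t u Hu).
      -- intros t _. apply continuity_2d_pt_ext_loc with (fun u v => fy v u).
         ++ destruct (Hloc y Hy) as [e He]. exists e. intros u v Hu Hv.
            symmetry. apply is_derive_unique, (H v u), He, Hu.
         ++ destruct (H t y Hy) as (_&_&_&_&_&Hc). intros eps.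
            destruct (Hc eps) as [de Hde]. exists de. intros u v Hu Hv. apply Hde; auto.
      -- generalize (Hloc y Hy). apply filter_imp. intros u Hu.
         apply (ex_RInt_continuous (V := R_CompleteNormedModule)). intros; apply Hcx, Hu.
    * rewrite (RInt_ext _ (fun s => gx s y)).
      2:{ intros s _. rewrite <- (proj1 (proj2 (proj2 (H s y Hy)))).
          apply is_derive_unique, (H s y Hy). }
      apply is_RInt_unique. 
      apply (is_RInt_derive (fun s => g s y)).
      -- intros s _. apply (H s y Hy).
      -- intros s _. apply Hcgx, Hy.
  + apply (is_derive_RInt (fun s => g 0 s)) with y0; [|apply Hcy, Hy].
    generalize (Hloc y Hy). apply filter_imp. intros b Hb.
    apply (RInt_correct (V := R_CompleteNormedModule)).
    apply (ex_RInt_continuous (V := R_CompleteNormedModule)). intros s Hs. apply Hcy.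
    assert (Rabs (s - y0) <= Rabs (b - y0)); [|lra].
    revert Hs. unfold Rmin, Rmax. destruct (Rle_dec y0 b); intros Hs; split_Rabs; lra.
Qed.

Definition gradient_on (y0 d : R) (phi f g : R -> R -> R) : Prop :=
  forall x y, Rabs (y - y0) < d ->
    is_derive (fun t => phi t y) x (f x y) /\ is_derive (fun t => phi x t) y (g x y).

Lemma gradient_differentiable (y0 d : R) (phi f g : R -> R -> R) (x y : R) :
  gradient_on y0 d phi f g -> Rabs (y - y0) < d -> continuity_2d_pt f x y ->
  differentiable_pt_lim phi x y (f x y) (g x y).
Proof.
intros Hg Hy Hc. apply filterdiff_differentiable_pt_lim, (is_derive_filterdiff phi x y f (g x y)).
- destruct (locally_strip _ _ _ Hy) as [e He]. exists e. intros [u v] [Hu Hv]. simpl.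
  apply Hg, He, Hv.
- apply Hg, Hy.
- apply continuity_2d_pt_filterlim, Hc.
Qed.

Lemma gradient_chain (y0 d : R) (phi f g : R -> R -> R) (x y : R -> R) (t dx dy : R) :
  gradient_on y0 d phi f g ->
  Rabs (y t - y0) < d -> continuity_2d_pt f (x t) (y t) ->
  is_derive x t dx -> is_derive y t dy ->
  is_derive (fun s => phi (x s) (y s)) t (f (x t) (y t) * dx + g (x t) (y t) * dy).
Proof.
intros Hg Hy Hc Hx' Hy'. apply is_derive_Reals.
apply derivable_pt_lim_comp_2d; [|apply is_derive_Reals, Hx'|apply is_derive_Reals, Hy'].
apply (gradient_differentiable y0 d); assumption.
Qed.

(* The mean value theorem in each variable, along the path (x1,y1), (x2,y1), (x2,y2). *)
Lemma gradient_increment (y0 d : R) (phi f g : R -> R -> R) (x1 y1 x2 y2 : R) :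
  gradient_on y0 d phi f g -> Rabs (y1 - y0) < d -> Rabs (y2 - y0) < d ->
  exists xc yc, Rmin x1 x2 <= xc <= Rmax x1 x2 /\ Rmin y1 y2 <= yc <= Rmax y1 y2 /\
    phi x2 y2 - phi x1 y1 = f xc y1 * (x2 - x1) + g x2 yc * (y2 - y1).
Proof.
intros Hg H1 H2.
destruct (MVT_gen (fun t => phi t y1) x1 x2 (fun t => f t y1)) as [xc [Hxc E1]].
{ intros t _. apply Hg, H1. }
{ intros t _. apply continuity_pt_filterlim, (ex_derive_continuous (fun s => phi s y1)).
  exists (f t y1). apply (Hg t y1 H1). }
assert (Hin : forall t, Rmin y1 y2 <= t <= Rmax y1 y2 -> Rabs (t - y0) < d).
{ intros t. unfold Rmin, Rmax. destruct (Rle_dec y1 y2); intros Ht; split_Rabs; lra. }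
destruct (MVT_gen (fun t => phi x2 t) y1 y2 (fun t => g x2 t)) as [yc [Hyc E2]].
{ intros t Ht. apply Hg, Hin. lra. }
{ intros t Ht. apply continuity_pt_filterlim, (ex_derive_continuous (fun s => phi x2 s)).
  exists (g x2 t). apply (Hg x2 t), Hin, Ht. }
exists xc, yc. split; [exact Hxc|]. split; [exact Hyc|]. lra.
Qed.

Lemma in_strip_between (y0 d y1 y2 t : R) :
  Rabs (y1 - y0) < d -> Rabs (y2 - y0) < d -> Rmin y1 y2 <= t <= Rmax y1 y2 ->
  Rabs (t - y0) < d.
Proof.
unfold Rmin, Rmax. destruct (Rle_dec y1 y2); intros; split_Rabs; lra.
Qed.

Lemma gradient_lipschitz (y0 d K : R) (phi f g : R -> R -> R) :
  gradient_on y0 d phi f g ->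
  (forall x y, Rabs (y - y0) < d -> Rabs (f x y) <= K /\ Rabs (g x y) <= K) ->
  forall x1 y1 x2 y2, Rabs (y1 - y0) < d -> Rabs (y2 - y0) < d ->
    Rabs (phi x1 y1 - phi x2 y2) <= K * (Rabs (x1 - x2) + Rabs (y1 - y2)).
Proof.
intros Hg HK x1 y1 x2 y2 H1 H2.
destruct (gradient_increment _ _ _ _ _ x2 y2 x1 y1 Hg H2 H1) as (xc & yc & Hxc & Hyc & ->).
eapply Rle_trans; [apply Rabs_triang|]. rewrite !Rabs_mult, Rmult_plus_distr_l.
apply Rplus_le_compat; (apply Rmult_le_compat_r; [apply Rabs_pos|]).
- apply HK, H2.
- apply HK, (in_strip_between _ _ y2 y1); auto.
Qed.

(** Strict differentiability: both points vary near [(x, y)], so the remainder is Lipschitz with a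
    small constant. The C^1 estimates on return maps rest on this form. *)
Lemma gradient_strict (y0 d : R) (phi f g : R -> R -> R) (x y kap : R) :
  gradient_on y0 d phi f g -> Rabs (y - y0) < d ->
  continuity_2d_pt f x y -> continuity_2d_pt g x y -> 0 < kap ->
  exists r, 0 < r /\ forall x1 y1 x2 y2,
    Rabs (x1 - x) < r -> Rabs (y1 - y) < r -> Rabs (x2 - x) < r -> Rabs (y2 - y) < r ->
    Rabs (phi x1 y1 - phi x2 y2 - (f x y * (x1 - x2) + g x y * (y1 - y2)))
      <= kap * (Rabs (x1 - x2) + Rabs (y1 - y2)).
Proof.
intros Hg Hy Hf Hgc Hk.
destruct (Hf (mkposreal kap Hk)) as [r1 Hr1]. destruct (Hgc (mkposreal kap Hk)) as [r2 Hr2].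
destruct (locally_strip _ _ _ Hy) as [r3 Hr3].
exists (Rmin (Rmin r1 r2) r3). split.
{ repeat apply Rmin_glb_lt; apply cond_pos. }
intros x1 y1 x2 y2 A1 B1 A2 B2.
assert (Hm : forall s, s < Rmin (Rmin r1 r2) r3 -> s < r1 /\ s < r2 /\ s < r3).
{ intros s Hs. generalize (Rmin_l (Rmin r1 r2) r3) (Rmin_r (Rmin r1 r2) r3) (Rmin_l r1 r2) (Rmin_r r1 r2).
  lra. }
apply Hm in A1, B1, A2, B2.
destruct (gradient_increment _ _ _ _ _ x2 y2 x1 y1 Hg) as (xc & yc & Hxc & Hyc & ->).
{ apply Hr3, B2. } { apply Hr3, B1. }
replace (f xc y2 * (x1 - x2) + g x1 yc * (y1 - y2) - (f x y * (x1 - x2) + g x y * (y1 - y2)))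
  with ((f xc y2 - f x y) * (x1 - x2) + (g x1 yc - g x y) * (y1 - y2)) by ring.
eapply Rle_trans; [apply Rabs_triang|]. rewrite !Rabs_mult, Rmult_plus_distr_l.
assert (Hxc' : Rabs (xc - x) < r1).
{ apply (in_strip_between _ _ x2 x1); [apply A2|apply A1|exact Hxc]. }
assert (Hyc' : Rabs (yc - y) < r2).
{ apply (in_strip_between _ _ y2 y1); [apply B2|apply B1|exact Hyc]. }
apply Rplus_le_compat; (apply Rmult_le_compat_r; [apply Rabs_pos|]); left.
- apply Hr1; [exact Hxc'|apply B2].
- apply Hr2; [apply A1|exact Hyc'].
Qed.

(** * The fields in logarithmic polar coordinates *)

(* In the coordinate [zeta = x + i y], [z - 1 = exp (- i zeta)], the system
   [z' = - i (z - 1) + eps * sum_m c_m (z - 1)^m] reads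
   [x' = 1 + eps * fieldA], [y' = eps * fieldB]. *)
Definition fieldA (c : nat -> R) (x y : R) : R :=
  - c 0%nat * exp (- y) * sin x + c 2%nat * exp y * sin x
  + c 3%nat * (exp y * exp y) * (2 * sin x * cos x).
Definition fieldB (c : nat -> R) (x y : R) : R :=
  c 0%nat * exp (- y) * cos x + c 1%nat + c 2%nat * exp y * cos x
  + c 3%nat * (exp y * exp y) * (cos x * cos x - sin x * sin x).
Definition fieldA' (c : nat -> R) (x y : R) : R :=
  - c 0%nat * exp (- y) * cos x + c 2%nat * exp y * cos x
  + 2 * c 3%nat * (exp y * exp y) * (cos x * cos x - sin x * sin x).
Definition fieldB' (c : nat -> R) (x y : R) : R :=
  - c 0%nat * exp (- y) * sin x - c 2%nat * exp y * sin x
  - 4 * c 3%nat * (exp y * exp y) * (sin x * cos x).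

(* Imaginary part of a primitive of [fieldA + i fieldB]. *)
Definition kappa (c : nat -> R) (x y : R) : R :=
  c 0%nat * exp (- y) * sin x + c 1%nat * x + c 2%nat * exp y * sin x
  + c 3%nat * (exp y * exp y) * (sin x * cos x).

Ltac cont2d :=
  repeat first
   [ apply continuity_2d_pt_const | apply continuity_2d_pt_id1 | apply continuity_2d_pt_id2
   | apply (continuity_2d_pt_plus _ _ _ _) | apply (continuity_2d_pt_minus _ _ _ _)
   | apply (continuity_2d_pt_opp _ _ _) | apply (continuity_2d_pt_mult _ _ _ _)
   | apply (continuity_1d_2d_pt_comp exp); [apply derivable_continuous_pt, derivable_pt_exp|]
   | apply (continuity_1d_2d_pt_comp sin); [apply continuity_sin|]
   | apply (continuity_1d_2d_pt_comp cos); [apply continuity_cos|] ].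

Lemma fieldA_cont c x y : continuity_2d_pt (fieldA c) x y.
Proof. unfold fieldA. cont2d. Qed.
Lemma fieldB_cont c x y : continuity_2d_pt (fieldB c) x y.
Proof. unfold fieldB. cont2d. Qed.
Lemma fieldA'_cont c x y : continuity_2d_pt (fieldA' c) x y.
Proof. unfold fieldA'. cont2d. Qed.
Lemma fieldB'_cont c x y : continuity_2d_pt (fieldB' c) x y.
Proof. unfold fieldB'. cont2d. Qed.

Lemma fieldA_dx c x y : is_derive (fun t => fieldA c t y) x (fieldA' c x y).
Proof. unfold fieldA, fieldA'. auto_derive; auto. ring. Qed.
Lemma fieldB_dx c x y : is_derive (fun t => fieldB c t y) x (fieldB' c x y).
Proof. unfold fieldB, fieldB'. auto_derive; auto. ring. Qed.
(** With the two derivatives in [x] above, this and the next lemma are the Cauchy-Riemann equations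
    of [fieldA + i fieldB], the source of all closed forms below. *)
Lemma fieldA_dy c x y : is_derive (fun t => fieldA c x t) y (- fieldB' c x y).
Proof. unfold fieldA, fieldB'. auto_derive; auto. ring. Qed.
Lemma fieldB_dy c x y : is_derive (fun t => fieldB c x t) y (fieldA' c x y).
Proof. unfold fieldB, fieldA'. auto_derive; auto. ring. Qed.
Lemma kappa_dx c x y : is_derive (fun t => kappa c t y) x (fieldB c x y).
Proof. unfold kappa, fieldB. auto_derive; auto. ring. Qed.
Lemma kappa_dy c x y : is_derive (fun t => kappa c x t) y (fieldA c x y).
Proof. unfold kappa, fieldA. auto_derive; auto. ring. Qed.

Lemma field_bounded (c : nat -> R) (y0 : R) :
  exists K, 0 < K /\ forall x y, Rabs (y - y0) < 1 ->
    Rabs (fieldA c x y) <= K /\ Rabs (fieldB c x y) <= K.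
Proof.
set (E := exp (Rabs y0 + 1)).
set (K := Rabs (c 0%nat) * E + Rabs (c 1%nat) + Rabs (c 2%nat) * E + 2 * Rabs (c 3%nat) * (E * E)).
assert (HE : 0 < E) by apply exp_pos.
assert (Hc : forall m, 0 <= Rabs (c m)) by (intros; apply Rabs_pos).
assert (HK : 0 <= K).
{ unfold K. repeat apply Rplus_le_le_0_compat; repeat apply Rmult_le_pos; auto; lra. }
exists (K + 1). split; [lra|]. intros x y Hy.
assert (B1 : exp y <= E).
{ left. apply exp_increasing. split_Rabs; lra. }
assert (B2 : exp (- y) <= E).
{ left. apply exp_increasing. split_Rabs; lra. }
assert (P1 := exp_pos y). assert (P2 := exp_pos (- y)).
assert (S1 := SIN_bound x). assert (S2 := COS_bound x).
assert (S3 := sin2_cos2 x). unfold Rsqr in S3.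
assert (Q0 := Rle_0_sqr (sin x + cos x)). assert (Q1 := Rle_0_sqr (sin x - cos x)).
assert (Q5 := Rle_0_sqr (sin x)). assert (Q6 := Rle_0_sqr (cos x)). unfold Rsqr in *.
assert (D1 : Rabs (2 * sin x * cos x) <= 1) by (apply Rabs_le; lra).
assert (D2 : Rabs (cos x * cos x - sin x * sin x) <= 1) by (apply Rabs_le; lra).
assert (D3 : Rabs (sin x) <= 1) by (apply Rabs_le; lra).
assert (D4 : Rabs (cos x) <= 1) by (apply Rabs_le; lra).
assert (B3 : exp y * exp y <= E * E) by (apply Rmult_le_compat; lra).
assert (M3 : forall m u s V, 0 < u <= V -> Rabs s <= 1 -> Rabs (c m * u * s) <= Rabs (c m) * V).
{ intros m u s V [Hu Hu'] Hs. rewrite !Rabs_mult. rewrite (Rabs_right u) by lra.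
  rewrite Rmult_assoc. apply Rmult_le_compat_l; [apply Rabs_pos|].
  rewrite <- (Rmult_1_r V). apply Rmult_le_compat; try lra. apply Rabs_pos. }
assert (P3 : 0 < exp y * exp y) by nra.
assert (Q3 : 0 <= Rabs (c 3%nat) * (E * E)) by (repeat apply Rmult_le_pos; auto; lra).
assert (Q2 := Hc 1%nat).
split.
- unfold fieldA.
  assert (T0 := M3 0%nat (exp (- y)) (sin x) E (conj P2 B2) D3).
  assert (T2 := M3 2%nat (exp y) (sin x) E (conj P1 B1) D3).
  assert (T3 := M3 3%nat (exp y * exp y) _ (E * E) (conj P3 B3) D1).
  unfold K. rewrite <- Ropp_mult_distr_l.
  rewrite <- Ropp_mult_distr_l.
  revert T0 T2 T3 Q3 Q2. generalize (c 0%nat * exp (- y) * sin x) (c 2%nat * exp y * sin x)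
    (c 3%nat * (exp y * exp y) * (2 * sin x * cos x)).
  intros u v w. intros.
  apply Rle_trans with (Rabs u + Rabs v + Rabs w); [|lra]. rewrite <- (Rabs_Ropp u).
  eapply Rle_trans; [apply Rabs_triang|]. apply Rplus_le_compat_r, Rabs_triang.
- unfold fieldB.
  assert (T0 := M3 0%nat (exp (- y)) (cos x) E (conj P2 B2) D4).
  assert (T2 := M3 2%nat (exp y) (cos x) E (conj P1 B1) D4).
  assert (T3 := M3 3%nat (exp y * exp y) _ (E * E) (conj P3 B3) D2).
  unfold K.
  revert T0 T2 T3 Q3 Q2. generalize (c 0%nat * exp (- y) * cos x) (c 2%nat * exp y * cos x)
    (c 3%nat * (exp y * exp y) * (cos x * cos x - sin x * sin x)).
  intros u v w. intros.
  apply Rle_trans with (Rabs u + Rabs (c 1%nat) + Rabs v + Rabs w); [|lra].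
  eapply Rle_trans; [apply Rabs_triang|]. apply Rplus_le_compat_r.
  eapply Rle_trans; [apply Rabs_triang|]. apply Rplus_le_compat_r.
  apply Rabs_triang.
Qed.

(* [gradU + i gradV = (1 / (1 + e k) - 1) / e] with [k = fieldA + i fieldB]. *)
Definition gradN (c : nat -> R) (e x y : R) : R :=
  (1 + e * fieldA c x y) * (1 + e * fieldA c x y)
  + (e * fieldB c x y) * (e * fieldB c x y).
Definition gradU (c : nat -> R) (e x y : R) : R :=
  - (fieldA c x y + e * (fieldA c x y * fieldA c x y + fieldB c x y * fieldB c x y))
  / gradN c e x y.
Definition gradV (c : nat -> R) (e x y : R) : R := - fieldB c x y / gradN c e x y.

(** Real and imaginary parts of the derivative [- k' / (1 + e k)^2] of [(1 / (1 + e k) - 1) / e],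
    taken along a real line so that one statement serves both variables. *)
Lemma mobius_derive (e : R) (A B : R -> R) (t da db : R) :
  is_derive A t da -> is_derive B t db ->
  let a := 1 + e * A t in let b := e * B t in
  a * a + b * b <> 0 ->
  is_derive (fun s => - (A s + e * (A s * A s + B s * B s))
     / ((1 + e * A s) * (1 + e * A s) + (e * B s) * (e * B s))) t
    (- (da * (a * a - b * b) + db * (2 * a * b)) / ((a * a + b * b) * (a * a + b * b))) /\
  is_derive (fun s => - B s / ((1 + e * A s) * (1 + e * A s) + (e * B s) * (e * B s))) t
    (- (db * (a * a - b * b) - da * (2 * a * b)) / ((a * a + b * b) * (a * a + b * b))).
Proof.
intros HA HB a b HN. unfold a, b in *.
assert (EA := is_derive_unique _ _ _ HA). assert (EB := is_derive_unique _ _ _ HB).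
split; auto_derive; repeat split; try (eexists; eassumption); try exact HN;
 replace (Derive (fun x => A x) t) with da by (symmetry; exact EA);
 replace (Derive (fun x => B x) t) with db by (symmetry; exact EB);
 field; exact HN.
Qed.

Lemma gradN_pos (c : nat -> R) (e x y K : R) :
  Rabs (fieldA c x y) <= K -> Rabs e * K <= 1 / 4 -> 9 / 16 <= gradN c e x y.
Proof.
intros HA He. unfold gradN.
assert (Rabs (e * fieldA c x y) <= 1 / 4).
{ rewrite Rabs_mult. eapply Rle_trans; [|exact He].
  apply Rmult_le_compat_l; [apply Rabs_pos|exact HA]. }
assert (3 / 4 <= 1 + e * fieldA c x y) by (revert H; split_Rabs; lra).
nra.
Qed.

Lemma gradU_cont c e x y : gradN c e x y <> 0 -> continuity_2d_pt (gradU c e) x y.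
Proof.
intros HN. unfold gradU, Rdiv.
apply (continuity_2d_pt_mult (fun x y => - (fieldA c x y + e * (fieldA c x y * fieldA c x y + fieldB c x y * fieldB c x y))) (fun x y => / gradN c e x y)).
2: apply (continuity_2d_pt_inv (gradN c e)); [unfold gradN|exact HN].
all: cont2d; first [apply fieldA_cont|apply fieldB_cont].
Qed.

Lemma gradV_cont c e x y : gradN c e x y <> 0 -> continuity_2d_pt (gradV c e) x y.
Proof.
intros HN. unfold gradV, Rdiv.
apply (continuity_2d_pt_mult (fun x y => - fieldB c x y) (fun x y => / gradN c e x y)).
2: apply (continuity_2d_pt_inv (gradN c e)); [unfold gradN|exact HN].
all: cont2d; first [apply fieldA_cont|apply fieldB_cont].
Qed.

(** [p + i q] is a holomorphic primitive of [gradU + i gradV], whose real and imaginary parts exist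
    because the Cauchy-Riemann equations make both forms closed. The normalization of [q] matches
    [kappa], which vanishes at [x = 0]. *)
Lemma grad_primitive (c : nat -> R) (e y0 : R) :
  (forall x y, Rabs (y - y0) < 1 -> gradN c e x y <> 0) ->
  exists p q : R -> R -> R,
    gradient_on y0 1 p (gradU c e) (fun x y => - gradV c e x y) /\
    gradient_on y0 1 q (gradV c e) (gradU c e) /\ q 0 y0 = 0.
Proof.
intros HN.
set (a := fun x y => 1 + e * fieldA c x y). set (b := fun x y => e * fieldB c x y).
(* [D] is the real part of [- k' / (1 + e k)^2] for [k' = da + i db]; fed with [- i k'], that is
   with [db] and [- da], it returns the imaginary part. *)
set (D := fun da db x y : R => - (da * (a x y * a x y - b x y * b x y) + db * (2 * a x y * b x y))
   / (gradN c e x y * gradN c e x y)).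
assert (Ux : forall x y, Rabs (y - y0) < 1 ->
  is_derive (fun t => gradU c e t y) x (D (fieldA' c x y) (fieldB' c x y) x y) /\
  is_derive (fun t => gradV c e t y) x (D (fieldB' c x y) (- fieldA' c x y) x y)).
{ intros x y Hy.
  destruct (mobius_derive e (fun t => fieldA c t y) (fun t => fieldB c t y) x _ _
     (fieldA_dx c x y) (fieldB_dx c x y) (HN x y Hy)) as [h1 h2].
  split; [exact h1|]. unfold D.
  replace (- (fieldB' c x y * (a x y * a x y - b x y * b x y) + - fieldA' c x y * (2 * a x y * b x y)))
   with (- (fieldB' c x y * (a x y * a x y - b x y * b x y) - fieldA' c x y * (2 * a x y * b x y))) by ring.
  exact h2. }
assert (Uy : forall x y, Rabs (y - y0) < 1 ->
  is_derive (fun t => gradU c e x t) y (- D (fieldB' c x y) (- fieldA' c x y) x y) /\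
  is_derive (fun t => gradV c e x t) y (D (fieldA' c x y) (fieldB' c x y) x y)).
{ intros x y Hy.
  destruct (mobius_derive e (fun t => fieldA c x t) (fun t => fieldB c x t) y _ _
     (fieldA_dy c x y) (fieldB_dy c x y) (HN x y Hy)) as [h1 h2].
  split.
  - replace (- D (fieldB' c x y) (- fieldA' c x y) x y) with (- (- fieldB' c x y * (a x y * a x y - b x y * b x y) + fieldA' c x y * (2 * a x y * b x y)) / (gradN c e x y * gradN c e x y)); [exact h1|].
    unfold D, Rdiv. ring.
  - replace (D (fieldA' c x y) (fieldB' c x y) x y) with (- (fieldA' c x y * (a x y * a x y - b x y * b x y) - - fieldB' c x y * (2 * a x y * b x y)) / (gradN c e x y * gradN c e x y)); [exact h2|].
    unfold D, Rdiv. ring. }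
assert (DC : forall f g x y, Rabs (y - y0) < 1 -> continuity_2d_pt f x y -> continuity_2d_pt g x y ->
  continuity_2d_pt (fun x y => D (f x y) (g x y) x y) x y).
{ intros f g x y Hy Hf Hg. unfold D, Rdiv, a, b.
  apply (continuity_2d_pt_mult (fun x y => - (f x y * ((1 + e * fieldA c x y) * (1 + e * fieldA c x y) - e * fieldB c x y * (e * fieldB c x y)) + g x y * (2 * (1 + e * fieldA c x y) * (e * fieldB c x y)))) (fun x y => / (gradN c e x y * gradN c e x y))).
  2: apply (continuity_2d_pt_inv (fun x y => gradN c e x y * gradN c e x y)); [unfold gradN|].
  3: apply Rmult_integral_contrapositive; split; apply HN, Hy.
  all: cont2d; first [exact Hf|exact Hg|apply fieldA_cont|apply fieldB_cont]. }
destruct (strip_potential (gradU c e) (fun x y => - gradV c e x y)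
  (fun x y => - D (fieldB' c x y) (- fieldA' c x y) x y)
  (fun x y => - D (fieldB' c x y) (- fieldA' c x y) x y) y0 1 Rlt_0_1) as [p Hp].
{ intros x y Hy. split; [apply Uy, Hy|]. split; [apply (is_derive_opp (fun t => gradV c e t y)), Ux, Hy|].
  split; [reflexivity|]. split; [apply gradU_cont, HN, Hy|].
  split; [apply continuity_2d_pt_opp, gradV_cont, HN, Hy|].
  apply continuity_2d_pt_opp, (DC (fieldB' c) (fun x y => - fieldA' c x y)); [exact Hy|apply fieldB'_cont|].
  apply continuity_2d_pt_opp, fieldA'_cont. }
destruct (strip_potential (gradV c e) (gradU c e)
  (fun x y => D (fieldA' c x y) (fieldB' c x y) x y)
  (fun x y => D (fieldA' c x y) (fieldB' c x y) x y) y0 1 Rlt_0_1) as [q Hq].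
{ intros x y Hy. split; [apply Uy, Hy|]. split; [apply Ux, Hy|].
  split; [reflexivity|]. split; [apply gradV_cont, HN, Hy|].
  split; [apply gradU_cont, HN, Hy|].
  apply (DC (fieldA' c) (fieldB' c)); [exact Hy|apply fieldA'_cont|apply fieldB'_cont]. }
exists p, (fun x y => q x y - q 0 y0). split; [exact Hp|]. split; [|ring].
intros x y Hy. destruct (Hq x y Hy) as [q1 q2].
split; [rewrite <- (Rminus_0_r (gradV c e x y))|rewrite <- (Rminus_0_r (gradU c e x y))].
- apply (is_derive_minus (fun t => q t y) (fun _ => q 0 y0)); [exact q1|].
  apply (is_derive_const (V := R_NormedModule)).
- apply (is_derive_minus (fun t => q x t) (fun _ => q 0 y0)); [exact q2|].
  apply (is_derive_const (V := R_NormedModule)).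
Qed.

(** The bound [9/16 <= gradN] makes [1 / gradN] at most 2, whence the size [4 K]. The last two
    bounds are the expansion [(1 / (1 + e k) - 1) / e = - k + O(e)], which later makes [- kappa] the
    leading term of [q]. *)
Lemma grad_bounds (c : nat -> R) (e x y K : R) :
  0 < K -> Rabs (fieldA c x y) <= K -> Rabs (fieldB c x y) <= K -> Rabs e * K <= 1 / 4 ->
  Rabs (gradU c e x y) <= 4 * K /\ Rabs (gradV c e x y) <= 4 * K /\
  Rabs (gradU c e x y + fieldA c x y) <= 40 * K * K * Rabs e /\
  Rabs (gradV c e x y + fieldB c x y) <= 40 * K * K * Rabs e.
Proof.
intros HK HA HB He. assert (HN := gradN_pos _ _ _ _ _ HA He).
assert (HN0 : gradN c e x y <> 0) by lra.
assert (Hi : 0 < / gradN c e x y <= 2).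
{ split; [apply Rinv_0_lt_compat; lra|]. rewrite <- (Rinv_inv 2).
  apply Rinv_le_contravar; lra. }
set (A := fieldA c x y) in *. set (B := fieldB c x y) in *.
assert (He0 := Rabs_pos e). 
assert (HeA : Rabs (e * A) <= 1 / 4).
{ rewrite Rabs_mult. eapply Rle_trans; [|exact He]. apply Rmult_le_compat_l; auto. }
assert (HeB : Rabs (e * B) <= 1 / 4).
{ rewrite Rabs_mult. eapply Rle_trans; [|exact He]. apply Rmult_le_compat_l; auto. }
assert (HeA' : Rabs (e * A) <= Rabs e * K).
{ rewrite Rabs_mult. apply Rmult_le_compat_l; auto. }
assert (HeB' : Rabs (e * B) <= Rabs e * K).
{ rewrite Rabs_mult. apply Rmult_le_compat_l; auto. }
assert (Hdiv : forall u M, Rabs u <= M -> Rabs (u / gradN c e x y) <= 2 * M).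
{ intros u M Hu. unfold Rdiv. rewrite Rabs_mult, (Rabs_right (/ gradN c e x y)) by lra.
  assert (0 <= Rabs u) by apply Rabs_pos. nra. }
assert (Hm : forall u v M M', Rabs u <= M -> Rabs v <= M' -> Rabs (u * v) <= M * M').
{ intros. rewrite Rabs_mult. apply Rmult_le_compat; auto; apply Rabs_pos. }
assert (Ht : forall u v M M', Rabs u <= M -> Rabs v <= M' -> Rabs (u + v) <= M + M').
{ intros. eapply Rle_trans; [apply Rabs_triang|lra]. }
assert (HKe : 0 <= Rabs e * K) by nra.
split; [|split; [|split]].
- unfold gradU. fold A B. replace (4 * K) with (2 * (2 * K)) by ring. apply Hdiv.
  rewrite Rabs_Ropp. replace (A + e * (A * A + B * B)) with (A + (e * A * A + e * B * B)) by ring.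
  eapply Rle_trans; [apply (Ht _ _ K (1 / 4 * K + 1 / 4 * K)); auto|lra].
- unfold gradV. fold B. eapply Rle_trans; [apply (Hdiv _ K); rewrite Rabs_Ropp; auto|lra].
- replace (gradU c e x y + A) with
   ((e * A * A - e * B * B + (e * A * (e * A) + e * B * (e * B)) * A) / gradN c e x y).
  2:{ unfold gradU. fold A B. unfold gradN in *. fold A B in HN0 |- *. field. exact HN0. }
  replace (40 * K * K * Rabs e) with (2 * (20 * (Rabs e * K * K))) by ring. apply Hdiv.
  eapply Rle_trans.
  { apply (Ht _ _ (Rabs e * K * K + Rabs e * K * K) ((Rabs e * K * (1/4) + Rabs e * K * (1/4)) * K)).
    - unfold Rminus. apply Ht; [auto|rewrite Rabs_Ropp; auto].
    - apply Hm; [apply Ht|]; auto. }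
  assert (0 <= Rabs e * K * K) by nra. lra.
- replace (gradV c e x y + B) with
   ((e * A * B + e * A * B + (e * A * (e * A) + e * B * (e * B)) * B) / gradN c e x y).
  2:{ unfold gradV. fold A B. unfold gradN in *. fold A B in HN0 |- *. field. exact HN0. }
  replace (40 * K * K * Rabs e) with (2 * (20 * (Rabs e * K * K))) by ring. apply Hdiv.
  eapply Rle_trans.
  { apply (Ht _ _ (Rabs e * K * K + Rabs e * K * K) ((Rabs e * K * (1/4) + Rabs e * K * (1/4)) * K)).
    - apply Ht; auto.
    - apply Hm; [apply Ht|]; auto. }
  assert (0 <= Rabs e * K * K) by nra. lra.
Qed.

(** * Inverting near-identity maps of the plane *)

Definition dist1 (u v : R * R) : R := Rabs (fst u - fst v) + Rabs (snd u - snd v).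

Lemma dist1_triang u v w : dist1 u w <= dist1 u v + dist1 v w.
Proof.
unfold dist1.
assert (h1 := Rabs_triang (fst u - fst v) (fst v - fst w)).
assert (h2 := Rabs_triang (snd u - snd v) (snd v - snd w)).
replace (fst u - fst v + (fst v - fst w)) with (fst u - fst w) in h1 by ring.
replace (snd u - snd v + (snd v - snd w)) with (snd u - snd w) in h2 by ring.
lra.
Qed.

Lemma dist1_pos u v : 0 <= dist1 u v.
Proof. unfold dist1. generalize (Rabs_pos (fst u - fst v)) (Rabs_pos (snd u - snd v)). lra. Qed.

Lemma dist1_sym u v : dist1 u v = dist1 v u.
Proof. unfold dist1. rewrite (Rabs_minus_sym (fst u)), (Rabs_minus_sym (snd u)). reflexivity. Qed.

Lemma contraction_fixpoint (T : R * R -> R * R) :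
  (forall u v, dist1 (T u) (T v) <= / 2 * dist1 u v) -> exists w, T w = w.
Proof.
intros HT.
set (s := fix s n := match n with O => (0, 0) | S m => T (s m) end).
set (d := dist1 (T (s O)) (s O)).
assert (H0 : forall k, dist1 (s k) (s O) <= 2 * d).
{ induction k as [|k IH].
  - replace (dist1 (s O) (s O)) with 0 by (unfold dist1; rewrite !Rminus_diag, Rabs_R0; ring).
    assert (h := dist1_pos (T (s O)) (s O)). unfold d. lra.
  - assert (h := dist1_triang (T (s k)) (T (s O)) (s O)). assert (h' := HT (s k) (s O)).
    change (s (S k)) with (T (s k)). fold d in h. lra. }
assert (H1 : forall n k, dist1 (s (n + k)%nat) (s n) <= (/ 2) ^ n * (2 * d)).
{ induction n as [|n IH]; intros k.
  - simpl pow. rewrite Rmult_1_l. apply H0.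
  - change (s (S n + k)%nat) with (T (s (n + k)%nat)). change (s (S n)) with (T (s n)).
    assert (h := HT (s (n + k)%nat) (s n)). assert (h' := IH k). simpl pow. lra. }
assert (Hz : forall e, 0 < e -> exists n, (/ 2) ^ n * (2 * d) < e).
{ intros e He. assert (Hd : 0 <= d) by apply dist1_pos.
  destruct (pow_lt_1_zero (/ 2) ltac:(rewrite Rabs_right; lra) (e / (2 * d + 1))) as [n Hn].
  { apply Rdiv_lt_0_compat; lra. }
  exists n. assert (h := Hn n (Nat.le_refl n)). 
  assert (0 < (/ 2) ^ n) by (apply pow_lt; lra).
  rewrite Rabs_right in h by lra. apply Rlt_div_r in h; [|lra]. nra. }
assert (Hcau : forall (f : R * R -> R), (forall u v, Rabs (f u - f v) <= dist1 u v) ->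
   ex_finite_lim_seq (fun n => f (s n))).
{ intros f Hf. apply ex_lim_seq_cauchy_corr. intros eps.
  destruct (Hz (eps / 2) ltac:(generalize (cond_pos eps); lra)) as [N HN].
  exists N. intros n m Hn Hm.
  assert (a1 := H1 N (n - N)%nat). assert (a2 := H1 N (m - N)%nat).
  replace (N + (n - N))%nat with n in a1 by lia. replace (N + (m - N))%nat with m in a2 by lia.
  assert (a3 := dist1_triang (s n) (s N) (s m)). rewrite (dist1_sym (s N)) in a3.
  assert (a4 := Hf (s n) (s m)). lra. }
destruct (Hcau fst) as [l1 L1].
{ intros u v. unfold dist1. generalize (Rabs_pos (snd u - snd v)). lra. }
destruct (Hcau snd) as [l2 L2].
{ intros u v. unfold dist1. generalize (Rabs_pos (fst u - fst v)). lra. }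
exists (l1, l2).
assert (Hsmall : forall e, 0 < e -> dist1 (T (l1, l2)) (l1, l2) <= e).
{ intros e He. apply is_lim_seq_spec in L1, L2.
  destruct (L1 (mkposreal (e / 4) ltac:(lra))) as [n1 N1].
  destruct (L2 (mkposreal (e / 4) ltac:(lra))) as [n2 N2]. simpl in N1, N2.
  set (n := (n1 + n2)%nat).
  assert (b1 := N1 n ltac:(unfold n; lia)). assert (b2 := N2 n ltac:(unfold n; lia)).
  assert (b3 := N1 (S n) ltac:(unfold n; lia)). assert (b4 := N2 (S n) ltac:(unfold n; lia)).
  assert (c1 : dist1 (s n) (l1, l2) <= e / 2) by (change (Rabs (fst (s n) - l1) + Rabs (snd (s n) - l2) <= e / 2); lra).
  assert (c2 : dist1 (s (S n)) (l1, l2) <= e / 2) by (change (Rabs (fst (s (S n)) - l1) + Rabs (snd (s (S n)) - l2) <= e / 2); lra).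
  assert (c3 := dist1_triang (T (l1, l2)) (s (S n)) (l1, l2)).
  assert (c4 := HT (l1, l2) (s n)). rewrite (dist1_sym (l1, l2)) in c4.
  change (T (s n)) with (s (S n)) in c4. lra. }
assert (E : dist1 (T (l1, l2)) (l1, l2) <= 0).
{ apply le_epsilon. intros e He. rewrite Rplus_0_l. apply Hsmall, He. }
unfold dist1 in E. destruct (T (l1, l2)) as [a b]. simpl in E.
assert (h1 := Rabs_pos (a - l1)). assert (h2 := Rabs_pos (b - l2)).
f_equal; apply Rminus_diag_uniq; apply Rabs_eq_0; lra.
Qed.

Definition clamp (a b x : R) : R := Rmax a (Rmin b x).

Lemma clamp_in a b x : a <= b -> a <= clamp a b x <= b.
Proof. intros. unfold clamp, Rmax, Rmin. destruct (Rle_dec b x); destruct Rle_dec; lra. Qed.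
Lemma clamp_id a b x : a <= x <= b -> clamp a b x = x.
Proof. intros. unfold clamp, Rmax, Rmin. destruct (Rle_dec b x); destruct Rle_dec; lra. Qed.
Lemma clamp_lip a b x y : a <= b -> Rabs (clamp a b x - clamp a b y) <= Rabs (x - y).
Proof.
intros. unfold clamp, Rmax, Rmin.
destruct (Rle_dec b x); destruct (Rle_dec b y); repeat destruct Rle_dec; split_Rabs; lra.
Qed.

Definition small_on (y0 d : R) (P : R -> R -> R) : Prop :=
  forall x1 y1 x2 y2, Rabs (y1 - y0) < d -> Rabs (y2 - y0) < d ->
    Rabs (P x1 y1 - P x2 y2) <= / 4 * (Rabs (x1 - x2) + Rabs (y1 - y2)).

(** Each perturbation absorbs at most a quarter of the distance, so the map shrinks distances by a
    factor at most 2. With [a = b = 0] this is injectivity. *)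
Lemma near_identity_injective (y0 d : R) (P Q : R -> R -> R) (x1 y1 x2 y2 a b : R) :
  small_on y0 d P -> small_on y0 d Q -> Rabs (y1 - y0) < d -> Rabs (y2 - y0) < d ->
  Rabs (x1 + P x1 y1 - (x2 + P x2 y2)) <= a ->
  Rabs (y1 + Q x1 y1 - (y2 + Q x2 y2)) <= b ->
  Rabs (x1 - x2) + Rabs (y1 - y2) <= 2 * (a + b).
Proof.
intros HP HQ H1 H2 Ha Hb.
assert (h1 := HP x1 y1 x2 y2 H1 H2). assert (h2 := HQ x1 y1 x2 y2 H1 H2).
revert Ha Hb h1 h2. generalize (P x1 y1) (P x2 y2) (Q x1 y1) (Q x2 y2). intros p1 p2 q1 q2 Ha Hb h1 h2.
assert (Rabs (x1 - x2) <= a + Rabs (p1 - p2)).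
{ replace (x1 - x2) with ((x1 + p1 - (x2 + p2)) - (p1 - p2)) by ring.
  eapply Rle_trans; [apply Rabs_triang|]. rewrite Rabs_Ropp. lra. }
assert (Rabs (y1 - y2) <= b + Rabs (q1 - q2)).
{ replace (y1 - y2) with ((y1 + q1 - (y2 + q2)) - (q1 - q2)) by ring.
  eapply Rle_trans; [apply Rabs_triang|]. rewrite Rabs_Ropp. lra. }
lra.
Qed.

(* Outside the box the map is extended by clamping its small part. *)
Lemma near_identity_surjective (y0 d X r : R) (P Q : R -> R -> R) :
  0 < r < d -> 0 <= X -> small_on y0 d P -> small_on y0 d Q ->
  forall a b, exists x y,
    x + P (clamp (- X) X x) (clamp (y0 - r) (y0 + r) y) = a /\
    y + Q (clamp (- X) X x) (clamp (y0 - r) (y0 + r) y) = b.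
Proof.
intros Hr HX HP HQ a b.
set (cx := clamp (- X) X). set (cy := clamp (y0 - r) (y0 + r)).
assert (Hcy : forall y, Rabs (cy y - y0) < d).
{ intros y. assert (h := clamp_in (y0 - r) (y0 + r) y ltac:(lra)). fold cy in h. split_Rabs; lra. }
destruct (contraction_fixpoint (fun w => (a - P (cx (fst w)) (cy (snd w)), b - Q (cx (fst w)) (cy (snd w)))))
  as [[x y] Hw].
{ intros [x1 y1] [x2 y2]. unfold dist1. simpl.
  assert (h1 := HP (cx x1) (cy y1) (cx x2) (cy y2) (Hcy _) (Hcy _)).
  assert (h2 := HQ (cx x1) (cy y1) (cx x2) (cy y2) (Hcy _) (Hcy _)).
  assert (h3 := clamp_lip (- X) X x1 x2 ltac:(lra)).
  assert (h4 := clamp_lip (y0 - r) (y0 + r) y1 y2 ltac:(lra)). fold cx in h3. fold cy in h4.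
  revert h1 h2 h3 h4. generalize (P (cx x1) (cy y1)) (P (cx x2) (cy y2)) (Q (cx x1) (cy y1)) (Q (cx x2) (cy y2)).
  intros p1 p2 q1 q2 h1 h2 h3 h4.
  replace (a - p1 - (a - p2)) with (- (p1 - p2)) by ring.
  replace (b - q1 - (b - q2)) with (- (q1 - q2)) by ring. rewrite !Rabs_Ropp. lra. }
simpl in Hw. injection Hw. intros E1 E2. exists x, y. split; lra.
Qed.

Lemma is_derive_of_linear_bound (f : R -> R) (t l : R) :
  (forall e, 0 < e -> exists r, 0 < r /\ forall s, Rabs (s - t) < r ->
     Rabs (f s - f t - l * (s - t)) <= e * Rabs (s - t)) ->
  is_derive f t l.
Proof.
intros H. apply is_derive_Reals. intros e He.
destruct (H (e / 2) ltac:(lra)) as [r [Hr Hb]].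
exists (mkposreal r Hr). intros h Hh Hhr. simpl in Hhr.
assert (b := Hb (t + h)). replace (t + h - t) with h in b by ring. specialize (b Hhr).
replace ((f (t + h) - f t) / h - l) with ((f (t + h) - f t - l * h) / h) by (field; exact Hh).
unfold Rdiv. rewrite Rabs_mult, Rabs_inv. assert (0 < Rabs h) by (apply Rabs_pos_lt, Hh).
apply Rle_lt_trans with (e / 2 * Rabs h * / Rabs h).
- apply Rmult_le_compat_r; [left; apply Rinv_0_lt_compat; lra|exact b].
- field_simplify; lra.
Qed.

Lemma weighted_sum_le (A B w1 w2 k : R) :
  0 <= A -> 0 <= B -> 0 <= w1 -> w1 <= k -> w2 <= k -> A * w1 + B * w2 <= (A + B + 1) * k.
Proof.
intros HA HB H0 H1 H2.
assert (A * w1 <= A * k) by (apply Rmult_le_compat_l; lra).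
assert (B * w2 <= B * k) by (apply Rmult_le_compat_l; lra). lra.
Qed.

(** The two linear equations say [(a + i b) (1 + e (u + i v)) = 1]: the inverse of a map has the
    inverse derivative. The Lipschitz bound for the inverse converts the first-order expansion of
    the map into one for the path. *)
Lemma near_identity_inverse_derive (y0 e C1 C2 t a b : R) (p q u v : R -> R -> R) (x y : R -> R) :
  gradient_on y0 1 p u (fun x y => - v x y) -> gradient_on y0 1 q v u ->
  small_on y0 1 (fun x y => e * p x y) -> small_on y0 1 (fun x y => e * q x y) ->
  continuity_2d_pt u (x t) (y t) -> continuity_2d_pt v (x t) (y t) ->
  a * (1 + e * u (x t) (y t)) - b * (e * v (x t) (y t)) = 1 ->
  a * (e * v (x t) (y t)) + b * (1 + e * u (x t) (y t)) = 0 ->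
  locally t (fun s => Rabs (y s - y0) < 1 /\
    x s + e * p (x s) (y s) = C1 + s /\ y s + e * q (x s) (y s) = C2) ->
  is_derive x t a /\ is_derive y t b.
Proof.
intros Hp Hq Sp Sq Cu Cv I1 I2 [r Hr].
destruct (Hr t ltac:(apply ball_center)) as (T0 & T1 & T2).
assert (Hl : forall s, Rabs (s - t) < r -> Rabs (x s - x t) + Rabs (y s - y t) <= 2 * Rabs (s - t)).
{ intros s Hs. destruct (Hr s Hs) as (S0 & S1 & S2).
  rewrite <- (Rplus_0_r (Rabs (s - t))).
  apply (near_identity_injective y0 1 (fun x y => e * p x y) (fun x y => e * q x y)); auto.
  - rewrite S1, T1. right. f_equal. ring.
  - rewrite S2, T2, Rminus_diag, Rabs_R0. lra. }
set (M := Rabs (a * e) + Rabs (b * e) + 1).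
assert (HM : 0 < M). { unfold M. generalize (Rabs_pos (a * e)) (Rabs_pos (b * e)). lra. }
(* [w1] and [w2] are, up to sign, the remainders in the expansions of [p] and [q]. Radii and
   tolerances are halved because the path moves at most [2 |s - t|]. *)
assert (Key : forall kap, 0 < kap -> exists r', 0 < r' /\ forall s, Rabs (s - t) < r' ->
  exists w1 w2, Rabs w1 <= kap * Rabs (s - t) /\ Rabs w2 <= kap * Rabs (s - t) /\
   (1 + e * u (x t) (y t)) * (x s - x t) - e * v (x t) (y t) * (y s - y t) = (s - t) + e * w1 /\
   e * v (x t) (y t) * (x s - x t) + (1 + e * u (x t) (y t)) * (y s - y t) = e * w2).
{ intros kap Hk.
  destruct (gradient_strict y0 1 p u (fun x y => - v x y) (x t) (y t) (kap / 2) Hp T0 Cu) as [r1 [Hr1 B1]].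
  { apply continuity_2d_pt_opp, Cv. } { lra. }
  destruct (gradient_strict y0 1 q v u (x t) (y t) (kap / 2) Hq T0 Cv Cu) as [r2 [Hr2 B2]]; [lra|].
  exists (Rmin r (Rmin (r1 / 2) (r2 / 2))). split.
  { repeat apply Rmin_glb_lt; try apply cond_pos; lra. }
  intros s Hs.
  assert (Hs0 : Rabs (s - t) < r /\ 2 * Rabs (s - t) < r1 /\ 2 * Rabs (s - t) < r2).
  { generalize (Rmin_l r (Rmin (r1 / 2) (r2 / 2))) (Rmin_r r (Rmin (r1 / 2) (r2 / 2)))
     (Rmin_l (r1 / 2) (r2 / 2)) (Rmin_r (r1 / 2) (r2 / 2)). lra. }
  destruct Hs0 as (s1 & s2 & s3).
  assert (L := Hl s s1). assert (p1 := Rabs_pos (x s - x t)). assert (p2 := Rabs_pos (y s - y t)).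
  destruct (Hr s s1) as (S0 & S1 & S2).
  assert (b1 := B1 (x s) (y s) (x t) (y t)). assert (b2 := B2 (x s) (y s) (x t) (y t)).
  rewrite !Rminus_diag, !Rabs_R0 in b1, b2. specialize (b1 ltac:(lra) ltac:(lra) ltac:(lra) ltac:(lra)).
  specialize (b2 ltac:(lra) ltac:(lra) ltac:(lra) ltac:(lra)).
  exists (- (p (x s) (y s) - p (x t) (y t) - (u (x t) (y t) * (x s - x t) + - v (x t) (y t) * (y s - y t)))),
   (- (q (x s) (y s) - q (x t) (y t) - (v (x t) (y t) * (x s - x t) + u (x t) (y t) * (y s - y t)))).
  rewrite !Rabs_Ropp. split; [nra|]. split; [nra|]. split.
  - replace (x s) with (C1 + s - e * p (x s) (y s)) at 1 by lra.
    replace (x t) with (C1 + t - e * p (x t) (y t)) at 2 by lra.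
    revert S1 T1. generalize (p (x s) (y s)) (p (x t) (y t)) (u (x t) (y t)) (v (x t) (y t)).
    intros ps pt uu vv S1 T1.
    replace (x s) with (C1 + s - e * ps) by lra. replace (x t) with (C1 + t - e * pt) by lra. ring.
  - revert S2 T2. generalize (q (x s) (y s)) (q (x t) (y t)) (u (x t) (y t)) (v (x t) (y t)).
    intros ps pt uu vv S2 T2.
    replace (y s) with (C2 - e * ps) by lra. replace (y t) with (C2 - e * pt) by lra. ring. }
split; apply is_derive_of_linear_bound; intros eps Heps;
  (destruct (Key (eps / M)) as [r' [Hr' B]]; [apply Rdiv_lt_0_compat; lra|]);
  exists r'; (split; [exact Hr'|]); intros s Hs;
  destruct (B s Hs) as (w1 & w2 & W1 & W2 & E1 & E2);
  revert E1 E2 I1 I2; generalize (u (x t) (y t)) (v (x t) (y t)) (x s - x t) (y s - y t);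
  intros uu vv dx dy E1 E2 I1 I2.
(* Solving the linear system of [Key] for [dx] with the inverse matrix, whose entries are [a] and
   [b] up to sign. *)
- replace (dx - a * (s - t)) with (a * e * w1 + - (b * e) * w2).
  2:{ transitivity ((a * (1 + e * uu) - b * (e * vv)) * dx - (a * (e * vv) + b * (1 + e * uu)) * dy - a * (s - t)).
      - replace (a * e * w1) with (a * (e * w1)) by ring. replace (- (b * e) * w2) with (- b * (e * w2)) by ring.
        rewrite <- E2. replace (e * w1) with ((1 + e * uu) * dx - e * vv * dy - (s - t)) by lra. ring.
      - rewrite I1, I2. ring. }
  apply Rle_trans with (M * (eps / M * Rabs (s - t))); [|right; field; lra].
  eapply Rle_trans; [apply Rabs_triang|]. rewrite (Rabs_mult (a * e)), (Rabs_mult (- (b * e))).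
  rewrite Rabs_Ropp. apply weighted_sum_le; auto using Rabs_pos.
- replace (dy - b * (s - t)) with (b * e * w1 + (a * e) * w2).
  2:{ transitivity ((a * (e * vv) + b * (1 + e * uu)) * dx + (a * (1 + e * uu) - b * (e * vv)) * dy - b * (s - t)).
      - replace (b * e * w1) with (b * (e * w1)) by ring. replace (a * e * w2) with (a * (e * w2)) by ring.
        rewrite <- E2. replace (e * w1) with ((1 + e * uu) * dx - e * vv * dy - (s - t)) by lra. ring.
      - rewrite I1, I2. ring. }
  apply Rle_trans with (M * (eps / M * Rabs (s - t))); [|right; field; lra].
  eapply Rle_trans; [apply Rabs_triang|]. rewrite (Rabs_mult (b * e)), (Rabs_mult (a * e)).
  rewrite (Rplus_comm (Rabs (b * e) * _)). apply weighted_sum_le; auto using Rabs_pos.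
Qed.

Definition lip_on (y0 d L : R) (P : R -> R -> R) : Prop :=
  forall x1 y1 x2 y2, Rabs (y1 - y0) < d -> Rabs (y2 - y0) < d ->
    Rabs (P x1 y1 - P x2 y2) <= L * (Rabs (x1 - x2) + Rabs (y1 - y2)).

(** The arc joining two points with the same value of the first integral is the preimage of a
    horizontal segment. Preimages exist for the clamped extension of the map; they depend
    continuously on [t] by injectivity, and a size estimate shows that clamping never acts for
    [0 <= t <= T], so that the path solves the original equations there. *)
Lemma level_path (y0 r L x1 y1 x2 y2 : R) (P Q : R -> R -> R) :
  0 < r < 1 -> L <= / 4 -> L * 100 <= r / 2 -> lip_on y0 1 L P -> lip_on y0 1 L Q ->
  0 <= x1 <= 16 -> 0 <= x2 <= 16 -> Rabs (y1 - y0) < r / 2 -> Rabs (y2 - y0) < r / 2 ->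
  y1 + Q x1 y1 = y2 + Q x2 y2 ->
  let T := (x2 + P x2 y2) - (x1 + P x1 y1) in
  exists x y : R -> R,
    (forall t, continuous x t) /\ (forall t, continuous y t) /\
    x 0 = x1 /\ y 0 = y1 /\ (0 < T -> x T = x2 /\ y T = y2) /\
    forall t, 0 <= t <= T -> Rabs (y t - y0) < r /\
      x t + P (x t) (y t) = (x1 + P x1 y1) + t /\ y t + Q (x t) (y t) = y1 + Q x1 y1.
Proof.
intros Hr HL HLr LP LQ Hx1 Hx2 Hy1 Hy2 HE T.
assert (HL0 : 0 <= L).
{ assert (h := LP 1 y0 0 y0). rewrite !Rminus_diag, Rabs_R0, Rminus_0_r, Rabs_R1 in h.
  specialize (h Rlt_0_1 Rlt_0_1). generalize (Rabs_pos (P 1 y0 - P 0 y0)). lra. }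
assert (SP : forall P, lip_on y0 1 L P -> small_on y0 1 P).
{ intros F HF u1 v1 u2 v2 h1 h2. eapply Rle_trans; [apply HF; auto|].
  apply Rmult_le_compat_r; [|exact HL]. generalize (Rabs_pos (u1 - u2)) (Rabs_pos (v1 - v2)). lra. }
(* The sections lie in [0 <= x <= 16]; the wider box leaves room for the variation of [P]. *)
set (cx := clamp (- 20) 20). set (cy := clamp (y0 - r) (y0 + r)).
assert (Hsol := near_identity_surjective y0 1 20 r P Q Hr ltac:(lra) (SP _ LP) (SP _ LQ)).
assert (Hfun : forall t, exists w : R * R, fst w + P (cx (fst w)) (cy (snd w)) = (x1 + P x1 y1) + t /\
   snd w + Q (cx (fst w)) (cy (snd w)) = y1 + Q x1 y1).
{ intros t. destruct (Hsol ((x1 + P x1 y1) + t) (y1 + Q x1 y1)) as (a & b & h1 & h2).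
  exists (a, b). split; assumption. }
assert (exists w : R -> R * R, forall t, fst (w t) + P (cx (fst (w t))) (cy (snd (w t))) = (x1 + P x1 y1) + t /\
   snd (w t) + Q (cx (fst (w t))) (cy (snd (w t))) = y1 + Q x1 y1) as [w Hw].
{ apply (choice (fun t w => fst w + P (cx (fst w)) (cy (snd w)) = (x1 + P x1 y1) + t /\
   snd w + Q (cx (fst w)) (cy (snd w)) = y1 + Q x1 y1)). exact Hfun. }
assert (Hcy : forall y, Rabs (cy y - y0) <= r).
{ intros y. assert (h := clamp_in (y0 - r) (y0 + r) y ltac:(lra)). fold cy in h. split_Rabs; lra. }
assert (Hcx : forall x, Rabs (cx x) <= 20).
{ intros x. assert (h := clamp_in (- 20) 20 x ltac:(lra)). fold cx in h. split_Rabs; lra. }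
assert (Hlip : forall F, lip_on y0 1 L F -> forall u1 v1 u2 v2,
   Rabs (F (cx u1) (cy v1) - F (cx u2) (cy v2)) <= L * (Rabs (u1 - u2) + Rabs (v1 - v2))).
{ intros F HF u1 v1 u2 v2. eapply Rle_trans; [apply HF|].
  - eapply Rle_lt_trans; [apply Hcy|lra].
  - eapply Rle_lt_trans; [apply Hcy|lra].
  - apply Rmult_le_compat_l; [exact HL0|]. apply Rplus_le_compat; apply clamp_lip; lra. }
assert (Hcl : forall s t, Rabs (fst (w s) - fst (w t)) + Rabs (snd (w s) - snd (w t)) <= 2 * Rabs (s - t)).
{ intros s t. destruct (Hw s) as [s1 s2]. destruct (Hw t) as [t1 t2].
  assert (l1 := Hlip P LP (fst (w s)) (snd (w s)) (fst (w t)) (snd (w t))).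
  assert (l2 := Hlip Q LQ (fst (w s)) (snd (w s)) (fst (w t)) (snd (w t))).
  revert s1 s2 t1 t2 l1 l2. 
  generalize (P (cx (fst (w s))) (cy (snd (w s)))) (P (cx (fst (w t))) (cy (snd (w t)))).
  generalize (Q (cx (fst (w s))) (cy (snd (w s)))) (Q (cx (fst (w t))) (cy (snd (w t)))).
  generalize (fst (w s)) (fst (w t)) (snd (w s)) (snd (w t)).
  intros a b c d q1 q2 p1 p2 s1 s2 t1 t2 l1 l2.
  assert (h0 : 0 <= Rabs (a - b) + Rabs (c - d)) by (generalize (Rabs_pos (a - b)) (Rabs_pos (c - d)); lra).
  assert (h1 : Rabs (a - b) <= Rabs (s - t) + Rabs (p1 - p2)).
  { replace (a - b) with ((s - t) - (p1 - p2)) by lra. 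
    eapply Rle_trans; [apply Rabs_triang|]. rewrite Rabs_Ropp. lra. }
  assert (h2 : Rabs (c - d) <= Rabs (q1 - q2)).
  { replace (c - d) with (- (q1 - q2)) by lra. rewrite Rabs_Ropp. lra. }
  nra. }
assert (Hin1 : Rabs (y1 - y0) <= r /\ Rabs (y2 - y0) <= r) by (split; lra).
assert (C1 : cx x1 = x1 /\ cy y1 = y1).
{ split; apply clamp_id; [lra|]. revert Hy1. split_Rabs; lra. }
assert (C2 : cx x2 = x2 /\ cy y2 = y2).
{ split; apply clamp_id; [lra|]. revert Hy2. split_Rabs; lra. }
assert (Hfar : forall F, lip_on y0 1 L F -> forall u v, Rabs (F (cx u) (cy v) - F x1 y1) <= r / 2).
{ intros F HF u v. eapply Rle_trans; [apply HF|].
  - eapply Rle_lt_trans; [apply Hcy|lra].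
  - lra.
  (* 100 is a crude bound for the distance from [(x1, y1)] to any point of the box: at most 36 in
     [x] and less than 2 in [y]. *)
  - apply Rle_trans with (L * 100); [|lra]. apply Rmult_le_compat_l; [exact HL0|].
    assert (h1 := Hcx u). assert (h2 := Hcy v). revert h1 h2 Hy1.
    generalize (cx u) (cy v). intros. split_Rabs; lra. }
assert (HT : x1 + T <= 17).
{ unfold T. assert (h := Hfar P LP x2 y2). rewrite (proj1 C2), (proj2 C2) in h. apply Rabs_le_between in h. lra. }
assert (Hbox : forall t, 0 <= t <= T -> cx (fst (w t)) = fst (w t) /\ cy (snd (w t)) = snd (w t) /\
   Rabs (snd (w t) - y0) < r).
{ intros t Ht. destruct (Hw t) as [s1 s2].
  assert (h1 := Hfar P LP (fst (w t)) (snd (w t))). assert (h2 := Hfar Q LQ (fst (w t)) (snd (w t))).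
  assert (Rabs (snd (w t) - y0) < r).
  { replace (snd (w t) - y0) with ((y1 - y0) - (Q (cx (fst (w t))) (cy (snd (w t))) - Q x1 y1)) by lra.
    eapply Rle_lt_trans; [apply Rabs_triang|]. rewrite Rabs_Ropp. lra. }
  split; [|split]; [| |assumption]; apply clamp_id.
  - assert (Rabs (fst (w t) - x1 - t) <= r / 2); [|apply Rabs_le_between in H0; lra].
    replace (fst (w t) - x1 - t) with (- (P (cx (fst (w t))) (cy (snd (w t))) - P x1 y1)) by lra.
    rewrite Rabs_Ropp. exact h1.
  - revert H. split_Rabs; lra. }
assert (Huniq : forall t x y, cx x = x -> cy y = y -> x + P x y = (x1 + P x1 y1) + t -> y + Q x y = y1 + Q x1 y1 ->
   fst (w t) = x /\ snd (w t) = y).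
{ intros t x y hx hy e1 e2. destruct (Hw t) as [s1 s2].
  assert (l1 := Hlip P LP (fst (w t)) (snd (w t)) x y). assert (l2 := Hlip Q LQ (fst (w t)) (snd (w t)) x y).
  rewrite hx, hy in l1, l2. revert s1 s2 l1 l2.
  generalize (P (cx (fst (w t))) (cy (snd (w t)))) (Q (cx (fst (w t))) (cy (snd (w t)))).
  generalize (fst (w t)) (snd (w t)). intros a b p1 q1 s1 s2 l1 l2.
  assert (h0 : 0 <= Rabs (a - x) + Rabs (b - y)) by (generalize (Rabs_pos (a - x)) (Rabs_pos (b - y)); lra).
  assert (h1 : Rabs (a - x) = Rabs (p1 - P x y)).
  { replace (a - x) with (- (p1 - P x y)) by lra. apply Rabs_Ropp. }
  assert (h2 : Rabs (b - y) = Rabs (q1 - Q x y)).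
  { replace (b - y) with (- (q1 - Q x y)) by lra. apply Rabs_Ropp. }
  assert (g1 := Rabs_pos (a - x)). assert (g2 := Rabs_pos (b - y)).
  split; apply Rminus_diag_uniq; apply Rabs_eq_0; nra. }
exists (fun t => fst (w t)), (fun t => snd (w t)).
split; [|split; [|split; [|split; [|split]]]].
- apply (continuous_lip _ 2). intros s t. generalize (Hcl s t) (Rabs_pos (snd (w s) - snd (w t))). lra.
- apply (continuous_lip _ 2). intros s t. generalize (Hcl s t) (Rabs_pos (fst (w s) - fst (w t))). lra.
- apply (Huniq 0 x1 y1); try apply C1; lra.
- apply (Huniq 0 x1 y1); try apply C1; lra.
- intros HT0. apply (Huniq T x2 y2); try apply C2; unfold T; lra.
- intros t Ht. destruct (Hbox t Ht) as (b1 & b2 & b3). destruct (Hw t) as [s1 s2].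
  rewrite b1, b2 in s1, s2. auto.
Qed.

(** * Near-identity maps of the line *)

(* [al e u = u + e * (p + a * (u - ys) + o(1))] near [ys], in the strict C^1 sense in [u]. *)
Definition near_id (ys : R) (al : R -> R -> R) (p a : R) : Prop :=
  forall kap, 0 < kap -> exists d e1, 0 < d /\ 0 < e1 /\
    forall e, 0 < Rabs e < e1 ->
      Rabs (al e ys - ys - e * p) <= kap * Rabs e /\
      forall u v, Rabs (u - ys) < d -> Rabs (v - ys) < d ->
        Rabs (al e u - al e v - (1 + e * a) * (u - v)) <= kap * Rabs e * Rabs (u - v).

Lemma near_id_center (ys : R) al p a : near_id ys al p a ->
  exists e1, 0 < e1 /\ forall e, 0 < Rabs e < e1 ->
    Rabs (al e ys - ys) <= (Rabs p + 1) * Rabs e.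
Proof.
intros H. destruct (H 1 Rlt_0_1) as (d & e1 & Hd & He1 & B).
exists e1. split; [exact He1|]. intros e He. destruct (B e He) as [h _].
replace (al e ys - ys) with ((al e ys - ys - e * p) + e * p) by ring.
eapply Rle_trans; [apply Rabs_triang|]. rewrite Rabs_mult. lra.
Qed.

Lemma near_id_slope (ys : R) al p a s : near_id ys al p a -> 0 < s ->
  exists d e1, 0 < d /\ 0 < e1 /\ forall e, 0 < Rabs e < e1 ->
    forall u v, Rabs (u - ys) < d -> Rabs (v - ys) < d ->
    Rabs (al e u - al e v - (u - v)) <= s * Rabs (u - v).
Proof.
intros H Hs. destruct (H 1 Rlt_0_1) as (d & e1 & Hd & He1 & B).
assert (Ha := Rabs_pos a).
assert (Hq : 0 < s / (Rabs a + 1)) by (apply Rdiv_lt_0_compat; lra).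
exists d, (Rmin e1 (s / (Rabs a + 1))). split; [exact Hd|]. split.
{ apply Rmin_glb_lt; assumption. }
intros e [He0 He] u v Hu Hv.
assert (He2 : Rabs e < e1) by (eapply Rlt_le_trans; [exact He|apply Rmin_l]).
assert (He3 : Rabs e < s / (Rabs a + 1)) by (eapply Rlt_le_trans; [exact He|apply Rmin_r]).
apply Rlt_div_r in He3; [|lra].
destruct (B e (conj He0 He2)) as [_ h]. specialize (h u v Hu Hv).
replace (al e u - al e v - (u - v)) with
  ((al e u - al e v - (1 + e * a) * (u - v)) + e * a * (u - v)) by ring.
eapply Rle_trans; [apply Rabs_triang|]. rewrite !Rabs_mult.
assert (h2 := Rabs_pos (u - v)). nra.
Qed.

(** To first order in [e] both the displacement and its slope add up; the cross terms are [O(e^2)]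
    and disappear by shrinking the range of [e]. *)
Lemma near_id_comp (ys : R) al be p a q b :
  near_id ys al p a -> near_id ys be q b ->
  near_id ys (fun e u => be e (al e u)) (p + q) (a + b).
Proof.
intros Ha Hb kap Hk.
set (k1 := Rmin 1 (kap / 8)).
assert (Hk1 : 0 < k1 /\ k1 <= 1 /\ k1 <= kap / 8).
{ split; [apply Rmin_glb_lt; lra|]. split; [apply Rmin_l|apply Rmin_r]. }
destruct (Ha k1 (proj1 Hk1)) as (d1 & e1 & Hd1 & He1 & B1).
destruct (Hb k1 (proj1 Hk1)) as (d2 & e2 & Hd2 & He2 & B2).
destruct (near_id_center _ _ _ _ Ha) as (e3 & He3 & B3).
destruct (near_id_slope _ _ _ _ 1 Ha Rlt_0_1) as (d4 & e4 & Hd4 & He4 & B4).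
set (C := Rabs p + 1). assert (HC : 0 < C) by (unfold C; generalize (Rabs_pos p); lra).
(* One constant dominating every coefficient of [e^2] met below, such as [|b| C] and [|a| |b|]. *)
set (C2 := (Rabs b + 1) * (C + Rabs a + 2) + 1).
assert (HC2 : 0 < C2).
{ unfold C2. generalize (Rabs_pos a) (Rabs_pos b). intros. nra. }
exists (Rmin (Rmin d1 d4) (d2 / 4)),
  (Rmin (Rmin (Rmin e1 e2) (Rmin e3 e4)) (Rmin (d2 / (2 * C)) (k1 / C2))).
split. { repeat apply Rmin_glb_lt; lra. }
split. { repeat apply Rmin_glb_lt; auto; apply Rdiv_lt_0_compat; lra. }
intros e [He0 He].
apply Rmin_Rgt in He. destruct He as [He H56]. apply Rmin_Rgt in He. destruct He as [H12 H34].
apply Rmin_Rgt in H12, H34, H56. destruct H12 as [E1 E2], H34 as [E3 E4], H56 as [E5 E6].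
apply Rgt_lt in E1, E2, E3, E4, E5, E6.
apply Rlt_div_r in E5; [|lra]. apply Rlt_div_r in E6; [|lra].
destruct (B1 e (conj He0 E1)) as [c1 l1]. destruct (B2 e (conj He0 E2)) as [c2 l2].
assert (c3 := B3 e (conj He0 E3)). assert (l4 := B4 e (conj He0 E4)). fold C in c3.
assert (Hys0 : Rabs (ys - ys) = 0) by (rewrite Rminus_diag; apply Rabs_R0).
assert (Hin : forall u, Rabs (u - ys) < Rmin (Rmin d1 d4) (d2 / 4) ->
  Rabs (u - ys) < d1 /\ Rabs (u - ys) < d4 /\ Rabs (al e u - ys) < d2).
{ intros u Hu. apply Rmin_Rgt in Hu. destruct Hu as [Hu h3]. apply Rmin_Rgt in Hu. destruct Hu as [h1 h2].
  split; [lra|]. split; [lra|].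
  assert (h := l4 u ys ltac:(lra) ltac:(lra)).
  replace (al e u - ys) with ((al e u - al e ys - (u - ys)) + (u - ys) + (al e ys - ys)) by ring.
  eapply Rle_lt_trans; [apply Rabs_triang|].
  eapply Rle_lt_trans; [apply Rplus_le_compat_r, Rabs_triang|]. lra. }
destruct (Hin ys) as (_ & _ & Hys2).
{ rewrite Hys0. repeat apply Rmin_glb_lt; lra. }
split.
- assert (h := l2 (al e ys) ys Hys2 ltac:(lra)).
  replace (be e (al e ys) - ys - e * (p + q)) with
    ((be e (al e ys) - be e ys - (1 + e * b) * (al e ys - ys)) + (be e ys - ys - e * q)
     + (al e ys - ys - e * p) + e * b * (al e ys - ys)) by ring.
  assert (hb : Rabs (e * b * (al e ys - ys)) <= Rabs e * (Rabs b * (C * Rabs e))).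
  { rewrite !Rabs_mult, Rmult_assoc. apply Rmult_le_compat_l; [apply Rabs_pos|].
    apply Rmult_le_compat_l; [apply Rabs_pos|exact c3]. }
  assert (hb2 : Rabs b * (C * Rabs e) <= k1).
  { assert (Rabs b * C <= C2); [|nra]. unfold C2. generalize (Rabs_pos a) (Rabs_pos b). intros. nra. }
  assert (h1 : Rabs (al e ys - ys) <= 1).
  { assert (C <= C2); [|nra]. unfold C2. generalize (Rabs_pos a) (Rabs_pos b). intros. nra. }
  assert (h' : Rabs (be e (al e ys) - be e ys - (1 + e * b) * (al e ys - ys)) <= k1 * Rabs e).
  { eapply Rle_trans; [exact h|]. rewrite <- (Rmult_1_r (k1 * Rabs e)) at 2.
    apply Rmult_le_compat_l; [apply Rmult_le_pos; lra|exact h1]. }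
  eapply Rle_trans; [apply Rabs_triang|].
  eapply Rle_trans; [apply Rplus_le_compat_r, Rabs_triang|].
  eapply Rle_trans; [apply Rplus_le_compat_r, Rplus_le_compat_r, Rabs_triang|].
  assert (hh : Rabs e * (Rabs b * (C * Rabs e)) <= Rabs e * k1) by (apply Rmult_le_compat_l; lra).
  assert (hk : k1 * Rabs e <= kap / 8 * Rabs e) by (apply Rmult_le_compat_r; lra).
  assert (0 <= kap * Rabs e) by (apply Rmult_le_pos; lra). lra.
- intros u v Hu Hv. destruct (Hin u Hu) as (u1 & u2 & u3). destruct (Hin v Hv) as (v1 & v2 & v3).
  assert (h1 := l1 u v u1 v1). assert (h2 := l2 _ _ u3 v3). assert (h4 := l4 u v u2 v2).
  assert (hp := Rabs_pos (u - v)).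
  assert (h5 : Rabs (al e u - al e v) <= 2 * Rabs (u - v)).
  { replace (al e u - al e v) with ((al e u - al e v - (u - v)) + (u - v)) by ring.
    eapply Rle_trans; [apply Rabs_triang|]. lra. }
  replace (be e (al e u) - be e (al e v) - (1 + e * (a + b)) * (u - v)) with
   ((be e (al e u) - be e (al e v) - (1 + e * b) * (al e u - al e v))
    + (al e u - al e v - (1 + e * a) * (u - v))
    + e * b * (al e u - al e v - (1 + e * a) * (u - v))
    + e * b * (e * a) * (u - v)) by ring.
  assert (hs : Rabs (e * b * (al e u - al e v - (1 + e * a) * (u - v))) <= Rabs e * (k1 * Rabs (u - v))).
  { rewrite !Rabs_mult, Rmult_assoc. apply Rmult_le_compat_l; [lra|].
    apply Rle_trans with (Rabs b * (k1 * Rabs e * Rabs (u - v))).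
    - apply Rmult_le_compat_l; [apply Rabs_pos|exact h1].
    - replace (Rabs b * (k1 * Rabs e * Rabs (u - v))) with ((Rabs b * Rabs e) * (k1 * Rabs (u - v))) by ring.
      rewrite <- (Rmult_1_l (k1 * Rabs (u - v))) at 2.
      apply Rmult_le_compat_r; [apply Rmult_le_pos; lra|].
      assert (h : Rabs b <= C2) by (unfold C2; generalize (Rabs_pos a) (Rabs_pos b); intros; nra).
      assert (Rabs b * Rabs e <= C2 * Rabs e) by (apply Rmult_le_compat_r; lra). lra. }
  assert (ht : Rabs (e * b * (e * a) * (u - v)) <= Rabs e * (k1 * Rabs (u - v))).
  { rewrite !Rabs_mult. replace (Rabs e * Rabs b * (Rabs e * Rabs a) * Rabs (u - v))
     with (Rabs e * ((Rabs b * Rabs a * Rabs e) * Rabs (u - v))) by ring.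
    apply Rmult_le_compat_l; [lra|]. apply Rmult_le_compat_r; [lra|].
    assert (h : Rabs b * Rabs a <= C2) by (unfold C2; generalize (Rabs_pos a) (Rabs_pos b); intros; nra).
    assert (Rabs b * Rabs a * Rabs e <= C2 * Rabs e) by (apply Rmult_le_compat_r; lra). lra. }
  eapply Rle_trans; [apply Rabs_triang|].
  eapply Rle_trans; [apply Rplus_le_compat_r, Rabs_triang|].
  eapply Rle_trans; [apply Rplus_le_compat_r, Rplus_le_compat_r, Rabs_triang|].
  assert (hx : k1 * Rabs e * Rabs (al e u - al e v) <= k1 * Rabs e * (2 * Rabs (u - v))).
  { apply Rmult_le_compat_l; [|exact h5]. apply Rmult_le_pos; lra. }
  assert (hy : 0 <= Rabs e * Rabs (u - v)) by (apply Rmult_le_pos; lra).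
  assert (hz : k1 * (Rabs e * Rabs (u - v)) <= kap / 8 * (Rabs e * Rabs (u - v))) by (apply Rmult_le_compat_r; lra).
  nra.
Qed.

Lemma near_id_continuous (ys : R) al p a : near_id ys al p a ->
  exists d e1, 0 < d /\ 0 < e1 /\ forall e u, 0 < Rabs e < e1 -> Rabs (u - ys) < d ->
    continuity_pt (al e) u.
Proof.
intros H. destruct (near_id_slope _ _ _ _ 1 H Rlt_0_1) as (d & e1 & Hd & He1 & B).
exists d, e1. split; [exact Hd|]. split; [exact He1|]. intros e u He Hu eps Heps.
exists (Rmin (eps / 2) (d - Rabs (u - ys))). split; [apply Rmin_glb_lt; lra|].
intros v [_ Hv]. change (Rabs (v - u) < Rmin (eps / 2) (d - Rabs (u - ys))) in Hv.
change (Rabs (al e v - al e u) < eps).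
apply Rmin_Rgt in Hv. destruct Hv as [h1 h2].
assert (Rabs (v - ys) < d).
{ replace (v - ys) with ((v - u) + (u - ys)) by ring. eapply Rle_lt_trans; [apply Rabs_triang|]. lra. }
assert (h := B e He v u H0 Hu).
replace (al e v - al e u) with ((al e v - al e u - (v - u)) + (v - u)) by ring.
eapply Rle_lt_trans; [apply Rabs_triang|]. lra.
Qed.

(** First-order form of the inverse of [be] composed with [al]. Slopes close to 1 give uniqueness
    and Lipschitz dependence of the solution, continuity gives its existence. This is the step from
    one section to the next, where the values of the first integral agree. *)
Lemma near_id_solve (ys : R) al be p a q b :
  near_id ys al p a -> near_id ys be q b ->
  exists f, near_id ys f (p - q) (a - b) /\
    exists d e1, 0 < d /\ 0 < e1 /\ forall e u, 0 < Rabs e < e1 -> Rabs (u - ys) < d ->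
      al e u = be e (f e u) /\
      forall v, Rabs (v - ys) < d -> al e u = be e v -> v = f e u.
Proof.
intros Ha Hb.
destruct (near_id_slope _ _ _ _ (/ 4) Ha ltac:(lra)) as (d1 & e1 & Hd1 & He1 & B1).
destruct (near_id_slope _ _ _ _ (/ 4) Hb ltac:(lra)) as (d2 & e2 & Hd2 & He2 & B2).
destruct (near_id_center _ _ _ _ Ha) as (e3 & He3 & B3).
destruct (near_id_center _ _ _ _ Hb) as (e4 & He4 & B4).
destruct (near_id_continuous _ _ _ _ Hb) as (d5 & e5 & Hd5 & He5 & B5).
set (Ca := Rabs p + 1) in *. set (Cb := Rabs q + 1) in *.
assert (HCa : 0 < Ca) by (unfold Ca; generalize (Rabs_pos p); lra).
assert (HCb : 0 < Cb) by (unfold Cb; generalize (Rabs_pos q); lra).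
set (D := Rmin d2 d5 / 2).
assert (HD : 0 < D /\ D < d2 /\ D < d5).
{ assert (0 < Rmin d2 d5) by (apply Rmin_glb_lt; lra).
  generalize (Rmin_l d2 d5) (Rmin_r d2 d5). unfold D. lra. }
assert (Hys0 : Rabs (ys - ys) = 0) by (rewrite Rminus_diag; apply Rabs_R0).
(* By the intermediate value theorem, [be] maps the ball of radius [D] onto a set containing the image of a small ball under [al]. *)
set (dd := Rmin (Rmin d1 d2) (D / 8)). 
set (ee := Rmin (Rmin (Rmin e1 e2) (Rmin e3 e4)) (Rmin e5 (D / (8 * (Ca + Cb))))).
assert (Hdd : 0 < dd) by (unfold dd; repeat apply Rmin_glb_lt; lra).
assert (Hee : 0 < ee) by (unfold ee; repeat apply Rmin_glb_lt; auto; apply Rdiv_lt_0_compat; lra).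
assert (Heeb : forall e, 0 < Rabs e < ee -> 0 < Rabs e /\ Rabs e < e1 /\ Rabs e < e2 /\ Rabs e < e3 /\ Rabs e < e4
   /\ Rabs e < e5 /\ Rabs e * (Ca + Cb) < D / 8).
{ intros e [He0 He]. apply Rmin_Rgt in He. destruct He as [He H56]. apply Rmin_Rgt in He. destruct He as [H12 H34].
  apply Rmin_Rgt in H12, H34, H56. destruct H12 as [E1 E2], H34 as [E3 E4], H56 as [E5 E6].
  apply Rgt_lt in E6. apply Rlt_div_r in E6; [|lra]. repeat split; lra. }
assert (Hddb : forall u, Rabs (u - ys) < dd -> Rabs (u - ys) < d1 /\ Rabs (u - ys) < d2 /\ Rabs (u - ys) < D / 8).
{ intros u Hu. apply Rmin_Rgt in Hu. destruct Hu as [Hu h3]. apply Rmin_Rgt in Hu. lra. }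
assert (Hex : forall e u, exists v, 0 < Rabs e < ee -> Rabs (u - ys) < dd ->
   al e u = be e v /\ Rabs (v - ys) <= D).
{ intros e u. destruct (Rlt_dec 0 (Rabs e)) as [He0|He0]; [|exists 0; intros; lra].
  destruct (Rlt_dec (Rabs e) ee) as [He|He]; [|exists 0; intros; lra].
  destruct (Rlt_dec (Rabs (u - ys)) dd) as [Hu|Hu]; [|exists 0; intros; lra].
  destruct (Heeb e (conj He0 He)) as (_ & E1 & E2 & E3 & E4 & E5 & E6).
  destruct (Hddb u Hu) as (U1 & U2 & U3).
  assert (h1 := B1 e (conj He0 E1) u ys U1 ltac:(lra)). assert (h3 := B3 e (conj He0 E3)).
  assert (h4 := B4 e (conj He0 E4)).
  assert (hD : forall s, Rabs s = D -> Rabs (be e (ys + s) - be e ys - s) <= / 4 * D).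
  { intros s Hs. assert (h := B2 e (conj He0 E2) (ys + s) ys).
    replace (ys + s - ys) with s in h by ring. rewrite Hs in h. apply h; lra. }
  assert (hp := hD D ltac:(rewrite Rabs_right; lra)).
  assert (hm := hD (- D) ltac:(rewrite Rabs_Ropp, Rabs_right; lra)).
  destruct (Ranalysis5.f_interv_is_interv (be e) (ys + - D) (ys + D) (al e u)) as [v [Hv Ev]].
  - lra.
  - apply Rabs_le_between in hp, hm, h1, h3, h4. apply Rabs_lt_between in U3. 
    assert (Rabs (u - ys) <= D / 8) by (apply Rabs_le; lra). lra.
  - intros x Hx. apply B5; [split; lra|]. apply Rabs_lt_between. lra.
  - exists v. intros _ _. split; [symmetry; exact Ev|]. apply Rabs_le. lra. }
destruct (choice (fun (w : R * R) v => 0 < Rabs (fst w) < ee -> Rabs (snd w - ys) < dd ->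
   al (fst w) (snd w) = be (fst w) v /\ Rabs (v - ys) <= D)) as [f0 Hf0].
{ intros [e u]. apply Hex. }
set (f := fun e u => f0 (e, u)).
assert (Hf : forall e u, 0 < Rabs e < ee -> Rabs (u - ys) < dd ->
   al e u = be e (f e u) /\ Rabs (f e u - ys) <= D).
{ intros e u. apply (Hf0 (e, u)). }
assert (Hlip : forall e u v, 0 < Rabs e < ee -> Rabs (u - ys) < dd -> Rabs (v - ys) < dd ->
   Rabs (f e u - f e v) <= 2 * Rabs (u - v)).
{ intros e u v He Hu Hv. destruct (Heeb e He) as (He0 & E1 & E2 & E3 & E4 & E5 & E6).
  destruct (Hddb u Hu) as (U1 & U2 & U3). destruct (Hddb v Hv) as (V1 & V2 & V3).
  destruct (Hf e u He Hu) as [fu gu]. destruct (Hf e v He Hv) as [fv gv].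
  assert (h1 := B1 e (conj He0 E1) u v U1 V1).
  assert (h2 := B2 e (conj He0 E2) (f e u) (f e v) ltac:(lra) ltac:(lra)).
  rewrite <- fu, <- fv in h2. revert h1 h2. generalize (f e u) (f e v) (al e u) (al e v).
  clear. intros. split_Rabs; lra. }
assert (Hcen : forall e, 0 < Rabs e < ee -> Rabs (f e ys - ys) <= 2 * (Ca + Cb) * Rabs e).
{ intros e He. destruct (Heeb e He) as (He0 & E1 & E2 & E3 & E4 & E5 & E6).
  destruct (Hf e ys He ltac:(lra)) as [fu gu].
  assert (h2 := B2 e (conj He0 E2) (f e ys) ys ltac:(lra) ltac:(lra)). rewrite <- fu in h2.
  assert (h3 := B3 e (conj He0 E3)). assert (h4 := B4 e (conj He0 E4)).
  revert h2 h3 h4. generalize (f e ys) (al e ys) (be e ys). intros y1 y2 y3 h2 h3 h4.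
  assert (Rabs (y1 - ys) <= Rabs (y2 - y3) + / 4 * Rabs (y1 - ys)).
  { replace (y1 - ys) with ((y2 - y3) - (y2 - y3 - (y1 - ys))) at 1 by ring.
    eapply Rle_trans; [apply Rabs_triang|]. rewrite Rabs_Ropp. lra. }
  assert (Rabs (y2 - y3) <= Ca * Rabs e + Cb * Rabs e).
  { replace (y2 - y3) with ((y2 - ys) - (y3 - ys)) by ring.
    eapply Rle_trans; [apply Rabs_triang|]. rewrite Rabs_Ropp. lra. }
  assert (0 <= (Ca + Cb) * Rabs e) by (apply Rmult_le_pos; lra). lra. }
exists f. split.
- intros kap Hk. set (k1 := kap / 16). assert (Hk1 : 0 < k1) by (unfold k1; lra).
  destruct (Ha k1 Hk1) as (g1 & i1 & Hg1 & Hi1 & A1).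
  destruct (Hb k1 Hk1) as (g2 & i2 & Hg2 & Hi2 & A2).
  set (C3 := Rabs b * Rabs (a - b) + (Rabs b + k1) * (2 * (Ca + Cb)) + 1).
  assert (HC3 : 0 < C3).
  { unfold C3. generalize (Rabs_pos b) (Rabs_pos (a - b)). intros.
    assert (0 <= Rabs b * Rabs (a - b)) by (apply Rmult_le_pos; lra).
    assert (0 <= (Rabs b + k1) * (2 * (Ca + Cb))) by (apply Rmult_le_pos; lra). lra. }
  set (C4 := 2 * (Ca + Cb)). assert (HC4 : 0 < C4) by (unfold C4; lra).
  set (C5 := Rabs b + 1). assert (HC5 : 0 < C5) by (unfold C5; generalize (Rabs_pos b); lra).
  exists (Rmin dd (Rmin g1 (g2 / 4))), (Rmin (Rmin ee i1) (Rmin (Rmin i2 (/ (2 * C5))) (Rmin (g2 / (4 * C4)) (k1 / C3)))).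
  split. { repeat apply Rmin_glb_lt; lra. }
  split. { repeat apply Rmin_glb_lt; auto; try (apply Rdiv_lt_0_compat; lra). apply Rinv_0_lt_compat; lra. }
  intros e [He0 He]. apply Rmin_Rgt in He. destruct He as [He H56]. apply Rmin_Rgt in He. destruct He as [H1 H2].
  apply Rmin_Rgt in H56. destruct H56 as [H34 H56]. apply Rmin_Rgt in H34, H56.
  destruct H34 as [H3 H4], H56 as [H5 H6]. apply Rgt_lt in H1, H2, H3, H4, H5, H6.
  apply Rlt_div_r in H5; [|lra]. apply Rlt_div_r in H6; [|lra].
  assert (H4' : Rabs e * C5 < / 2).
  { replace (/ 2) with (/ (2 * C5) * C5) by (field; lra). apply Rmult_lt_compat_r; lra. }
  assert (Heb : Rabs (e * b) <= / 2).
  { rewrite Rabs_mult. assert (Rabs e * Rabs b <= Rabs e * C5); [|lra].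
    apply Rmult_le_compat_l; [lra|unfold C5; lra]. }
  destruct (A1 e (conj He0 H2)) as [c1 l1]. destruct (A2 e (conj He0 H3)) as [c2 l2].
  assert (HE := conj He0 H1 : 0 < Rabs e < ee).
  assert (Hinv : forall z M, Rabs ((1 + e * b) * z) <= M -> Rabs z <= 2 * M).
  { intros z M. rewrite Rabs_mult. intros hz. assert (/ 2 <= Rabs (1 + e * b)).
    { revert Heb. generalize (e * b). clear. intros. split_Rabs; lra. }
    assert (0 <= Rabs z) by apply Rabs_pos. nra. }
  assert (Hfin : forall u, Rabs (u - ys) < Rmin dd (Rmin g1 (g2 / 4)) ->
     Rabs (u - ys) < dd /\ Rabs (u - ys) < g1 /\ Rabs (f e u - ys) < g2).
  { intros u Hu. apply Rmin_Rgt in Hu. destruct Hu as [h1 Hu]. apply Rmin_Rgt in Hu. destruct Hu as [h2 h3].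
    split; [lra|]. split; [lra|].
    assert (h := Hlip e u ys HE ltac:(lra) ltac:(lra)). assert (h' := Hcen e HE). fold C4 in h'.
    replace (f e u - ys) with ((f e u - f e ys) + (f e ys - ys)) by ring.
    eapply Rle_lt_trans; [apply Rabs_triang|]. lra. }
  assert (Hys1 : Rabs (ys - ys) < Rmin dd (Rmin g1 (g2 / 4))).
  { rewrite Hys0. repeat apply Rmin_glb_lt; lra. }
  split.
  + destruct (Hfin ys Hys1) as (_ & _ & F3). destruct (Hf e ys HE ltac:(lra)) as [F _].
    assert (l := l2 (f e ys) ys F3 ltac:(lra)). rewrite <- F in l.
    assert (h' := Hcen e HE). fold C4 in h'.
    replace kap with (2 * (8 * k1)) by (unfold k1; field). rewrite Rmult_assoc.
    revert c1 c2 l h'. generalize (al e ys) (be e ys) (f e ys). intros y1 y2 y3 c1 c2 l h'.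
    replace (y3 - ys - e * (p - q)) with
      (- (y1 - y2 - (1 + e * b) * (y3 - ys)) + (y1 - ys - e * p) + - (y2 - ys - e * q) + - (e * b * (y3 - ys))) by ring.
    eapply Rle_trans; [apply Rabs_triang|]. rewrite Rabs_Ropp.
    eapply Rle_trans; [apply Rplus_le_compat_r, Rabs_triang|]. rewrite Rabs_Ropp.
    eapply Rle_trans; [apply Rplus_le_compat_r, Rplus_le_compat_r, Rabs_triang|]. rewrite Rabs_Ropp.
    rewrite !Rabs_mult.
    assert (t1 : Rabs e * Rabs b * Rabs (y3 - ys) + k1 * Rabs e * Rabs (y3 - ys) <= k1 * Rabs e).
    { replace (Rabs e * Rabs b * Rabs (y3 - ys) + k1 * Rabs e * Rabs (y3 - ys)) with
        (Rabs e * ((Rabs b + k1) * Rabs (y3 - ys))) by ring. rewrite (Rmult_comm k1).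
      apply Rmult_le_compat_l; [lra|].
      apply Rle_trans with ((Rabs b + k1) * (C4 * Rabs e)).
      - apply Rmult_le_compat_l; [generalize (Rabs_pos b); lra|exact h'].
      - assert ((Rabs b + k1) * C4 <= C3).
        { unfold C3. fold C4. assert (0 <= Rabs b * Rabs (a - b)) by (apply Rmult_le_pos; apply Rabs_pos). lra. }
        assert (Rabs e * ((Rabs b + k1) * C4) <= Rabs e * C3) by (apply Rmult_le_compat_l; lra). lra. }
    assert (0 <= k1 * Rabs e) by (apply Rmult_le_pos; lra). lra.
  + intros u v Hu Hv. destruct (Hfin u Hu) as (u1 & u2 & u3). destruct (Hfin v Hv) as (v1 & v2 & v3).
    destruct (Hf e u HE u1) as [fu _]. destruct (Hf e v HE v1) as [fv _].
    assert (h1 := l1 u v u2 v2). assert (h2 := l2 _ _ u3 v3). rewrite <- fu, <- fv in h2.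
    assert (h3 := Hlip e u v HE u1 v1). assert (hp := Rabs_pos (u - v)).
    replace (kap * Rabs e * Rabs (u - v)) with (2 * (8 * k1 * Rabs e * Rabs (u - v))) by (unfold k1; field).
    apply Hinv.
    replace ((1 + e * b) * (f e u - f e v - (1 + e * (a - b)) * (u - v))) with
     ((al e u - al e v - (1 + e * a) * (u - v)) + - (al e u - al e v - (1 + e * b) * (f e u - f e v))
       + - (e * (e * b * (a - b)) * (u - v))) by ring.
    eapply Rle_trans; [apply Rabs_triang|]. rewrite Rabs_Ropp.
    eapply Rle_trans; [apply Rplus_le_compat_r, Rabs_triang|]. rewrite Rabs_Ropp.
    assert (ht : Rabs (e * (e * b * (a - b)) * (u - v)) <= k1 * Rabs e * Rabs (u - v)).
    { rewrite !Rabs_mult. apply Rmult_le_compat_r; [lra|]. rewrite (Rmult_comm k1).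
      apply Rmult_le_compat_l; [lra|].
      assert (Rabs b * Rabs (a - b) <= C3).
      { unfold C3. assert (0 <= (Rabs b + k1) * (2 * (Ca + Cb))) by
         (apply Rmult_le_pos; [generalize (Rabs_pos b); lra|lra]). lra. }
      assert (Rabs e * (Rabs b * Rabs (a - b)) <= Rabs e * C3) by (apply Rmult_le_compat_l; lra). lra. }
    assert (hx : k1 * Rabs e * Rabs (f e u - f e v) <= k1 * Rabs e * (2 * Rabs (u - v))).
    { apply Rmult_le_compat_l; [|exact h3]. apply Rmult_le_pos; lra. }
    assert (0 <= k1 * Rabs e * Rabs (u - v)) by (repeat apply Rmult_le_pos; lra). lra.
- exists (Rmin dd d2), ee. split; [apply Rmin_glb_lt; lra|]. split; [exact Hee|]. intros e u He Hu.
  apply Rmin_Rgt in Hu. destruct Hu as [Hu _]. apply Rgt_lt in Hu.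
  destruct (Hf e u He Hu) as [F1 F2]. split; [exact F1|].
  intros v Hv Ev. apply Rmin_Rgt in Hv. destruct Hv as [_ Hv].
  destruct (Heeb e He) as (He0 & E1 & E2 & E3 & E4 & E5 & E6).
  assert (h := B2 e (conj He0 E2) v (f e u) ltac:(lra) ltac:(lra)).
  rewrite <- F1, <- Ev, Rminus_diag in h.
  apply Rminus_diag_uniq, Rabs_eq_0. revert h. generalize (v - f e u). clear. intros. split_Rabs; lra.
Qed.

(** Divided by [e], the displacement is close to [m (u - ys)], so it changes sign across a ball
    whose radius does not depend on [e]. *)
Lemma near_id_fixpoint_exists (ys : R) F m :
  near_id ys F 0 m -> m <> 0 ->
  forall d, 0 < d -> exists e1, 0 < e1 /\ forall e, 0 < Rabs e < e1 ->
    exists u, Rabs (u - ys) < d /\ F e u = u.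
Proof.
intros H Hm d Hd.
destruct (near_id_continuous _ _ _ _ H) as (d1 & e1 & Hd1 & He1 & B1).
assert (Hm' : 0 < Rabs m) by (apply Rabs_pos_lt, Hm).
destruct (H (Rabs m / 4) ltac:(lra)) as (d2 & e2 & Hd2 & He2 & B2).
set (r := Rmin d (Rmin d1 d2) / 2).
assert (Hr : 0 < r /\ r < d /\ r < d1 /\ r < d2).
{ assert (0 < Rmin d (Rmin d1 d2)) by (repeat apply Rmin_glb_lt; lra). unfold r.
  generalize (Rmin_l d (Rmin d1 d2)) (Rmin_r d (Rmin d1 d2)) (Rmin_l d1 d2) (Rmin_r d1 d2). lra. }
clearbody r.
(* The displacement at [ys] itself must be small against the linear term [|m| r] at the ends of the
   ball; the two errors together take at most half of that term. *)
destruct (H (Rabs m / 4 * r)) as (d3 & e3 & Hd3 & He3 & B3).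
{ apply Rmult_lt_0_compat; lra. }
exists (Rmin e1 (Rmin e2 e3)). split; [repeat apply Rmin_glb_lt; lra|].
intros e [He0 He]. apply Rmin_Rgt in He. destruct He as [E1 He]. apply Rmin_Rgt in He. destruct He as [E2 E3].
destruct (B2 e (conj He0 E2)) as [_ l2]. destruct (B3 e (conj He0 E3)) as [c3 _].
assert (Hys0 : Rabs (ys - ys) = 0) by (rewrite Rminus_diag; apply Rabs_R0).
assert (hs : forall s, Rabs s = r -> Rabs (F e (ys + s) - (ys + s) - e * m * s) <= / 2 * (Rabs e * Rabs m * r)).
{ intros s Hs. assert (h := l2 (ys + s) ys). replace (ys + s - ys) with s in h by ring. rewrite Hs in h.
  specialize (h ltac:(lra) ltac:(lra)).
  replace (F e (ys + s) - (ys + s) - e * m * s) with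
    ((F e (ys + s) - F e ys - (1 + e * m) * s) + (F e ys - ys - e * 0)) by ring.
  eapply Rle_trans; [apply Rabs_triang|]. lra. }
assert (hp := hs r ltac:(rewrite Rabs_right; lra)).
assert (hm := hs (- r) ltac:(rewrite Rabs_Ropp, Rabs_right; lra)).
assert (Hem : 0 < Rabs e * Rabs m * r) by (repeat apply Rmult_lt_0_compat; lra).
rewrite <- Rabs_mult in *. 
assert (Hcont : forall x, ys + - r <= x <= ys + r -> continuity_pt (fun u => F e u - u) x).
{ intros x Hx. apply continuity_pt_minus; [|apply derivable_continuous_pt, derivable_pt_id].
  apply B1; [split; lra|]. apply Rabs_lt_between; lra. }
apply Rabs_le_between in hp, hm.
destruct (Rle_dec 0 (e * m)) as [Hs|Hs].
- rewrite (Rabs_right (e * m)) in * by lra.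
  destruct (Ranalysis5.f_interv_is_interv (fun u => F e u - u) (ys + - r) (ys + r) 0) as [u [Hu Eu]].
  + lra. + lra. + exact Hcont.
  + exists u. split; [apply Rabs_lt_between; lra|lra].
- rewrite (Rabs_left (e * m)) in * by lra.
  destruct (Ranalysis5.f_interv_is_interv (fun u => - (F e u - u)) (ys + - r) (ys + r) 0) as [u [Hu Eu]].
  + lra. + lra. + intros x Hx. apply (continuity_pt_opp (fun u => F e u - u)), Hcont, Hx.
  + exists u. split; [apply Rabs_lt_between; lra|lra].
Qed.

(* Two orbits of [F] in a small ball separate or approach at a geometric rate, so two periodic ones coincide. *)
Lemma near_id_periodic_unique (ys : R) F m :
  near_id ys F 0 m -> m <> 0 ->
  exists d e1, 0 < d /\ 0 < e1 /\ forall e, 0 < Rabs e < e1 ->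
    forall (u v : nat -> R) (n : nat), (0 < n)%nat ->
      (forall k, Rabs (u k - ys) < d /\ u (S k) = F e (u k)) ->
      (forall k, Rabs (v k - ys) < d /\ v (S k) = F e (v k)) ->
      u n = u O -> v n = v O -> u O = v O.
Proof.
intros H Hm. assert (Hm' : 0 < Rabs m) by (apply Rabs_pos_lt, Hm).
destruct (H (Rabs m / 2) ltac:(lra)) as (d & e1 & Hd & He1 & B).
(* [|e m| < 1/2] keeps [1 + e m] positive; the distance of two orbits then grows or decays according
   to the sign of [e m]. *)
exists d, (Rmin e1 (/ (2 * Rabs m))). split; [exact Hd|]. split.
{ apply Rmin_glb_lt; [lra|]. apply Rinv_0_lt_compat; lra. }
intros e [He0 He] u v n Hn Hu Hv Eu Ev.
apply Rmin_Rgt in He. destruct He as [E1 E2]. apply Rgt_lt in E2.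
assert (E2' : Rabs e * Rabs m < / 2).
{ replace (/ 2) with (/ (2 * Rabs m) * Rabs m) by (field; lra). apply Rmult_lt_compat_r; lra. }
destruct (B e (conj He0 E1)) as [_ l].
assert (Hem : 0 < Rabs e * Rabs m) by (apply Rmult_lt_0_compat; lra).
set (D := fun k => Rabs (u k - v k)).
assert (Hl : forall k, Rabs (u (S k) - v (S k) - (1 + e * m) * (u k - v k)) <= Rabs (e * m) / 2 * D k).
{ intros k. destruct (Hu k) as [h1 ->]. destruct (Hv k) as [h2 ->].
  eapply Rle_trans; [apply l; assumption|]. right. rewrite Rabs_mult. unfold D. field. }
rewrite <- Rabs_mult in *.
assert (HD : forall k, 0 <= D k) by (intros; apply Rabs_pos).
assert (Hz : D O = 0 -> u O = v O).
{ intros h. apply Rminus_diag_uniq, Rabs_eq_0, h. }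
apply Hz. destruct (Rle_lt_or_eq_dec 0 (D O) (HD O)) as [Hpos|]; [exfalso|auto].
assert (Hend : D n = D O) by (unfold D; rewrite Eu, Ev; reflexivity).
destruct (Rle_dec 0 (e * m)) as [Hs|Hs].
- rewrite (Rabs_right (e * m)) in * by lra.
  assert (Hg : forall k, (1 + e * m / 2) * D k <= D (S k)).
  { intros k. assert (h := Hl k). unfold D in *.
    assert (h2 : Rabs ((1 + e * m) * (u k - v k)) <= Rabs (u (S k) - v (S k)) + e * m / 2 * Rabs (u k - v k)).
    { replace ((1 + e * m) * (u k - v k)) with ((u (S k) - v (S k)) - (u (S k) - v (S k) - (1 + e * m) * (u k - v k))) by ring.
      eapply Rle_trans; [apply Rabs_triang|]. rewrite Rabs_Ropp. lra. }
    rewrite Rabs_mult, (Rabs_right (1 + e * m)) in h2 by lra. lra. }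
  assert (Hk : forall k, D O <= D k).
  { induction k as [|k IH]; [lra|]. assert (h := Hg k). assert (h' := HD k).
    assert (0 <= e * m / 2 * D k) by (apply Rmult_le_pos; lra). lra. }
  destruct n as [|n]; [lia|]. assert (h := Hg n). assert (h' := Hk n).
  assert (0 < e * m / 2 * D n) by (apply Rmult_lt_0_compat; lra). lra.
- rewrite (Rabs_left (e * m)) in * by lra.
  assert (Hg : forall k, D (S k) <= (1 + e * m / 2) * D k).
  { intros k. assert (h := Hl k). unfold D in *.
    replace (u (S k) - v (S k)) with ((u (S k) - v (S k) - (1 + e * m) * (u k - v k)) + (1 + e * m) * (u k - v k)) by ring.
    eapply Rle_trans; [apply Rabs_triang|]. rewrite Rabs_mult, (Rabs_right (1 + e * m)) by lra. lra. }
  assert (Hk : forall k, D (S k) < D O).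
  { induction k as [|k IH].
    - assert (h := Hg O). assert (0 < - (e * m / 2) * D O) by (apply Rmult_lt_0_compat; lra). lra.
    - assert (h := Hg (S k)). assert (h' := HD (S k)).
      assert (0 <= - (e * m / 2) * D (S k)) by (apply Rmult_le_pos; lra). lra. }
  destruct n as [|n]; [lia|]. assert (h := Hk n). lra.
Qed.

(** * Filippov velocities in polar coordinates *)

Definition polar (x y : R) : C := (1 + exp y * cos x, - (exp y * sin x)).
(** The differential of [polar] at [(x, y)] applied to [(dx, dy)]. *)
Definition polar_push (x y dx dy : R) : C :=
  (exp y * (cos x * dy - sin x * dx), - (exp y * (sin x * dy + cos x * dx))).

(* Coefficients of [sum_m c_m (z - 1)^m] in powers of [z]. *)
Definition acoef (c : zone -> nat -> R) (s : zone) (j : nat) : R :=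
  match j with
  | 0%nat => c s 0%nat - c s 1%nat + c s 2%nat - c s 3%nat
  | 1%nat => c s 1%nat - 2 * c s 2%nat + 3 * c s 3%nat
  | 2%nat => c s 2%nat - 3 * c s 3%nat
  | _ => c s 3%nat
  end.
Definition bcoef (s : zone) (j : nat) : R := 0.
Definition centered (c : zone -> nat -> R) (e : R) : pw_field := perturbed (acoef c) bcoef e.

Lemma centered_polar c e s x y :
  centered c e s (polar x y) =
  polar_push x y (1 + e * fieldA (c s) x y) (e * fieldB (c s) x y).
Proof.
assert (H1 : exp y * exp (- y) = 1) by (rewrite <- exp_plus, Rplus_opp_r; apply exp_0).
assert (H2 := sin2_cos2 x). unfold Rsqr in H2.
unfold centered, perturbed, h. rewrite !sum_Sn, sum_O. unfold plus; simpl.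
unfold polar, polar_push, fieldA, fieldB, bcoef, acoef.
revert H1 H2. generalize (exp y) (exp (- y)) (cos x) (sin x). intros r r' C S H1 H2.
unfold Cplus, Cmult, Copp, Cminus, RtoC, Ci. simpl.
apply injective_projections; simpl.
- transitivity (r * S * -1 + e * (c s 0%nat + c s 1%nat * (r * C) + c s 2%nat * (r * r * (C * C - S * S))
    + c s 3%nat * (r * r * r * (C * C * C - 3 * C * S * S)))); [ring|].
  transitivity (r * S * -1 + e * (c s 0%nat * (r * r' * (S * S + C * C)) + c s 1%nat * (r * C) + c s 2%nat * (r * r * (C * C - S * S))
    + c s 3%nat * (r * r * r * (C * C * C - 3 * C * S * S)))); [rewrite H1, H2|]; ring.
- ring_simplify. replace (C ^ 2) with (1 - S * S) by lra. ring.
Qed.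

Lemma polar_periodic x y : polar (x + 2 * PI) y = polar x y.
Proof. unfold polar. rewrite cos_plus, sin_plus, cos_2PI, sin_2PI. f_equal; ring. Qed.

Lemma polar_shift x y k : polar (x - 2 * PI * INR k) y = polar x y.
Proof.
induction k as [|k IH].
- simpl INR. rewrite Rmult_0_r, Rminus_0_r. reflexivity.
- rewrite <- IH, <- (polar_periodic (x - 2 * PI * INR (S k))), S_INR. f_equal. ring.
Qed.

Lemma Cmod_sub_le (z w : C) : Cmod w <= Cmod z + Cmod (w - z)%C.
Proof. replace w with (z + (w - z))%C at 1 by ring. apply Cmod_triangle. Qed.

Lemma Cmod_sub_sym (z w : C) : Cmod (z - w)%C = Cmod (w - z)%C.
Proof. rewrite <- Cmod_opp. f_equal. ring. Qed.

Lemma in_closure_le (A : C -> Prop) (f : C -> R) (z : C) (c : R) :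
  (forall u v, f u <= f v + Cmod (u - v)%C) -> (forall w, A w -> f w <= c) ->
  in_closure A z -> f z <= c.
Proof.
intros Hf HA Hz. apply le_epsilon. intros eps He.
destruct (Hz eps He) as (w & Hw & Hd). assert (h := Hf z w). assert (h' := HA w Hw).
rewrite Cmod_sub_sym in h. lra.
Qed.

(** Any two zones are separated by one of the 1-Lipschitz functions [|z|] and [|z - 2/3|], up to
    sign. For the inner disk and the exterior the tangency enters through
    [|z| <= |z - 2/3| + 2/3]. *)
Lemma in_zone_not_closure (s s' : zone) (z : C) :
  in_zone s z -> s' <> s -> ~ in_closure (in_zone s') z.
Proof.
intros Hz Hne Hcl.
set (f1 := fun z : C => Cmod (z - RtoC (2 / 3))%C). set (f2 := fun z : C => Cmod z).
assert (L1 : forall u v, f1 u <= f1 v + Cmod (u - v)%C).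
{ intros u v. unfold f1. replace (u - v)%C with ((u - RtoC (2/3)) - (v - RtoC (2/3)))%C by ring. apply Cmod_sub_le. }
assert (L2 : forall u v, f2 u <= f2 v + Cmod (u - v)%C) by (intros; apply Cmod_sub_le).
assert (L1' : forall u v, - f1 u <= - f1 v + Cmod (u - v)%C).
{ intros u v. generalize (L1 v u). rewrite (Cmod_sub_sym v u). lra. }
assert (L2' : forall u v, - f2 u <= - f2 v + Cmod (u - v)%C).
{ intros u v. generalize (L2 v u). rewrite (Cmod_sub_sym v u). lra. }
assert (L3 : forall u, f2 u <= f1 u + 2 / 3).
{ intros u. generalize (Cmod_sub_le (RtoC (2 / 3)) u). rewrite Cmod_R, Rabs_right by lra. unfold f1, f2. lra. }
assert (L3' : forall u, Cmod u <= Cmod (u - RtoC (2 / 3))%C + 2 / 3) by exact L3.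
destruct s, s'; try congruence; simpl in Hz; try destruct Hz as [Hz Hz2].
- assert (h := fun H => in_closure_le _ (fun u => - f1 u) z (- (1 / 3)) L1' H Hcl). cbv beta in h. simpl in h.
  apply (Rlt_not_le _ _ (Rlt_0_1)). unfold f1, f2 in *.
  assert (h' := h ltac:(intros w hw; try destruct hw; try generalize (L3' w); lra)). lra.
- assert (h := fun H => in_closure_le _ (fun u => - f2 u) z (- 1) L2' H Hcl). cbv beta in h. simpl in h.
  apply (Rlt_not_le _ _ (Rlt_0_1)). generalize (L3 z); unfold f1, f2 in *.
  assert (h' := h ltac:(intros w hw; try destruct hw; try generalize (L3' w); lra)). lra.
- assert (h := fun H => in_closure_le _ f1 z (1 / 3) L1 H Hcl). cbv beta in h. simpl in h.
  apply (Rlt_not_le _ _ (Rlt_0_1)). unfold f1, f2 in *.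
  assert (h' := h ltac:(intros w hw; try destruct hw; try generalize (L3' w); lra)). lra.
- assert (h := fun H => in_closure_le _ (fun u => - f2 u) z (- 1) L2' H Hcl). cbv beta in h. simpl in h.
  apply (Rlt_not_le _ _ (Rlt_0_1)). unfold f1, f2 in *.
  assert (h' := h ltac:(intros w hw; try destruct hw; try generalize (L3' w); lra)). lra.
- assert (h := fun H => in_closure_le _ f2 z 1 L2 H Hcl). cbv beta in h. simpl in h.
  apply (Rlt_not_le _ _ (Rlt_0_1)). unfold f1, f2 in *.
  assert (h' := h ltac:(intros w hw; try destruct hw; try generalize (L3' w); lra)). lra.
- assert (h := fun H => in_closure_le _ f2 z 1 L2 H Hcl). cbv beta in h. simpl in h.
  apply (Rlt_not_le _ _ (Rlt_0_1)). unfold f1, f2 in *.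
  assert (h' := h ltac:(intros w hw; try destruct hw; try generalize (L3' w); lra)). lra.
Qed.

Lemma in_zone_in_closure s z : in_zone s z -> in_closure (in_zone s) z.
Proof.
intros Hz d Hd. exists z. split; [exact Hz|]. replace (z - z)%C with (RtoC 0) by ring.
rewrite Cmod_0. exact Hd.
Qed.

Definition only_zone (s s' : zone) : R :=
  match s, s' with Zplus, Zplus => 1 | Zcenter, Zcenter => 1 | Zminus, Zminus => 1 | _, _ => 0 end.

Lemma filippov_closure (X : pw_field) s z : in_closure (in_zone s) z -> filippov X z (X s z).
Proof.
intros Hs. exists (only_zone s). split; [intros s'; destruct s, s'; simpl; lra|].
split; [destruct s; simpl; lra|]. split.
- intros s' Hn. destruct s, s'; simpl; try reflexivity; contradiction.
- destruct s; simpl; ring.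
Qed.

Lemma polar_push_comb x y l1 l2 l3 a1 a2 a3 b1 b2 b3 :
  (RtoC l1 * polar_push x y a1 b1 + RtoC l2 * polar_push x y a2 b2 + RtoC l3 * polar_push x y a3 b3)%C =
  polar_push x y (l1 * a1 + l2 * a2 + l3 * a3) (l1 * b1 + l2 * b2 + l3 * b3).
Proof.
unfold polar_push, Cplus, Cmult, RtoC. apply injective_projections; simpl; ring.
Qed.

(** Averaging with arbitrary weights keeps [dx] within [K |e|] of 1 and [dy] within [K |e|] of 0, so
    the bounds hold on the circles and at their tangency point too, where the velocity is ambiguous.
    Inside a zone the other weights vanish and the velocity is exact. *)
Lemma filippov_polar c e x y v K :
  filippov (centered c e) (polar x y) v ->
  (forall s, Rabs (fieldA (c s) x y) <= K /\ Rabs (fieldB (c s) x y) <= K) ->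
  exists dx dy, v = polar_push x y dx dy /\
    Rabs (dx - 1) <= K * Rabs e /\ Rabs dy <= K * Rabs e /\
    forall s, in_zone s (polar x y) ->
      dx = 1 + e * fieldA (c s) x y /\ dy = e * fieldB (c s) x y.
Proof.
intros (l & Hl & Hs & Hn & ->) HK.
rewrite !centered_polar, polar_push_comb. eexists _, _. split; [reflexivity|].
assert (Hb : forall f : zone -> R, (forall s, Rabs (f s) <= K) ->
   Rabs (l Zplus * (e * f Zplus) + l Zcenter * (e * f Zcenter) + l Zminus * (e * f Zminus)) <= K * Rabs e).
{ intros f Hf.
  replace (l Zplus * (e * f Zplus) + l Zcenter * (e * f Zcenter) + l Zminus * (e * f Zminus))
   with ((l Zplus * f Zplus + l Zcenter * f Zcenter + l Zminus * f Zminus) * e) by ring.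
  rewrite Rabs_mult. apply Rmult_le_compat_r; [apply Rabs_pos|].
  assert (G : forall s, - (l s * K) <= l s * f s <= l s * K).
  { intros s. assert (h := Hf s). apply Rabs_le_between in h. assert (g := Hl s). nra. }
  assert (g1 := G Zplus). assert (g2 := G Zcenter). assert (g3 := G Zminus).
  replace K with ((l Zplus + l Zcenter + l Zminus) * K) by (rewrite Hs; ring).
  apply Rabs_le. lra. }
split; [|split].
- eapply Rle_trans; [|apply (Hb (fun s => fieldA (c s) x y)); intros s; apply HK].
  right. f_equal. apply Rminus_diag_uniq.
  transitivity (l Zplus + l Zcenter + l Zminus - 1); [ring|lra].
- apply (Hb (fun s => fieldB (c s) x y)). intros s. apply HK.
- intros s Hz.
  assert (Hz0 : forall s', s' <> s -> l s' = 0).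
  { intros s' h. apply Hn. apply (in_zone_not_closure s s'); assumption. }
  destruct s.
  + rewrite (Hz0 Zcenter), (Hz0 Zminus) in * by discriminate. replace (l Zplus) with 1 by lra. split; ring.
  + rewrite (Hz0 Zplus), (Hz0 Zminus) in * by discriminate. replace (l Zcenter) with 1 by lra. split; ring.
  + rewrite (Hz0 Zplus), (Hz0 Zcenter) in * by discriminate. replace (l Zminus) with 1 by lra. split; ring.
Qed.

Lemma filippov_in_zone c e s x y :
  in_zone s (polar x y) ->
  filippov (centered c e) (polar x y)
    (polar_push x y (1 + e * fieldA (c s) x y) (e * fieldB (c s) x y)).
Proof.
intros Hz. rewrite <- centered_polar. apply filippov_closure, in_zone_in_closure, Hz.
Qed.

(** * First integrals of the zones and their matching along the sections *)

Lemma zone_field_bounded (c : zone -> nat -> R) (y0 : R) :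
  exists K, 0 < K /\ forall s x y, Rabs (y - y0) < 1 ->
    Rabs (fieldA (c s) x y) <= K /\ Rabs (fieldB (c s) x y) <= K.
Proof.
destruct (field_bounded (c Zplus) y0) as (K1 & H1 & B1).
destruct (field_bounded (c Zcenter) y0) as (K2 & H2 & B2).
destruct (field_bounded (c Zminus) y0) as (K3 & H3 & B3).
exists (K1 + K2 + K3). split; [lra|]. intros s x y Hy.
destruct s; [destruct (B1 x y Hy)|destruct (B2 x y Hy)|destruct (B3 x y Hy)]; lra.
Qed.

(* [x + e p] and [y + e q] are the time and the first integral of the system with coefficients [c]. *)
Record first_integral (c : nat -> R) (y0 e C : R) (p q : R -> R -> R) : Prop := {
  fi_N : forall x y, Rabs (y - y0) < 1 -> gradN c e x y <> 0;
  fi_p : gradient_on y0 1 p (gradU c e) (fun x y => - gradV c e x y);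
  fi_q : gradient_on y0 1 q (gradV c e) (gradU c e);
  fi_lp : lip_on y0 1 (C * Rabs e) (fun x y => e * p x y);
  fi_lq : lip_on y0 1 (C * Rabs e) (fun x y => e * q x y);
  fi_q0 : q 0 y0 = 0;
  fi_qk : lip_on y0 1 (C * Rabs e) (fun x y => q x y + kappa c x y)
}.
Arguments fi_N {c y0 e C p q} _.
Arguments fi_p {c y0 e C p q} _.
Arguments fi_q {c y0 e C p q} _.
Arguments fi_lp {c y0 e C p q} _.
Arguments fi_lq {c y0 e C p q} _.
Arguments fi_q0 {c y0 e C p q} _.
Arguments fi_qk {c y0 e C p q} _.

Lemma lip_on_scale y0 d K e f : lip_on y0 d K f -> lip_on y0 d (K * Rabs e) (fun x y => e * f x y).
Proof.
intros H x1 y1 x2 y2 h1 h2. replace (e * f x1 y1 - e * f x2 y2) with (e * (f x1 y1 - f x2 y2)) by ring.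
rewrite Rabs_mult. rewrite (Rmult_comm K), Rmult_assoc.
apply Rmult_le_compat_l; [apply Rabs_pos|]. apply H; assumption.
Qed.

Lemma lip_on_le y0 d K K' f : K <= K' -> lip_on y0 d K f -> lip_on y0 d K' f.
Proof.
intros Hk H x1 y1 x2 y2 h1 h2. eapply Rle_trans; [apply H; assumption|].
apply Rmult_le_compat_r; [|exact Hk]. generalize (Rabs_pos (x1 - x2)) (Rabs_pos (y1 - y2)). lra.
Qed.

Lemma first_integral_exists (c : zone -> nat -> R) (y0 : R) :
  exists e0 C, 0 < e0 /\ 0 < C /\ exists p q : zone -> R -> R -> R -> R,
    forall s e, Rabs e < e0 -> first_integral (c s) y0 e C (p s e) (q s e).
Proof.
destruct (zone_field_bounded c y0) as (K & HK & B).
assert (He0 : 0 < / (4 * K)) by (apply Rinv_0_lt_compat; lra).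
(* A common constant for the Lipschitz bounds [4 K] of [p] and [q] and [40 K^2 |e|] of
   [q + kappa]. *)
set (C := 4 * K + 40 * K * K).
assert (HC : 0 < C) by (unfold C; assert (0 < K * K) by (apply Rmult_lt_0_compat; lra); lra).
assert (HKK : 0 < K * K) by (apply Rmult_lt_0_compat; lra).
exists (/ (4 * K)), C. split; [exact He0|]. split; [exact HC|].
assert (Hex : forall w : zone * R, exists pq : (R -> R -> R) * (R -> R -> R), Rabs (snd w) < / (4 * K) ->
   first_integral (c (fst w)) y0 (snd w) C (fst pq) (snd pq)).
{ intros [s e]. simpl. destruct (Rlt_dec (Rabs e) (/ (4 * K))) as [He|He].
  (* Default pair outside the admissible range of [e], so that choice yields functions of all
     [e]. *)
  2:{ exists (fun _ _ => 0, fun _ _ => 0). intros; lra. }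
  assert (HeK : Rabs e * K <= 1 / 4).
  { replace (1 / 4) with (/ (4 * K) * K) by (field; lra). apply Rmult_le_compat_r; lra. }
  assert (HN : forall x y, Rabs (y - y0) < 1 -> gradN (c s) e x y <> 0).
  { intros x y Hy. assert (h := gradN_pos (c s) e x y K (proj1 (B s x y Hy)) HeK). lra. }
  assert (HB := fun x y (Hy : Rabs (y - y0) < 1) =>
    grad_bounds (c s) e x y K HK (proj1 (B s x y Hy)) (proj2 (B s x y Hy)) HeK).
  destruct (grad_primitive (c s) e y0 HN) as (p & q & Hp & Hq & Hq0).
  assert (Hlp : lip_on y0 1 (4 * K) p).
  { unfold lip_on. apply (gradient_lipschitz y0 1 (4 * K) p _ _ Hp). intros x y Hy. rewrite Rabs_Ropp.
    destruct (HB x y Hy) as (h1 & h2 & _ & _). split; assumption. }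
  assert (Hlq : lip_on y0 1 (4 * K) q).
  { unfold lip_on. apply (gradient_lipschitz y0 1 (4 * K) q _ _ Hq). intros x y Hy.
    destruct (HB x y Hy) as (h1 & h2 & _ & _). split; assumption. }
  exists (p, q). intros _. simpl. split.
  - exact HN.
  - exact Hp.
  - exact Hq.
  - apply (lip_on_le _ _ (4 * K * Rabs e)); [|apply lip_on_scale, Hlp].
    apply Rmult_le_compat_r; [apply Rabs_pos|unfold C; lra].
  - apply (lip_on_le _ _ (4 * K * Rabs e)); [|apply lip_on_scale, Hlq].
    apply Rmult_le_compat_r; [apply Rabs_pos|unfold C; lra].
  - exact Hq0.
  - apply (lip_on_le _ _ (40 * K * K * Rabs e)).
    { apply Rmult_le_compat_r; [apply Rabs_pos|unfold C; lra]. }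
    unfold lip_on. apply (gradient_lipschitz y0 1 (40 * K * K * Rabs e) (fun x y => q x y + kappa (c s) x y)
      (fun x y => gradV (c s) e x y + fieldB (c s) x y) (fun x y => gradU (c s) e x y + fieldA (c s) x y)).
    + intros x y Hy. destruct (Hq x y Hy) as [h1 h2]. split.
      * apply (is_derive_plus (fun t => q t y) (fun t => kappa (c s) t y)); [exact h1|apply kappa_dx].
      * apply (is_derive_plus (fun t => q x t) (fun t => kappa (c s) x t)); [exact h2|apply kappa_dy].
    + intros x y Hy. destruct (HB x y Hy) as (_ & _ & h1 & h2). split; assumption. }
destruct (choice _ Hex) as [f Hf].
exists (fun s e => fst (f (s, e))), (fun s e => snd (f (s, e))).
intros s e He. apply (Hf (s, e)), He.
Qed.

Definition strict_derive (f : R -> R) (x l : R) : Prop :=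
  forall k, 0 < k -> exists d, 0 < d /\ forall u v, Rabs (u - x) < d -> Rabs (v - x) < d ->
    Rabs (f u - f v - l * (u - v)) <= k * Rabs (u - v).

Lemma strict_derive_C1 (f df : R -> R) (x r : R) : 0 < r ->
  (forall t, Rabs (t - x) < r -> is_derive f t (df t)) -> continuity_pt df x ->
  strict_derive f x (df x).
Proof.
intros Hr Hd Hc k Hk. destruct (Hc k Hk) as (r1 & Hr1 & B).
exists (Rmin r r1). split; [apply Rmin_glb_lt; assumption|].
intros u v Hu Hv. apply Rmin_Rgt in Hu, Hv.
assert (Hin : forall t, Rmin v u <= t <= Rmax v u -> Rabs (t - x) < r /\ Rabs (t - x) < r1).
{ intros t Ht. split; apply (in_strip_between x _ v u); try apply Ht; lra. }
destruct (MVT_gen f v u df) as [t [Ht E]].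
- intros t Ht. apply Hd, Hin. lra.
- intros t Ht. apply continuity_pt_filterlim, (ex_derive_continuous f). exists (df t). apply Hd, Hin, Ht.
- rewrite E. replace (df t * (u - v) - df x * (u - v)) with ((df t - df x) * (u - v)) by ring.
  rewrite Rabs_mult. apply Rmult_le_compat_r; [apply Rabs_pos|].
  destruct (Req_dec t x) as [->|Hne].
  + rewrite Rminus_diag, Rabs_R0. lra.
  + left. apply B. split; [split; [exact I|auto]|]. apply Hin, Ht.
Qed.

(** The first integral restricted to the section [x = xi u] is [u + e q], where [q + kappa] has
    Lipschitz constant [O(e)]. Hence the first-order term is [- kappa], and its slope along the
    section comes from the chain rule. *)
Lemma near_id_crossing (c : nat -> R) (y0 e0 C l : R) (p q : R -> R -> R -> R) (xi : R -> R) :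
  0 < e0 -> 0 < C ->
  (forall e, Rabs e < e0 -> first_integral c y0 e C (p e) (q e)) ->
  strict_derive xi y0 l ->
  near_id y0 (fun e u => u + e * q e (xi u) u) (- kappa c (xi y0) y0)
    (- (fieldB c (xi y0) y0 * l + fieldA c (xi y0) y0)).
Proof.
intros He0 HC HF Hxi kap Hk.
set (x0 := xi y0) in *. set (B := fieldB c x0 y0). set (A := fieldA c x0 y0).
set (M := Rabs l + 2). assert (HM : 0 < M) by (unfold M; generalize (Rabs_pos l); lra).
set (k1 := Rmin 1 (kap / (4 * (Rabs B + M)))).
assert (HBM : 0 < 4 * (Rabs B + M)) by (generalize (Rabs_pos B); lra).
assert (Hk1 : 0 < k1 /\ k1 <= 1 /\ k1 * (Rabs B + M) <= kap / 4).
{ split; [apply Rmin_glb_lt; [lra|apply Rdiv_lt_0_compat; lra]|]. split; [apply Rmin_l|].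
  assert (h : k1 <= kap / (4 * (Rabs B + M))) by apply Rmin_r.
  apply Rle_div_r in h; [|lra]. lra. }
destruct (Hxi k1 (proj1 Hk1)) as (d1 & Hd1 & B1).
destruct (gradient_strict y0 1 (kappa c) (fieldB c) (fieldA c) x0 y0 k1) as (r & Hr & B2).
{ intros x y _. split; [apply kappa_dx|apply kappa_dy]. }
{ rewrite Rminus_diag, Rabs_R0. lra. }
{ apply fieldB_cont. } { apply fieldA_cont. } { apply Hk1. }
exists (Rmin (Rmin 1 d1) (r / M)), (Rmin e0 (kap / (4 * C * (M + Rabs x0)))).
assert (HCM : 0 < 4 * C * (M + Rabs x0)).
{ assert (0 < M + Rabs x0) by (generalize (Rabs_pos x0); lra).
  assert (0 < C * (M + Rabs x0)) by (apply Rmult_lt_0_compat; lra). lra. }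
split. { repeat apply Rmin_glb_lt; try lra. apply Rdiv_lt_0_compat; lra. }
split. { apply Rmin_glb_lt; [lra|]. apply Rdiv_lt_0_compat; lra. }
intros e [H0 He]. apply Rmin_Rgt in He. destruct He as [E1 E2]. apply Rgt_lt in E2.
apply Rlt_div_r in E2; [|exact HCM].
destruct (HF e E1) as [_ _ _ _ _ Q0 QK].
assert (EM : C * Rabs e * M <= kap / 4).
{ assert (0 <= C * Rabs e * Rabs x0) by (repeat apply Rmult_le_pos; try lra; apply Rabs_pos). lra. }
assert (EX : C * Rabs e * Rabs x0 <= kap / 4).
{ assert (0 <= C * Rabs e * M) by (repeat apply Rmult_le_pos; lra). lra. }
assert (Hyy : Rabs (y0 - y0) < 1) by (rewrite Rminus_diag, Rabs_R0; lra).
split.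
- fold x0. replace (y0 + e * q e x0 y0 - y0 - e * - kappa c x0 y0) with (e * (q e x0 y0 + kappa c x0 y0)) by ring.
  rewrite Rabs_mult, Rmult_comm. apply Rmult_le_compat_r; [apply Rabs_pos|].
  (* [q] and [kappa] both vanish at [(0, y0)], so the Lipschitz bound for the sum also bounds its
     value. *)
  assert (h := QK x0 y0 0 y0 Hyy Hyy). cbv beta in h. rewrite Q0 in h.
  replace (kappa c 0 y0) with 0 in h by (unfold kappa; rewrite sin_0; ring).
  rewrite Rplus_0_r, !Rminus_0_r, Rminus_diag, Rabs_R0, Rplus_0_r in h. lra.
- intros u v Hu Hv.
  assert (Hin : forall u, Rabs (u - y0) < Rmin (Rmin 1 d1) (r / M) ->
    Rabs (u - y0) < 1 /\ Rabs (u - y0) < d1 /\ M * Rabs (u - y0) < r).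
  { intros z Hz. apply Rmin_Rgt in Hz. destruct Hz as [Hz h3]. apply Rmin_Rgt in Hz. apply Rgt_lt in h3.
    apply Rlt_div_r in h3; lra. }
  destruct (Hin u Hu) as (u1 & u2 & u3). destruct (Hin v Hv) as (v1 & v2 & v3).
  assert (Hxl : forall u v, Rabs (u - y0) < d1 -> Rabs (v - y0) < d1 ->
     Rabs (xi u - xi v) <= (Rabs l + 1) * Rabs (u - v)).
  { intros a b ha hb. assert (h := B1 a b ha hb).
    replace (xi a - xi b) with ((xi a - xi b - l * (a - b)) + l * (a - b)) by ring.
    eapply Rle_trans; [apply Rabs_triang|]. rewrite Rabs_mult. generalize (Rabs_pos (a - b)). nra. }
  assert (Hxr : forall u, Rabs (u - y0) < d1 -> M * Rabs (u - y0) < r -> Rabs (xi u - x0) < r).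
  { intros a ha hb. eapply Rle_lt_trans; [apply (Hxl a y0); [exact ha|rewrite Rminus_diag, Rabs_R0; exact Hd1]|].
    eapply Rle_lt_trans; [|exact hb]. apply Rmult_le_compat_r; [apply Rabs_pos|unfold M; lra]. }
  assert (Hyr : forall u, M * Rabs (u - y0) < r -> Rabs (u - y0) < r).
  { intros a ha. eapply Rle_lt_trans; [|exact ha]. rewrite <- (Rmult_1_l (Rabs (a - y0))) at 1.
    apply Rmult_le_compat_r; [apply Rabs_pos|unfold M; generalize (Rabs_pos l); lra]. }
  assert (h1 := B1 u v u2 v2). assert (h2 := Hxl u v u2 v2). assert (hp := Rabs_pos (u - v)).
  assert (h3 := B2 (xi u) u (xi v) v (Hxr u u2 u3) (Hyr u u3) (Hxr v v2 v3) (Hyr v v3)). fold A B in h3.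
  assert (h4 := QK (xi u) u (xi v) v u1 v1). cbv beta in h4.
  assert (h5 : Rabs (xi u - xi v) + Rabs (u - v) <= M * Rabs (u - v)) by (unfold M; lra).
  replace (u + e * q e (xi u) u - (v + e * q e (xi v) v) - (1 + e * - (B * l + A)) * (u - v)) with
    (e * ((q e (xi u) u + kappa c (xi u) u - (q e (xi v) v + kappa c (xi v) v))
      + - (kappa c (xi u) u - kappa c (xi v) v - (B * (xi u - xi v) + A * (u - v)))
      + - (B * (xi u - xi v - l * (u - v))))) by ring.
  rewrite Rabs_mult, (Rmult_comm kap), Rmult_assoc. apply Rmult_le_compat_l; [apply Rabs_pos|].
  eapply Rle_trans; [apply Rabs_triang|].
  eapply Rle_trans; [apply Rplus_le_compat_r, Rabs_triang|]. rewrite !Rabs_Ropp, Rabs_mult.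
  assert (t1 : C * Rabs e * (Rabs (xi u - xi v) + Rabs (u - v)) <= kap / 4 * Rabs (u - v)).
  { apply Rle_trans with (C * Rabs e * (M * Rabs (u - v))).
    - apply Rmult_le_compat_l; [apply Rmult_le_pos; lra|exact h5].
    - rewrite <- Rmult_assoc. apply Rmult_le_compat_r; lra. }
  assert (t2 : k1 * (Rabs (xi u - xi v) + Rabs (u - v)) <= k1 * M * Rabs (u - v)).
  { rewrite Rmult_assoc. apply Rmult_le_compat_l; lra. }
  assert (t3 : Rabs B * Rabs (xi u - xi v - l * (u - v)) <= k1 * Rabs B * Rabs (u - v)).
  { rewrite (Rmult_comm k1), Rmult_assoc. apply Rmult_le_compat_l; [apply Rabs_pos|exact h1]. }
  assert (t4 : k1 * (Rabs B + M) * Rabs (u - v) <= kap / 4 * Rabs (u - v)) by (apply Rmult_le_compat_r; lra).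
  assert (0 <= kap * Rabs (u - v)) by (apply Rmult_le_pos; lra). lra.
Qed.

Fixpoint fsum (f : nat -> R) (n : nat) : R :=
  match n with O => 0 | S m => fsum f m + f m end.

(** [eta i] stands for the height at which an orbit crosses the [i]-th section; [al i] and [be i]
    will be the first integral of the [i]-th zone on its entry and exit sections. *)
Definition chain (al be : nat -> R -> R -> R) (e : R) (N : nat) (eta : nat -> R) : Prop :=
  forall i, (i < N)%nat -> al i e (eta i) = be i e (eta (S i)).

Lemma near_id_ext ys f p a p' a' : near_id ys f p a -> p = p' -> a = a' -> near_id ys f p' a'.
Proof. intros H <- <-. exact H. Qed.

Lemma near_id_ball ys f p a : near_id ys f p a ->
  forall d, 0 < d -> exists d' e1, 0 < d' /\ 0 < e1 /\ forall e u, 0 < Rabs e < e1 ->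
    Rabs (u - ys) < d' -> Rabs (f e u - ys) < d.
Proof.
intros H d Hd.
destruct (near_id_slope _ _ _ _ 1 H Rlt_0_1) as (d1 & e1 & Hd1 & He1 & B1).
destruct (near_id_center _ _ _ _ H) as (e2 & He2 & B2).
assert (HC : 0 < Rabs p + 1) by (generalize (Rabs_pos p); lra).
exists (Rmin d1 (d / 4)), (Rmin (Rmin e1 e2) (d / (4 * (Rabs p + 1)))).
split; [apply Rmin_glb_lt; lra|]. split.
{ repeat apply Rmin_glb_lt; auto. apply Rdiv_lt_0_compat; lra. }
intros e u [H0 He] Hu. apply Rmin_Rgt in He, Hu. destruct He as [He E3]. apply Rmin_Rgt in He.
apply Rgt_lt in E3. apply Rlt_div_r in E3; [|lra].
assert (h1 := B1 e (conj H0 (proj1 He)) u ys (proj1 Hu)). rewrite Rminus_diag, Rabs_R0 in h1.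
specialize (h1 Hd1). assert (h2 := B2 e (conj H0 (proj2 He))).
replace (f e u - ys) with ((f e u - f e ys - (u - ys)) + (u - ys) + (f e ys - ys)) by ring.
eapply Rle_lt_trans; [apply Rabs_triang|].
eapply Rle_lt_trans; [apply Rplus_le_compat_r, Rabs_triang|]. lra.
Qed.

Lemma near_id_id ys : near_id ys (fun _ u => u) 0 0.
Proof.
intros kap Hk. exists 1, 1. split; [lra|]. split; [lra|]. intros e He. split.
- replace (ys - ys - e * 0) with 0 by ring. rewrite Rabs_R0. apply Rmult_le_pos; lra.
- intros u v _ _. replace (u - v - (1 + e * 0) * (u - v)) with 0 by ring. rewrite Rabs_R0.
  repeat apply Rmult_le_pos; try lra. apply Rabs_pos.
Qed.

Lemma chain_map (ys : R) (al be : nat -> R -> R -> R) (p a q b : nat -> R) (N : nat) :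
  (forall i, (i < N)%nat -> near_id ys (al i) (p i) (a i) /\ near_id ys (be i) (q i) (b i)) ->
  exists F : R -> R -> R,
    near_id ys F (fsum (fun i => p i - q i) N) (fsum (fun i => a i - b i) N) /\
    (exists d e1, 0 < d /\ 0 < e1 /\ forall e, 0 < Rabs e < e1 ->
      (forall eta, (forall i, (i <= N)%nat -> Rabs (eta i - ys) < d) -> chain al be e N eta ->
        eta N = F e (eta O)) /\
      (forall eta eta', (forall i, (i <= N)%nat -> Rabs (eta i - ys) < d) -> chain al be e N eta ->
        (forall i, (i <= N)%nat -> Rabs (eta' i - ys) < d) -> chain al be e N eta' ->
        eta O = eta' O -> forall i, (i <= N)%nat -> eta i = eta' i)) /\
    (forall d, 0 < d -> exists d' e1, 0 < d' /\ 0 < e1 /\ forall e u, 0 < Rabs e < e1 ->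
      Rabs (u - ys) < d' -> exists eta, eta O = u /\ eta N = F e u /\ chain al be e N eta /\
        forall i, (i <= N)%nat -> Rabs (eta i - ys) < d).
Proof.
induction N as [|N IH]; intros H.
- exists (fun _ u => u). split; [apply near_id_id|]. split.
  + exists 1, 1. split; [lra|]. split; [lra|]. intros e He. split; [reflexivity|].
    intros eta eta' _ _ _ _ E i Hi. replace i with O by lia. exact E.
  + intros d Hd. exists d, 1. split; [lra|]. split; [lra|]. intros e u _ Hu.
    exists (fun _ => u). split; [reflexivity|]. split; [reflexivity|]. split; [intros i Hi; lia|auto].
- destruct IH as (F & HF & (d1 & e1 & Hd1 & He1 & U) & E); [intros i Hi; apply H; lia|].
  destruct (H N ltac:(lia)) as [HA HB].
  destruct (near_id_solve _ _ _ _ _ _ _ HA HB) as (f & Hf & d2 & e2 & Hd2 & He2 & G).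
  exists (fun e u => f e (F e u)). split; [|split].
  + simpl. apply near_id_comp; assumption.
  + exists (Rmin d1 d2), (Rmin e1 e2). split; [apply Rmin_glb_lt; lra|]. split; [apply Rmin_glb_lt; lra|].
    intros e [H0 He]. apply Rmin_Rgt in He. destruct (U e (conj H0 (proj1 He))) as [U1 U2].
    assert (Hlast : forall eta, (forall i, (i <= S N)%nat -> Rabs (eta i - ys) < Rmin d1 d2) ->
       chain al be e (S N) eta -> eta (S N) = f e (eta N)).
    { intros eta Hb Hc. assert (h := Hb N ltac:(lia)). assert (h' := Hb (S N) ltac:(lia)).
      apply Rmin_Rgt in h, h'. destruct (G e (eta N) (conj H0 (proj2 He)) (proj2 h)) as [_ g].
      apply g; [apply h'|]. apply Hc. lia. }
    assert (Hfst : forall eta, (forall i, (i <= S N)%nat -> Rabs (eta i - ys) < Rmin d1 d2) ->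
       chain al be e (S N) eta -> (forall i, (i <= N)%nat -> Rabs (eta i - ys) < d1) /\ chain al be e N eta).
    { intros eta Hb Hc. split.
      - intros i Hi. assert (h := Hb i ltac:(lia)). apply Rmin_Rgt in h. apply h.
      - intros i Hi. apply Hc. lia. }
    split.
    * intros eta Hb Hc. rewrite (Hlast eta Hb Hc). f_equal.
      destruct (Hfst eta Hb Hc) as [h1 h2]. apply U1; assumption.
    * intros eta eta' Hb Hc Hb' Hc' E0 i Hi.
      destruct (Hfst eta Hb Hc) as [h1 h2]. destruct (Hfst eta' Hb' Hc') as [h3 h4].
      assert (hN := U2 eta eta' h1 h2 h3 h4 E0).
      destruct (Nat.eq_dec i (S N)) as [->|Hne]; [|apply hN; lia].
      rewrite (Hlast eta Hb Hc), (Hlast eta' Hb' Hc'), (hN N ltac:(lia)). reflexivity.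
  + intros d Hd.
    destruct (near_id_ball _ _ _ _ Hf d Hd) as (d3 & e3 & Hd3 & He3 & B3).
    destruct (E (Rmin d (Rmin d2 d3))) as (d4 & e4 & Hd4 & He4 & B4); [repeat apply Rmin_glb_lt; lra|].
    exists d4, (Rmin e2 (Rmin e3 e4)). split; [exact Hd4|]. split; [repeat apply Rmin_glb_lt; lra|].
    intros e u [H0 He] Hu. apply Rmin_Rgt in He. destruct He as [E2 He]. apply Rmin_Rgt in He. destruct He as [E3 E4].
    destruct (B4 e u (conj H0 E4) Hu) as (eta & h0 & hN & hc & hb).
    assert (hd : forall i, (i <= N)%nat -> Rabs (eta i - ys) < d /\ Rabs (eta i - ys) < d2 /\ Rabs (eta i - ys) < d3).
    { intros i Hi. assert (h := hb i Hi). apply Rmin_Rgt in h. destruct h as [h h']. apply Rmin_Rgt in h'. lra. }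
    exists (fun i => if Nat.leb i N then eta i else f e (F e u)).
    assert (hle : forall i, (i <= N)%nat -> Nat.leb i N = true) by (intros; apply Nat.leb_le; assumption).
    assert (hgt : Nat.leb (S N) N = false) by (apply Nat.leb_gt; lia).
    split; [rewrite hle by lia; exact h0|]. split; [rewrite hgt; reflexivity|]. split.
    * intros i Hi. rewrite (hle i) by lia. destruct (Nat.eq_dec i N) as [->|Hne].
      -- rewrite hgt, <- hN. apply (G e (eta N)); [split; lra|]. apply hd. lia.
      -- rewrite hle by lia. apply hc. lia.
    * intros i Hi. destruct (Nat.eq_dec i (S N)) as [->|Hne].
      -- rewrite hgt, <- hN. apply B3; [split; lra|]. apply hd. lia.
      -- rewrite hle by lia. apply hd. lia.
Qed.

(** * Lifting trajectories to the logarithmic plane *)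

Lemma is_derive_C_iff (z : R -> C) (t : R) (v : C) :
  is_derive z t v <->
  is_derive (fun s => fst (z s)) t (fst v) /\ is_derive (fun s => snd (z s)) t (snd v).
Proof.
split.
- intros H. split.
  + apply (filterdiff_comp' z fst t (fun y => scal y v) fst); [exact H|].
    apply filterdiff_linear, is_linear_fst.
  + apply (filterdiff_comp' z snd t (fun y => scal y v) snd); [exact H|].
    apply filterdiff_linear, is_linear_snd.
- intros [H1 H2].
  apply filterdiff_ext with (fun s => (fst (z s), snd (z s))); [intros s; destruct (z s); reflexivity|].
  assert (K := filterdiff_comp'_2 (fun s => fst (z s)) (fun s => snd (z s)) (fun a b : R => (a, b)) t
    _ _ (fun a b : R => (a, b)) H1 H2).
  apply K. apply filterdiff_ext with (fun u : R * R => u); [intros [a b]; reflexivity|].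
  apply (filterdiff_ext_lin _ (fun u : R * R => u)); [|intros [a b]; reflexivity]. apply filterdiff_id.
Qed.

Lemma continuous_C_iff (z : R -> C) (t : R) :
  continuous z t <->
  continuous (fun s => fst (z s)) t /\ continuous (fun s => snd (z s)) t.
Proof.
split.
- intros H. split; apply filterlim_locally; intros eps;
  generalize (proj1 (filterlim_locally z (z t)) H eps); apply filter_imp; intros s [h1 h2]; assumption.
- intros [H1 H2]. apply filterlim_locally. intros eps.
  generalize (proj1 (filterlim_locally (fun s => fst (z s)) _) H1 eps).
  generalize (proj1 (filterlim_locally (fun s => snd (z s)) _) H2 eps).
  intros G2 G1. generalize (filter_and _ _ G1 G2). apply filter_imp. intros s [g1 g2]. split; assumption.
Qed.

Lemma polar_Cmod x y : Cmod (polar x y - 1)%C = exp y.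
Proof.
unfold Cmod, polar. simpl.
replace ((1 + exp y * cos x + - (1)) * ((1 + exp y * cos x + - (1)) * 1) + (- (exp y * sin x) + - 0) * ((- (exp y * sin x) + - 0) * 1))
  with (exp y * exp y * (Rsqr (sin x) + Rsqr (cos x))) by (unfold Rsqr; ring).
rewrite sin2_cos2, Rmult_1_r. apply sqrt_square. left. apply exp_pos.
Qed.

Lemma angle_exists (a b r : R) : 0 < r -> r * r = a * a + b * b ->
  exists x, - PI <= x <= PI /\ a = r * cos x /\ b = - (r * sin x).
Proof.
intros Hr E.
assert (Ha : -1 <= a / r <= 1).
{ split.
  - apply Rle_div_r; [lra|]. nra.
  - apply Rle_div_l; [lra|]. nra. }
assert (Hb := acos_bound (a / r)). assert (P := PI_RGT_0).
assert (C1 : r * cos (acos (a / r)) = a) by (rewrite cos_acos by lra; field; lra).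
assert (C2 : r * sin (acos (a / r)) = Rabs b).
{ rewrite sin_acos by lra. rewrite <- (sqrt_square r) at 1 by lra.
  rewrite <- sqrt_mult; [|nra|].
  - replace (r * r * (1 - (a / r)²)) with (Rsqr b); [apply sqrt_Rsqr_abs|].
    unfold Rsqr. field_simplify; [|lra]. lra.
  - unfold Rsqr. nra. }
destruct (Rle_dec 0 b) as [H|H].
- exists (- acos (a / r)). rewrite cos_neg, sin_neg. rewrite Rabs_right in C2 by lra.
  split; [lra|]. split; lra.
- exists (acos (a / r)). rewrite Rabs_left in C2 by lra. split; [lra|]. split; lra.
Qed.

(** Increment of the angle [x] from [p] to [q] when their scalar product is positive. The sign comes
    from [polar], where increasing [x] turns clockwise. *)
Definition ang (p q : R * R) : R :=
  - atan ((snd q * fst p - fst q * snd p) / (fst q * fst p + snd q * snd p)).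

Lemma ang_step (p q : R * R) (r r' x : R) :
  0 < r -> 0 < r' -> fst p = r * cos x -> snd p = - (r * sin x) ->
  r' * r' = fst q * fst q + snd q * snd q -> 0 < fst q * fst p + snd q * snd p ->
  fst q = r' * cos (x + ang p q) /\ snd q = - (r' * sin (x + ang p q)).
Proof.
intros Hr Hr' P1 P2 Q Hdot. unfold ang.
set (a := fst q * fst p + snd q * snd p) in *. set (b := snd q * fst p - fst q * snd p).
assert (Hcs := sin2_cos2 x). unfold Rsqr in Hcs.
assert (Hab : a * a + b * b = (r * r') * (r * r')).
{ replace (r * r' * (r * r')) with (r * r * (r' * r')) by ring. rewrite Q.
  unfold a, b. rewrite P1, P2.
  replace (r * r) with (r * r * (sin x * sin x + cos x * cos x)) by (rewrite Hcs; ring). ring. }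
assert (Hrr : 0 < r * r') by (apply Rmult_lt_0_compat; assumption).
assert (Hs : sqrt (1 + (b / a)²) = r * r' / a).
{ replace (1 + (b / a)²) with (Rsqr (r * r' / a)).
  - apply sqrt_Rsqr. left. apply Rdiv_lt_0_compat; assumption.
  - unfold Rsqr. replace (r * r' / a * (r * r' / a)) with ((r * r') * (r * r') / (a * a)) by (field; lra).
    rewrite <- Hab. field. lra. }
rewrite cos_plus, sin_plus, cos_neg, sin_neg, cos_atan, sin_atan, Hs.
assert (E1 : 1 / (r * r' / a) = a / (r * r')) by (field; repeat split; lra).
assert (E2 : b / a / (r * r' / a) = b / (r * r')) by (field; repeat split; lra).
rewrite E1, E2. split.
- transitivity ((cos x * a + sin x * b) / r); [|field; lra].
  unfold a, b. rewrite P1, P2. apply Rmult_eq_reg_r with r; [|lra].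
  transitivity (r * fst q * (sin x * sin x + cos x * cos x)); [rewrite Hcs; ring|field; lra].
- transitivity (- ((sin x * a - cos x * b) / r)); [|field; lra].
  unfold a, b. rewrite P1, P2. apply Rmult_eq_reg_r with r; [|lra].
  transitivity (r * snd q * (sin x * sin x + cos x * cos x)); [rewrite Hcs; ring|field; lra].
Qed.

Lemma Rmin_lip a s t : Rabs (Rmin s a - Rmin t a) <= Rabs (s - t).
Proof. unfold Rmin. destruct (Rle_dec s a), (Rle_dec t a); split_Rabs; lra. Qed.

(** A Lipschitz curve that stays away from the origin turns by less than a right angle in a fixed
    time [tau]. The lift adds the increments [ang] over successive steps of that length. *)
Lemma angle_lift (w : R -> R * R) (M m : R) :
  0 < m ->
  (forall s t, Rabs (fst (w s) - fst (w t)) <= M * Rabs (s - t) /\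
               Rabs (snd (w s) - snd (w t)) <= M * Rabs (s - t)) ->
  (forall t, m * m <= fst (w t) * fst (w t) + snd (w t) * snd (w t)) ->
  exists x : R -> R, (forall t, continuous x t) /\ - PI <= x 0 <= PI /\
    forall t, 0 <= t ->
      let r := sqrt (fst (w t) * fst (w t) + snd (w t) * snd (w t)) in
      fst (w t) = r * cos (x t) /\ snd (w t) = - (r * sin (x t)).
Proof.
intros Hm HL Hmod.
set (rr := fun t => sqrt (fst (w t) * fst (w t) + snd (w t) * snd (w t))).
assert (Hmm : 0 < m * m) by (apply Rmult_lt_0_compat; lra).
assert (Hrr : forall t, 0 < rr t /\ rr t * rr t = fst (w t) * fst (w t) + snd (w t) * snd (w t)).
{ intros t. assert (h := Hmod t). split; [apply sqrt_lt_R0; lra|apply sqrt_sqrt; lra]. }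
assert (HM : 0 <= M).
{ destruct (HL 1 0) as [h _]. rewrite Rminus_0_r, Rabs_R1 in h.
  generalize (Rabs_pos (fst (w 1) - fst (w 0))). lra. }
(* In time [tau] each coordinate changes by at most [m / 2], so the scalar product of two positions
   of modulus at least [m] remains positive. *)
set (tau := m / (2 * (M + 1))).
assert (Htau : 0 < tau) by (apply Rdiv_lt_0_compat; lra).
assert (HMt : M * tau <= m / 2).
{ unfold tau. apply Rle_trans with ((M + 1) * (m / (2 * (M + 1)))); [|right; field; lra].
  apply Rmult_le_compat_r; [left; exact Htau|lra]. }
assert (Hdot : forall s t, Rabs (s - t) <= tau -> 0 < fst (w t) * fst (w s) + snd (w t) * snd (w s)).
{ intros s t Hst. destruct (HL s t) as [h1 h2]. assert (h3 := Hmod s). assert (h4 := Hmod t).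
  assert (h5 : M * Rabs (s - t) <= m / 2).
  { eapply Rle_trans; [|exact HMt]. apply Rmult_le_compat_l; assumption. }
  assert (g1 : Rabs (fst (w s) - fst (w t)) <= m / 2) by lra.
  assert (g2 : Rabs (snd (w s) - snd (w t)) <= m / 2) by lra.
  assert (q1 : (fst (w s) - fst (w t)) * (fst (w s) - fst (w t)) <= m / 2 * (m / 2)).
  { apply Rabs_le_between in g1. nra. }
  assert (q2 : (snd (w s) - snd (w t)) * (snd (w s) - snd (w t)) <= m / 2 * (m / 2)).
  { apply Rabs_le_between in g2. nra. }
  nra. }
destruct (angle_exists (fst (w 0)) (snd (w 0)) (rr 0) (proj1 (Hrr 0)) (proj2 (Hrr 0))) as (X0 & HX0 & A1 & A2).
(* [xs n] lifts the curve stopped at time [n tau]. Stopping makes every term continuous on the whole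
   line and every later term zero, so the lifts stabilize. *)
set (xs := fix xs (n : nat) (t : R) : R := match n with O => X0
  | S k => xs k t + ang (w (Rmin t (INR k * tau))) (w (Rmin t (INR (S k) * tau))) end).
assert (Hang0 : forall p, ang p p = 0).
{ intros p. unfold ang. replace (snd p * fst p - fst p * snd p) with 0 by ring.
  unfold Rdiv. rewrite Rmult_0_l, atan_0. ring. }
assert (Hstep : forall k, INR (S k) * tau = INR k * tau + tau) by (intros; rewrite S_INR; ring).
assert (Hstable : forall n k t, t <= INR n * tau -> xs (n + k)%nat t = xs n t).
{ intros n k t Ht. induction k as [|k IH]; [rewrite Nat.add_0_r; reflexivity|].
  rewrite Nat.add_succ_r. simpl xs. rewrite IH.
  assert (t <= INR (n + k) * tau).
  { eapply Rle_trans; [exact Ht|]. apply Rmult_le_compat_r; [lra|]. apply le_INR. lia. }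
  rewrite !Rmin_left, Hang0; [ring| |assumption]. 
  change (t <= INR (S (n + k)) * tau). rewrite Hstep. lra. }
assert (Hxs : forall n t, 0 <= t ->
   let u := Rmin t (INR n * tau) in fst (w u) = rr u * cos (xs n t) /\ snd (w u) = - (rr u * sin (xs n t))).
{ intros n t Ht. induction n as [|n IH].
  - simpl INR. rewrite Rmult_0_l, Rmin_right by lra. split; assumption.
  - simpl in IH. destruct IH as [I1 I2]. cbv zeta. simpl xs.
    change (match n with 0%nat => 1 | S _ => INR n + 1 end) with (INR (S n)).
    apply (ang_step _ _ (rr (Rmin t (INR n * tau)))); auto; try apply Hrr.
    apply Hdot. rewrite Hstep. assert (0 <= INR n * tau) by (apply Rmult_le_pos; [apply pos_INR|lra]).
    unfold Rmin. destruct (Rle_dec t (INR n * tau)), (Rle_dec t (INR n * tau + tau)); split_Rabs; lra. }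
assert (Hcont : forall n t, continuous (xs n) t).
{ induction n as [|n IH]; intros t; [apply continuous_const|].
  apply (continuous_plus (xs n)); [apply IH|].
  assert (W : forall a, (forall t, continuous (fun s => fst (w (Rmin s a))) t) /\ (forall t, continuous (fun s => snd (w (Rmin s a))) t)).
  { intros a. split; apply (continuous_lip _ M); intros s u;
    (eapply Rle_trans; [apply HL|apply Rmult_le_compat_l; [exact HM|apply Rmin_lip]]). }
  destruct (W (INR n * tau)) as [W1 W2]. destruct (W (INR (S n) * tau)) as [W3 W4].
  unfold ang. apply (continuous_opp (V := R_NormedModule)). apply continuous_comp; [|apply continuity_pt_filterlim, derivable_continuous_pt, derivable_pt_atan].
  apply (continuous_mult (K := R_AbsRing) (fun t => snd (w (Rmin t (INR (S n) * tau))) * fst (w (Rmin t (INR n * tau))) - fst (w (Rmin t (INR (S n) * tau))) * snd (w (Rmin t (INR n * tau))))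
    (fun t => / (fst (w (Rmin t (INR (S n) * tau))) * fst (w (Rmin t (INR n * tau))) + snd (w (Rmin t (INR (S n) * tau))) * snd (w (Rmin t (INR n * tau)))))).
  - apply (continuous_minus (V := R_NormedModule)); apply (continuous_mult (K := R_AbsRing)); auto.
  - apply continuous_comp.
    + apply (continuous_plus (V := R_NormedModule)); apply (continuous_mult (K := R_AbsRing)); auto.
    + apply continuous_Rinv. apply Rgt_not_eq, Hdot. rewrite Hstep.
      unfold Rmin. destruct (Rle_dec t (INR n * tau)), (Rle_dec t (INR n * tau + tau)); split_Rabs; lra. }
assert (Hn : forall t, exists n, t <= INR n * tau).
{ intros t. destruct (Rle_dec t 0) as [H|H]; [exists O; simpl; lra|].
  destruct (nfloor_ex (t / tau)) as [n [_ Hn]]; [left; apply Rdiv_lt_0_compat; lra|].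
  exists (S n). rewrite S_INR. apply Rlt_div_l in Hn; lra. }
destruct (choice _ Hn) as [N HN].
assert (HNs : forall n t, t <= INR n * tau -> xs (N t) t = xs n t).
{ intros n t Ht. destruct (Nat.le_ge_cases (N t) n) as [h|h].
  - replace n with (N t + (n - N t))%nat by lia. symmetry. apply Hstable, HN.
  - replace (N t) with (n + (N t - n))%nat by lia. apply Hstable, Ht. }
exists (fun t => xs (N t) t). split; [|split].
- intros t. apply (continuous_ext_loc _ (xs (N (t + 1)))).
  + exists (mkposreal 1 Rlt_0_1). intros s Hs. change (Rabs (s - t) < 1) in Hs. symmetry. apply HNs.
    eapply Rle_trans; [|apply HN]. apply Rabs_lt_between in Hs. lra.
  + apply Hcont.
- rewrite (HNs O) by (simpl; lra). exact HX0.
- intros t Ht. assert (h := Hxs (N t) t Ht). cbv zeta in h. rewrite Rmin_left in h by apply HN. exact h.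
Qed.

(** Near [t] the continuous angle equals [x t] plus the arctangent of a smooth function of [z], and
    [y] is half the logarithm of the squared modulus; both are therefore differentiable wherever [z]
    is. *)
Lemma polar_lift_derive (z : R -> C) (x y : R -> R) (t dx dy : R) :
  continuous x t -> locally t (fun s => z s = polar (x s) (y s)) ->
  is_derive z t (polar_push (x t) (y t) dx dy) ->
  is_derive x t dx /\ is_derive y t dy.
Proof.
intros Hx Hz Hd. apply is_derive_C_iff in Hd. destruct Hd as [D1 D2].
unfold polar_push in D1, D2. cbn [fst snd] in D1, D2.
set (w1 := fun s => fst (z s) - 1). set (w2 := fun s => snd (z s)).
assert (Hw : locally t (fun s => w1 s = exp (y s) * cos (x s) /\ w2 s = - (exp (y s) * sin (x s)))).
{ revert Hz. apply filter_imp. intros s Hs. unfold w1, w2. rewrite Hs. unfold polar; simpl. split; ring. }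
assert (Wt := locally_singleton _ _ Hw). destruct Wt as [W1 W2].
assert (E1 : is_derive w1 t (exp (y t) * (cos (x t) * dy - sin (x t) * dx))).
{ unfold w1. rewrite <- (Rminus_0_r (exp (y t) * _)).
  apply (is_derive_minus (fun s => fst (z s)) (fun _ => 1)); [exact D1|apply (is_derive_const (V := R_NormedModule))]. }
assert (E2 : is_derive w2 t (- (exp (y t) * (sin (x t) * dy + cos (x t) * dx)))) by exact D2.
assert (Hexp := exp_pos (y t)). assert (Hcs := sin2_cos2 (x t)). unfold Rsqr in Hcs.
assert (X1 : ex_derive w1 t) by (eexists; exact E1). assert (X2 : ex_derive w2 t) by (eexists; exact E2).
assert (U1 := is_derive_unique _ _ _ E1). assert (U2 := is_derive_unique _ _ _ E2).
assert (Hsq : w1 t * w1 t + w2 t * w2 t = exp (y t) * exp (y t)).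
{ rewrite W1, W2. transitivity (exp (y t) * exp (y t) * (sin (x t) * sin (x t) + cos (x t) * cos (x t))); [ring|].
  rewrite Hcs. ring. }
assert (Hsq0 : 0 < w1 t * w1 t + w2 t * w2 t) by (rewrite Hsq; apply Rmult_lt_0_compat; assumption).
split.
- apply (is_derive_ext_loc (fun s => x t + atan (- (w2 s * w1 t - w1 s * w2 t) / (w1 s * w1 t + w2 s * w2 t)))).
  + assert (Hc : locally t (fun s => Rabs (x s - x t) < PI / 2)).
    { apply (proj1 (filterlim_locally x (x t)) Hx (mkposreal (PI / 2) ltac:(generalize PI_RGT_0; lra))). }
    generalize (filter_and _ _ Hw Hc). apply filter_imp. intros s [[h1 h2] h3].
    rewrite h1, h2, W1, W2. apply Rabs_lt_between in h3.
    assert (es := exp_pos (y s)). assert (hc : 0 < cos (x s - x t)) by (apply cos_gt_0; lra).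
    replace (- (- (exp (y s) * sin (x s)) * (exp (y t) * cos (x t)) - exp (y s) * cos (x s) * - (exp (y t) * sin (x t))) /
      (exp (y s) * cos (x s) * (exp (y t) * cos (x t)) + - (exp (y s) * sin (x s)) * - (exp (y t) * sin (x t))))
      with (tan (x s - x t)).
    * rewrite atan_tan by lra. exact (Rplus_minus (x t) (x s)).
    * unfold tan. rewrite cos_minus in hc. rewrite sin_minus, cos_minus. field. split; [|lra].
      assert (exp (y s) * cos (x s) * (exp (y t) * cos (x t)) + - (exp (y s) * sin (x s)) * - (exp (y t) * sin (x t)) = exp (y s) * exp (y t) * (cos (x s) * cos (x t) + sin (x s) * sin (x t))) by ring.
      assert (0 < exp (y s) * exp (y t) * (cos (x s) * cos (x t) + sin (x s) * sin (x t))) by (repeat apply Rmult_lt_0_compat; lra).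
      lra.
  + auto_derive.
    * repeat split; auto. apply Rgt_not_eq, Hsq0.
    * replace (Derive (fun x => w1 x) t) with (exp (y t) * (cos (x t) * dy - sin (x t) * dx)) by (symmetry; exact U1).
      replace (Derive (fun x => w2 x) t) with (- (exp (y t) * (sin (x t) * dy + cos (x t) * dx))) by (symmetry; exact U2).
      replace (- (w2 t * w1 t - w1 t * w2 t)) with 0 by ring.
      rewrite Hsq, W1, W2. 
      transitivity (dx * (sin (x t) * sin (x t) + cos (x t) * cos (x t))); [|rewrite Hcs; ring].
      field. split; [lra|]. apply Rgt_not_eq.
      match goal with |- ?a > 0 => replace a with (exp (y t) * exp (y t) * (exp (y t) * exp (y t))) by ring end.
      repeat apply Rmult_lt_0_compat; lra.
- apply (is_derive_ext_loc (fun s => / 2 * ln (w1 s * w1 s + w2 s * w2 s))).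
  + revert Hw. apply filter_imp. intros s [h1 h2]. rewrite h1, h2.
    assert (hcs := sin2_cos2 (x s)). unfold Rsqr in hcs.
    replace (exp (y s) * cos (x s) * (exp (y s) * cos (x s)) + - (exp (y s) * sin (x s)) * - (exp (y s) * sin (x s)))
     with (exp (y s) * exp (y s) * (sin (x s) * sin (x s) + cos (x s) * cos (x s))) by ring.
    rewrite hcs, Rmult_1_r, <- exp_plus, ln_exp.
    change (/ 2 * (y s + y s) = y s). field.
  + auto_derive.
    * repeat split; auto.
    * replace (Derive (fun x => w1 x) t) with (exp (y t) * (cos (x t) * dy - sin (x t) * dx)) by (symmetry; exact U1).
      replace (Derive (fun x => w2 x) t) with (- (exp (y t) * (sin (x t) * dy + cos (x t) * dx))) by (symmetry; exact U2).
      rewrite Hsq, W1, W2.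
      transitivity (dy * (sin (x t) * sin (x t) + cos (x t) * cos (x t))); [field; lra|rewrite Hcs; ring].
Qed.

Definition in_tube (y0 d : R) (w : C) : Prop := exists x y, Rabs (y - y0) < d /\ w = polar x y.

(** A forward trajectory in logarithmic coordinates. On the circles the velocity is only known up to
    [K |e|], which is all that crossing requires. *)
Record lifted (c : zone -> nat -> R) (e y0 d K : R) (x y : R -> R) : Prop := {
  lf_cx : forall t, continuous x t;
  lf_cy : forall t, continuous y t;
  lf_strip : forall t, 0 <= t -> Rabs (y t - y0) < d;
  lf_der : exists D, locally_finite D /\ forall t, 0 < t -> ~ D t ->
    exists dx dy, is_derive x t dx /\ is_derive y t dy /\
      Rabs (dx - 1) <= K * Rabs e /\ Rabs dy <= K * Rabs e /\
      forall s, in_zone s (polar (x t) (y t)) ->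
        dx = 1 + e * fieldA (c s) (x t) (y t) /\ dy = e * fieldB (c s) (x t) (y t)
}.
Arguments lf_cx {c e y0 d K x y} _.
Arguments lf_cy {c e y0 d K x y} _.
Arguments lf_strip {c e y0 d K x y} _.
Arguments lf_der {c e y0 d K x y} _.

Lemma lip_of_derive_bound (f : R -> R) (D : R -> Prop) (M : R) :
  (forall t, continuous f t) -> locally_finite D ->
  (forall t, ~ D t -> exists l, is_derive f t l /\ Rabs l <= M) ->
  forall s t, Rabs (f s - f t) <= M * Rabs (s - t).
Proof.
intros Hc HD Hd.
assert (G : forall s t, s <= t -> Rabs (f t - f s) <= M * (t - s)).
{ intros s t Hst. destruct (HD s t) as [ts Hts].
  assert (L : - M * (t - s) <= f t - f s).
  { apply derive_ge_increment with ts; auto. intros u Hu Hn.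
    destruct (Hd u) as (l & h1 & h2); [intros h; apply Hn, Hts; [lra|exact h]|].
    exists l. split; [exact h1|]. apply Rabs_le_between in h2. lra. }
  assert (L' : - M * (t - s) <= (fun u => - f u) t - (fun u => - f u) s).
  { apply (derive_ge_increment (fun u => - f u) (- M) ts); [exact Hst|intros; apply (continuous_opp f), Hc|]. intros u Hu Hn.
    destruct (Hd u) as (l & h1 & h2); [intros h; apply Hn, Hts; [lra|exact h]|].
    exists (- l). split; [apply (is_derive_opp f), h1|]. apply Rabs_le_between in h2. lra. }
  apply Rabs_le. lra. }
intros s t. destruct (Rle_dec s t) as [h|h].
- rewrite Rabs_minus_sym, (Rabs_minus_sym s), (Rabs_right (t - s)) by lra. apply G, h.
- rewrite (Rabs_right (s - t)) by lra. apply G. lra.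
Qed.

(** In the tube the velocity is bounded and the distance to [z = 1] is at least [exp (y0 - 1)], as
    the lifting of the angle requires; [y] is read off that distance. *)
Lemma trajectory_lift c e y0 d K (z : R -> C) :
  0 < d <= 1 ->
  (forall s x y, Rabs (y - y0) < 1 -> Rabs (fieldA (c s) x y) <= K /\ Rabs (fieldB (c s) x y) <= K) ->
  trajectory (centered c e) z -> (forall t, in_tube y0 d (z t)) ->
  exists x y, lifted c e y0 d K x y /\ - PI <= x 0 <= PI /\ forall t, 0 <= t -> z t = polar (x t) (y t).
Proof.
intros Hd HK [Hc (D & HD & Hder)] Htube.
set (w := fun t => (fst (z t) - 1, snd (z t)) : R * R).
assert (Hw : forall t, exists y, Rabs (y - y0) < d /\ fst (w t) * fst (w t) + snd (w t) * snd (w t) = exp y * exp y).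
{ intros t. destruct (Htube t) as (x & y & Hy & E). exists y. split; [exact Hy|].
  unfold w. rewrite E. unfold polar. simpl. assert (h := sin2_cos2 x). unfold Rsqr in h.
  transitivity (exp y * exp y * (sin x * sin x + cos x * cos x)); [ring|rewrite h; ring]. }
assert (K0 : 0 <= K).
{ destruct (HK Zplus 0 y0) as [h _]; [rewrite Rminus_diag, Rabs_R0; lra|].
  generalize (Rabs_pos (fieldA (c Zplus) 0 y0)). lra. }
set (M := exp (y0 + 1) * (1 + 2 * (K * Rabs e))).
assert (HKe : 0 <= K * Rabs e) by (apply Rmult_le_pos; [exact K0|apply Rabs_pos]).
assert (Hv : forall t, ~ D t -> exists v, is_derive z t v /\ Rabs (fst v) <= M /\ Rabs (snd v) <= M).
{ intros t Ht. destruct (Hder t Ht) as (v & h1 & h2). exists v. split; [exact h1|].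
  destruct (Htube t) as (x & y & Hy & E). rewrite E in h2.
  destruct (filippov_polar _ _ _ _ _ K h2) as (dx & dy & -> & b1 & b2 & _).
  { intros s. apply HK. lra. }
  unfold polar_push. cbn [fst snd]. rewrite Rabs_Ropp, !Rabs_mult.
  assert (e1 := exp_pos y). rewrite (Rabs_right (exp y)) by lra.
  assert (e2 : exp y <= exp (y0 + 1)) by (left; apply exp_increasing; apply Rabs_lt_between in Hy; lra).
  assert (hs : Rabs (sin x) <= 1) by (apply Rabs_le, SIN_bound).
  assert (hc : Rabs (cos x) <= 1) by (apply Rabs_le, COS_bound).
  assert (hdx : Rabs dx <= 1 + K * Rabs e).
  { replace dx with (1 + (dx - 1)) by ring. eapply Rle_trans; [apply Rabs_triang|]. rewrite Rabs_R1. lra. }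
  assert (mm : forall a b B, Rabs a <= 1 -> Rabs b <= B -> Rabs (a * b) <= B).
  { intros a b B ha hb. rewrite Rabs_mult. generalize (Rabs_pos a) (Rabs_pos b). nra. }
  unfold M. split; apply Rmult_le_compat; try lra; try apply Rabs_pos.
  - unfold Rminus. eapply Rle_trans; [apply Rabs_triang|]. rewrite Rabs_Ropp.
    generalize (mm _ _ _ hc b2) (mm _ _ _ hs hdx). lra.
  - eapply Rle_trans; [apply Rabs_triang|]. generalize (mm _ _ _ hs b2) (mm _ _ _ hc hdx). lra. }
destruct (angle_lift w M (exp (y0 - 1))) as (x & Cx & X0 & Hx).
- apply exp_pos.
- intros s t. unfold w. cbn [fst snd]. replace (fst (z s) - 1 - (fst (z t) - 1)) with (fst (z s) - fst (z t)) by ring.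
  split.
  + apply (lip_of_derive_bound (fun t => fst (z t)) D); [intros u; apply continuous_C_iff, Hc|exact HD|].
    intros u Hu. destruct (Hv u Hu) as (v & h1 & h2 & _). apply is_derive_C_iff in h1.
    exists (fst v). split; [apply h1|exact h2].
  + apply (lip_of_derive_bound (fun t => snd (z t)) D); [intros u; apply continuous_C_iff, Hc|exact HD|].
    intros u Hu. destruct (Hv u Hu) as (v & h1 & _ & h2). apply is_derive_C_iff in h1.
    exists (snd v). split; [apply h1|exact h2].
- intros t. destruct (Hw t) as (y & Hy & ->).
  assert (exp (y0 - 1) <= exp y) by (left; apply exp_increasing; apply Rabs_lt_between in Hy; lra).
  generalize (exp_pos (y0 - 1)). intros. apply Rmult_le_compat; lra.
- set (y := fun t => / 2 * ln (fst (w t) * fst (w t) + snd (w t) * snd (w t))).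
  assert (Hy : forall t, Rabs (y t - y0) < d /\ exp (y t) * exp (y t) = fst (w t) * fst (w t) + snd (w t) * snd (w t)).
  { intros t. destruct (Hw t) as (y' & Hy & E). assert (y t = y').
    { unfold y. rewrite E, <- exp_plus, ln_exp. field. }
    rewrite H, E. auto. }
  assert (Hz : forall t, 0 <= t -> z t = polar (x t) (y t)).
  { intros t Ht. assert (h := Hx t Ht). cbv zeta in h. rewrite <- (proj2 (Hy t)), sqrt_square in h.
    2:{ left. apply exp_pos. }
    destruct h as [h1 h2]. unfold w in h1, h2. cbn [fst snd] in h1, h2.
    unfold polar. rewrite <- h1, <- (Ropp_involutive (exp (y t) * sin (x t))), <- h2.
    destruct (z t) as [z1 z2]. simpl. f_equal; ring. }
  exists x, y. split; [|split; [exact X0|exact Hz]]. split.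
  + exact Cx.
  + intros t. destruct (proj1 (continuous_C_iff z t) (Hc t)) as [c1 c2].
    assert (cw1 : continuous (fun t => fst (w t)) t).
    { unfold w. cbn [fst]. apply (continuous_minus (V := R_NormedModule)); [exact c1|apply continuous_const]. }
    unfold y. apply (continuous_scal_r (V := R_NormedModule) (/ 2)).
    apply continuous_comp.
    * apply (continuous_plus (V := R_NormedModule)); apply (continuous_mult (K := R_AbsRing)); assumption.
    * apply continuous_ln. rewrite <- (proj2 (Hy t)). apply Rmult_lt_0_compat; apply exp_pos.
  + intros t _. apply Hy.
  + exists D. split; [exact HD|]. intros t Ht Hn. destruct (Hder t Hn) as (v & h1 & h2).
    rewrite (Hz t) in h2 by lra.
    destruct (filippov_polar _ _ _ _ _ K h2) as (dx & dy & -> & b1 & b2 & b3).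
    { intros s. apply HK. destruct (Hy t) as [h _]. lra. }
    exists dx, dy.
    destruct (polar_lift_derive z x y t dx dy) as [g1 g2]; [apply Cx| |exact h1|].
    { exists (mkposreal t Ht). intros s Hs. change (Rabs (s - t) < t) in Hs. apply Hz.
      apply Rabs_lt_between in Hs. lra. }
    auto.
Qed.

(** * Turns around the center and uniqueness *)

(* The curves [x = xi i y], [i <= N], are the successive arcs of S1 and S3 met during one turn;
   [sg i] is the zone between [xi i] and [xi (S i)]. *)
Record config (y0 d0 L0 : R) (N : nat) (xi : nat -> R -> R) (dxi : nat -> R) (sg : nat -> zone) : Prop := {
  cf_N : (0 < N)%nat;
  cf_d : 0 < d0 <= 1;
  cf_L : 0 <= L0;
  cf_der : forall i y, (i <= N)%nat -> Rabs (y - y0) < d0 -> exists l, is_derive (xi i) y l /\ Rabs l <= L0;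
  cf_strict : forall i, (i <= N)%nat -> strict_derive (xi i) y0 (dxi i);
  cf_lt : forall i y, (i < N)%nat -> Rabs (y - y0) < d0 -> xi i y < xi (S i) y;
  cf_turn : forall y, Rabs (y - y0) < d0 -> xi N y = xi O y + 2 * PI;
  cf_range : forall i y, (i <= N)%nat -> Rabs (y - y0) < d0 -> PI < xi i y < 16;
  cf_zone : forall i x y, (i < N)%nat -> Rabs (y - y0) < d0 -> xi i y < x < xi (S i) y ->
    in_zone (sg i) (polar x y)
}.
Arguments cf_N {y0 d0 L0 N xi dxi sg} _.
Arguments cf_d {y0 d0 L0 N xi dxi sg} _.
Arguments cf_L {y0 d0 L0 N xi dxi sg} _.
Arguments cf_der {y0 d0 L0 N xi dxi sg} _.
Arguments cf_strict {y0 d0 L0 N xi dxi sg} _.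
Arguments cf_lt {y0 d0 L0 N xi dxi sg} _.
Arguments cf_turn {y0 d0 L0 N xi dxi sg} _.
Arguments cf_range {y0 d0 L0 N xi dxi sg} _.
Arguments cf_zone {y0 d0 L0 N xi dxi sg} _.

(** The identity [(1 + e (gradU + i gradV)) (1 + e k) = 1] in real form: along the flow, time
    advances at rate 1 and the first integral at rate 0. *)
Lemma first_integral_flow c e x y :
  gradN c e x y <> 0 ->
  let dx := 1 + e * fieldA c x y in let dy := e * fieldB c x y in
  dx + e * (gradU c e x y * dx + - gradV c e x y * dy) = 1 /\
  dy + e * (gradV c e x y * dx + gradU c e x y * dy) = 0.
Proof.
intros HN. unfold gradU, gradV. unfold gradN in *.
split; field; exact HN.
Qed.

Lemma lifted_arc c e y0 d K x y s C p q t1 t2 :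
  lifted c e y0 d K x y -> d <= 1 -> first_integral (c s) y0 e C p q -> 0 <= t1 <= t2 ->
  (forall t, t1 < t < t2 -> in_zone s (polar (x t) (y t))) ->
  x t2 + e * p (x t2) (y t2) - (x t1 + e * p (x t1) (y t1)) = t2 - t1 /\
  y t2 + e * q (x t2) (y t2) - (y t1 + e * q (x t1) (y t1)) = 0.
Proof.
intros HL Hd HF Ht Hz. destruct (lf_der HL) as (D & HD & Hder).
assert (Hs : forall t, 0 <= t -> Rabs (y t - y0) < 1).
{ intros t h. generalize (lf_strip HL t h). lra. }
destruct (HD t1 t2) as [ts Hts].
assert (Hcp : forall phi f g, gradient_on y0 1 phi f g -> (forall a b, Rabs (b - y0) < 1 -> continuity_2d_pt f a b) ->
  forall t, 0 <= t -> continuous (fun t => phi (x t) (y t)) t).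
{ intros phi f g Hg Hf t h.
  apply (continuous_comp_2 x y phi); [apply (lf_cx HL)|apply (lf_cy HL)|].
  apply (continuity_2d_pt_filterlim phi), differentiable_continuity_pt.
  exists (f (x t) (y t)), (g (x t) (y t)). apply (gradient_differentiable y0 1); auto. }
assert (CU : forall a b, Rabs (b - y0) < 1 -> continuity_2d_pt (gradU (c s) e) a b).
{ intros a b h. apply gradU_cont, (fi_N HF), h. }
assert (CV : forall a b, Rabs (b - y0) < 1 -> continuity_2d_pt (gradV (c s) e) a b).
{ intros a b h. apply gradV_cont, (fi_N HF), h. }
assert (Hsum : forall (f g : R -> R) t df dg, is_derive f t df -> is_derive g t dg ->
   is_derive (fun t => f t + e * g t) t (df + e * dg)).
{ intros f g t df dg h1 h2. apply (is_derive_plus f (fun t => e * g t)); [exact h1|].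
  apply (is_derive_scal g), h2. }
assert (Csum : forall (f g : R -> R) t, continuous f t -> continuous g t -> continuous (fun t => f t + e * g t) t).
{ intros f g t h1 h2. apply (continuous_plus (V := R_NormedModule)); [exact h1|].
  apply (continuous_scal_r (V := R_NormedModule) e g), h2. }
assert (Hd' : forall t, t1 < t < t2 -> ~ In t ts ->
  is_derive x t (1 + e * fieldA (c s) (x t) (y t)) /\ is_derive y t (e * fieldB (c s) (x t) (y t))).
{ intros t h Hn. destruct (Hder t) as (dx & dy & h1 & h2 & _ & _ & h5); [lra|intros hh; apply Hn, Hts; [lra|exact hh]|].
  destruct (h5 s (Hz t h)) as [<- <-]. auto. }
split.
- rewrite <- (Rmult_1_l (t2 - t1)).
  apply (derive_eq_increment (fun t => x t + e * p (x t) (y t)) 1 ts); [lra| |].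
  + intros t h. apply Csum; [apply (lf_cx HL)|].
    apply (Hcp p _ _ (fi_p HF)); [exact CU|lra].
  + intros t h Hn. destruct (Hd' t h Hn) as [h1 h2].
    assert (hs := Hs t ltac:(lra)).
    rewrite <- (proj1 (first_integral_flow (c s) e (x t) (y t) (fi_N HF _ _ hs))).
    apply Hsum; [exact h1|].
    apply (gradient_chain y0 1 p _ _ x y t _ _ (fi_p HF)); auto.
- rewrite <- (Rmult_0_l (t2 - t1)).
  apply (derive_eq_increment (fun t => y t + e * q (x t) (y t)) 0 ts); [lra| |].
  + intros t h. apply Csum; [apply (lf_cy HL)|].
    apply (Hcp q _ _ (fi_q HF)); [exact CV|lra].
  + intros t h Hn. destruct (Hd' t h Hn) as [h1 h2].
    assert (hs := Hs t ltac:(lra)).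
    rewrite <- (proj2 (first_integral_flow (c s) e (x t) (y t) (fi_N HF _ _ hs))).
    apply Hsum; [exact h2|].
    apply (gradient_chain y0 1 q _ _ x y t _ _ (fi_q HF)); auto.
Qed.

(** Whatever the Filippov velocity, [x - xi(y)] has derivative at least [1 - K |e| (1 + L0)]. Hence
    no trajectory slides along a section or recrosses it, and hitting times are unique. *)
Lemma lifted_increasing c e y0 d K x y (xi : R -> R) L0 t t' :
  lifted c e y0 d K x y -> 0 <= L0 -> K * Rabs e * (1 + L0) <= / 2 ->
  (forall u, Rabs (u - y0) < d -> exists l, is_derive xi u l /\ Rabs l <= L0) ->
  0 <= t <= t' -> / 2 * (t' - t) <= (x t' - xi (y t')) - (x t - xi (y t)).
Proof.
intros HL HL0 HK Hxi Ht. destruct (lf_der HL) as (D & HD & Hder).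
destruct (HD t t') as [ts Hts].
apply (derive_ge_increment (fun t => x t - xi (y t)) (/ 2) ts); [lra| |].
- intros s Hs. apply (continuous_minus (V := R_NormedModule)); [apply (lf_cx HL)|].
  apply (continuous_comp y xi); [apply (lf_cy HL)|].
  apply (ex_derive_continuous xi). destruct (Hxi (y s)) as (l & h & _); [apply (lf_strip HL); lra|].
  exists l. exact h.
- intros s Hs Hn. destruct (Hder s) as (dx & dy & h1 & h2 & h3 & h4 & _); [lra|intros hh; apply Hn, Hts; [lra|exact hh]|].
  destruct (Hxi (y s)) as (l & g1 & g2); [apply (lf_strip HL); lra|].
  exists (dx - dy * l). split.
  + apply (is_derive_minus x (fun s => xi (y s))); [exact h1|]. apply (is_derive_comp xi y); assumption.
  + assert (Rabs (dy * l) <= K * Rabs e * L0).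
    { rewrite Rabs_mult. apply Rmult_le_compat; auto using Rabs_pos. }
    apply Rabs_le_between in h3, H. lra.
Qed.

Lemma lifted_cont_section c e y0 d K x y (xi : R -> R) t :
  lifted c e y0 d K x y -> (forall u, Rabs (u - y0) < d -> ex_derive xi u) -> 0 <= t ->
  continuity_pt (fun t => x t - xi (y t)) t.
Proof.
intros HL Hxi Ht. apply continuity_pt_filterlim.
apply (continuous_minus (V := R_NormedModule) x (fun t => xi (y t))); [apply (lf_cx HL)|].
apply (continuous_comp y xi); [apply (lf_cy HL)|].
apply (ex_derive_continuous xi), Hxi, (lf_strip HL), Ht.
Qed.

Lemma section_hit c e y0 d K x y (xi : R -> R) L0 om s0 :
  lifted c e y0 d K x y -> 0 <= L0 -> K * Rabs e * (1 + L0) <= / 2 ->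
  (forall u, Rabs (u - y0) < d -> exists l, is_derive xi u l /\ Rabs l <= L0) ->
  0 <= s0 -> x s0 - xi (y s0) <= om ->
  exists t, s0 <= t /\ x t - xi (y t) = om.
Proof.
intros HL HL0 HK Hxi Hs H.
(* Moving at rate at least 1/2, the gap is closed within twice its length; the extra 1 keeps the
   interval nondegenerate. *)
set (T := s0 + 2 * (om - (x s0 - xi (y s0))) + 1).
destruct (Ranalysis5.f_interv_is_interv (fun t => x t - xi (y t)) s0 T om) as [t [Ht E]].
- unfold T. lra.
- split; [exact H|]. assert (h := lifted_increasing _ _ _ _ _ _ _ xi L0 s0 T HL HL0 HK Hxi).
  unfold T in *. specialize (h ltac:(lra)). lra.
- intros t Ht. apply (lifted_cont_section c e y0 d K x y xi t HL); [|lra].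
  intros u Hu. destruct (Hxi u Hu) as (l & h & _). exists l. exact h.
- exists t. split; [lra|exact E].
Qed.

(** Each section is hit exactly once after [s0]. Since the curves are ordered, so are the hitting
    times, and between two consecutive ones the orbit stays in the zone [sg i], where its first
    integral is constant. *)
Lemma one_turn c e y0 d d0 L0 K C N xi dxi sg p q x y s0 :
  config y0 d0 L0 N xi dxi sg -> lifted c e y0 d K x y -> d <= d0 ->
  K * Rabs e * (1 + L0) <= / 2 ->
  (forall s, first_integral (c s) y0 e C (p s) (q s)) ->
  0 <= s0 -> x s0 = xi O (y s0) ->
  exists s : nat -> R, s O = s0 /\
    (forall i, (i <= N)%nat -> s0 <= s i /\ x (s i) = xi i (y (s i))) /\
    (forall i, (i < N)%nat -> s i < s (S i)) /\
    forall i t, (i < N)%nat -> s i <= t <= s (S i) ->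
      x t + e * p (sg i) (x t) (y t) - (x (s i) + e * p (sg i) (x (s i)) (y (s i))) = t - s i /\
      y t + e * q (sg i) (x t) (y t) - (y (s i) + e * q (sg i) (x (s i)) (y (s i))) = 0.
Proof.
intros CF HL Hdd HK HFI Hs0 E0.
assert (Hd01 := cf_d CF). assert (HL0 := cf_L CF).
assert (Hst : forall t, 0 <= t -> Rabs (y t - y0) < d0).
{ intros t h. generalize (lf_strip HL t h). lra. }
assert (Hxi : forall i, (i <= N)%nat -> forall u, Rabs (u - y0) < d -> exists l, is_derive (xi i) u l /\ Rabs l <= L0).
{ intros i Hi u Hu. apply (cf_der CF); [exact Hi|lra]. }
assert (Hmon : forall i, (i <= N)%nat -> forall t t', 0 <= t <= t' -> / 2 * (t' - t) <= (x t' - xi i (y t')) - (x t - xi i (y t))).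
{ intros i Hi t t' Ht. apply (lifted_increasing c e y0 d K x y (xi i) L0); auto. }
assert (Hle : forall i u, (i <= N)%nat -> Rabs (u - y0) < d0 -> xi O u <= xi i u).
{ induction i as [|i IH]; intros u Hi Hu; [lra|].
  assert (h := IH u ltac:(lia) Hu). assert (h' := cf_lt CF i u ltac:(lia) Hu). lra. }
assert (Hex : forall i, exists t, (i <= N)%nat -> s0 <= t /\ x t - xi i (y t) = 0).
{ intros i. destruct (Nat.le_gt_cases i N) as [Hi|Hi]; [|exists 0; intros; lia].
  destruct (section_hit c e y0 d K x y (xi i) L0 0 s0) as [t Ht]; auto.
  - rewrite E0. assert (h := Hle i (y s0) Hi (Hst s0 Hs0)). lra.
  - exists t. intros _. exact Ht. }
destruct (choice _ Hex) as [s Hs].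
assert (Huniq : forall i t t', (i <= N)%nat -> 0 <= t -> 0 <= t' -> x t - xi i (y t) < x t' - xi i (y t') -> t < t').
{ intros i t t' Hi h h' hlt. destruct (Rlt_le_dec t t') as [hh|hh]; [exact hh|].
  assert (g := Hmon i Hi t' t (conj h' hh)). lra. }
exists s. assert (Hs' : forall i, (i <= N)%nat -> s0 <= s i /\ x (s i) = xi i (y (s i))).
{ intros i Hi. destruct (Hs i Hi). split; lra. }
assert (H00 : s O = s0).
{ destruct (Hs' O ltac:(lia)) as [h1 h2]. assert (g := Hmon O ltac:(lia) s0 (s O) (conj Hs0 h1)). lra. }
assert (Hlt : forall i, (i < N)%nat -> s i < s (S i)).
{ intros i Hi. destruct (Hs' i ltac:(lia)) as [h1 h2]. destruct (Hs' (S i) ltac:(lia)) as [h3 h4].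
  apply (Huniq i); [lia|lra|lra|]. rewrite h2, h4.
  assert (h := cf_lt CF i (y (s (S i))) Hi (Hst (s (S i)) ltac:(lra))). lra. }
split; [exact H00|]. split; [exact Hs'|]. split; [exact Hlt|].
intros i t Hi Ht. destruct (Hs' i ltac:(lia)) as [h1 h2]. destruct (Hs' (S i) ltac:(lia)) as [h3 h4].
apply (lifted_arc c e y0 d K x y (sg i) C); [exact HL|lra|apply HFI|lra|].
intros u Hu. apply (cf_zone CF); [exact Hi|apply Hst; lra|].
assert (g1 := Hmon i ltac:(lia) (s i) u ltac:(lra)). assert (g2 := Hmon (S i) ltac:(lia) u (s (S i)) ltac:(lra)).
lra.
Qed.

Lemma sin_shift x k : sin (x - 2 * PI * INR k) = sin x.
Proof.
rewrite <- (sin_period (x - 2 * PI * INR k) k). f_equal. ring.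
Qed.
Lemma cos_shift x k : cos (x - 2 * PI * INR k) = cos x.
Proof.
rewrite <- (cos_period (x - 2 * PI * INR k) k). f_equal. ring.
Qed.

Lemma lifted_shift c e y0 d K x y k :
  lifted c e y0 d K x y -> lifted c e y0 d K (fun t => x t - 2 * PI * INR k) y.
Proof.
intros [H1 H2 H3 (D & HD & H4)]. split; [|exact H2|exact H3|].
- intros t. apply (continuous_minus (V := R_NormedModule) x (fun _ => 2 * PI * INR k)); [apply H1|apply continuous_const].
- exists D. split; [exact HD|]. intros t Ht Hn. destruct (H4 t Ht Hn) as (dx & dy & h1 & h2 & h3 & h4 & h5).
  exists dx, dy. split; [|split; [exact h2|split; [exact h3|split; [exact h4|]]]].
  + rewrite <- (Rminus_0_r dx). apply (is_derive_minus x (fun _ => 2 * PI * INR k)); [exact h1|].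
    apply (is_derive_const (V := R_NormedModule)).
  + intros s Hs. rewrite polar_shift in Hs. unfold fieldA, fieldB. rewrite sin_shift, cos_shift. apply h5, Hs.
Qed.

Lemma cos_eq_1_multiple a : cos a = 1 -> exists n : Z, a = 2 * PI * IZR n.
Proof.
intros H. destruct (sin_eq_0_0 (a / 2)) as [n Hn].
- replace a with (2 * (a / 2)) in H by field. rewrite cos_2a_sin in H. nra.
- exists n. lra.
Qed.

Lemma polar_inj x y x' y' : polar x y = polar x' y' -> y = y' /\ exists n : Z, x' = x + 2 * PI * IZR n.
Proof.
intros H. assert (E : exp y = exp y') by (rewrite <- (polar_Cmod x y), <- (polar_Cmod x' y'), H; reflexivity).
apply exp_inv in E. subst y'. split; [reflexivity|].
unfold polar in H. injection H. intros H2 H1. assert (h := exp_pos y).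
assert (C : cos x = cos x') by (apply Rmult_eq_reg_l with (exp y); lra).
assert (S : sin x = sin x') by (apply Rmult_eq_reg_l with (exp y); lra).
destruct (cos_eq_1_multiple (x' - x)) as [n Hn].
- rewrite cos_minus, C, S. assert (g := sin2_cos2 x'). unfold Rsqr in g. lra.
- exists n. lra.
Qed.

Lemma interval_search (f : nat -> R) (n : nat) (t : R) :
  (0 < n)%nat -> f O <= t <= f n -> exists i, (i < n)%nat /\ f i <= t <= f (S i).
Proof.
induction n as [|n IH]; [lia|]. intros _ Ht.
destruct n as [|n]; [exists O; split; [lia|exact Ht]|].
destruct (Rle_dec t (f (S n))) as [h|h].
- destruct IH as (i & Hi & H); [lia|lra|]. exists i. split; [lia|exact H].
- exists (S n). split; [lia|lra].
Qed.

Record turn (y0 d0 e : R) (N : nat) (xi : nat -> R -> R) (sg : nat -> zone)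
    (p q : zone -> R -> R -> R) (x y : R -> R) (t0 t1 : R) (s : nat -> R) : Prop := {
  tn_0 : s O = t0;
  tn_1 : s N = t1;
  tn_sec : forall i, (i <= N)%nat -> 0 <= s i /\ x (s i) = xi i (y (s i));
  tn_lt : forall i, (i < N)%nat -> s i < s (S i);
  tn_arc : forall i t, (i < N)%nat -> s i <= t <= s (S i) ->
      x t + e * p (sg i) (x t) (y t) - (x (s i) + e * p (sg i) (x (s i)) (y (s i))) = t - s i /\
      y t + e * q (sg i) (x t) (y t) - (y (s i) + e * q (sg i) (x (s i)) (y (s i))) = 0
}.
Arguments tn_0 {y0 d0 e N xi sg p q x y t0 t1 s} _.
Arguments tn_1 {y0 d0 e N xi sg p q x y t0 t1 s} _.
Arguments tn_sec {y0 d0 e N xi sg p q x y t0 t1 s} _.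
Arguments tn_lt {y0 d0 e N xi sg p q x y t0 t1 s} _.
Arguments tn_arc {y0 d0 e N xi sg p q x y t0 t1 s} _.

(** [sig k] is the time at which the lift reaches the [k]-th translate of the initial section. Since
    [x 0 <= PI] and the sections lie beyond [PI], the start precedes all of them. *)
Lemma return_times c e y0 d d0 L0 K C N xi dxi sg p q x y :
  config y0 d0 L0 N xi dxi sg -> lifted c e y0 d K x y -> d <= d0 ->
  K * Rabs e * (1 + L0) <= / 2 ->
  (forall s, first_integral (c s) y0 e C (p s) (q s)) -> x 0 <= PI ->
  exists sig : nat -> R,
    (forall k, 0 <= sig k /\ x (sig k) - xi O (y (sig k)) = 2 * PI * INR k) /\
    forall k, exists s, turn y0 d0 e N xi sg p q (fun t => x t - 2 * PI * INR k) y (sig k) (sig (S k)) s.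
Proof.
intros CF HL Hdd HK HFI Hx0.
assert (HL0 := cf_L CF). assert (HP := PI_RGT_0).
assert (Hst : forall t, 0 <= t -> Rabs (y t - y0) < d0).
{ intros t h. generalize (lf_strip HL t h). lra. }
assert (Hxi : forall i, (i <= N)%nat -> forall u, Rabs (u - y0) < d -> exists l, is_derive (xi i) u l /\ Rabs l <= L0).
{ intros i Hi u Hu. apply (cf_der CF); [exact Hi|lra]. }
assert (Hmon : forall t t', 0 <= t <= t' -> / 2 * (t' - t) <= (x t' - xi O (y t')) - (x t - xi O (y t))).
{ intros t t' Ht. apply (lifted_increasing c e y0 d K x y (xi O) L0); auto. apply Hxi. lia. }
assert (Hex : forall k, exists t, 0 <= t /\ x t - xi O (y t) = 2 * PI * INR k).
{ intros k. apply (section_hit c e y0 d K x y (xi O) L0); auto.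
  - apply Hxi. lia.
  - lra.
  - destruct (cf_range CF O (y 0) ltac:(lia) (Hst 0 ltac:(lra))).
    assert (0 <= 2 * PI * INR k) by (apply Rmult_le_pos; [lra|apply pos_INR]). lra. }
destruct (choice _ Hex) as [sig Hsig].
exists sig. split; [exact Hsig|]. intros k. destruct (Hsig k) as [h1 h2].
destruct (one_turn c e y0 d d0 L0 K C N xi dxi sg p q (fun t => x t - 2 * PI * INR k) y (sig k) CF
  (lifted_shift _ _ _ _ _ _ _ k HL) Hdd HK HFI h1 ltac:(lra)) as (s & E0 & E1 & E2 & E3).
exists s. split; auto.
- destruct (E1 N ltac:(lia)) as [g1 g2].
  rewrite (cf_turn CF (y (s N)) (Hst (s N) ltac:(lra))) in g2.
  destruct (Hsig (S k)) as [h3 h4]. rewrite S_INR in h4.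
  destruct (Rtotal_order (s N) (sig (S k))) as [hh|[hh|hh]]; [exfalso|exact hh|exfalso].
  + assert (m := Hmon (s N) (sig (S k)) ltac:(lra)). lra.
  + assert (m := Hmon (sig (S k)) (s N) ltac:(lra)). lra.
- intros i Hi. destruct (E1 i Hi) as [g1 g2]. split; [lra|exact g2].
Qed.

Definition sec_in (xi : nat -> R -> R) (sg : nat -> zone) (q : zone -> R -> R -> R -> R) (i : nat) (e u : R) : R :=
  u + e * q (sg i) e (xi i u) u.
Definition sec_out (xi : nat -> R -> R) (sg : nat -> zone) (q : zone -> R -> R -> R -> R) (i : nat) (e u : R) : R :=
  u + e * q (sg i) e (xi (S i) u) u.

Lemma turn_chain y0 d0 e N xi sg p q x y t0 t1 s :
  turn y0 d0 e N xi sg (fun z => p z e) (fun z => q z e) x y t0 t1 s ->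
  chain (sec_in xi sg q) (sec_out xi sg q) e N (fun i => y (s i)).
Proof.
intros HT i Hi. unfold sec_in, sec_out.
destruct (tn_sec HT i ltac:(lia)) as [_ E1].
destruct (tn_sec HT (S i) ltac:(lia)) as [_ E2].
assert (Hlt := tn_lt HT i Hi).
destruct (tn_arc HT i (s (S i)) Hi ltac:(lra)) as [_ E3].
rewrite E1, E2 in E3. lra.
Qed.

(** Equal heights on two consecutive sections give equal durations of the arcs, and then equal
    values of the time and of the first integral after equal delays; injectivity of the
    near-identity map gives equal points. *)
Lemma turn_overlap c y0 d0 e C N xi sg p q x y t0 t1 s x' y' t0' t1' s' t :
  (forall z, first_integral (c z) y0 e C (p z) (q z)) -> C * Rabs e <= / 4 ->
  (0 < N)%nat ->
  (forall u, 0 <= u -> Rabs (y u - y0) < 1) -> (forall u, 0 <= u -> Rabs (y' u - y0) < 1) ->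
  turn y0 d0 e N xi sg p q x y t0 t1 s -> turn y0 d0 e N xi sg p q x' y' t0' t1' s' ->
  (forall i, (i <= N)%nat -> y (s i) = y' (s' i)) -> t0 <= t <= t1 ->
  exists t', 0 <= t' /\ x' t' = x t /\ y' t' = y t.
Proof.
intros HFI HC HN Hy Hy' T T' HE Ht.
assert (SM : forall z, small_on y0 1 (fun x y => e * p z x y) /\ small_on y0 1 (fun x y => e * q z x y)).
{ intros z. destruct (HFI z) as [_ _ _ L1 L2 _ _].
  split; [apply (lip_on_le _ _ _ _ _ HC L1)|apply (lip_on_le _ _ _ _ _ HC L2)]. }
destruct (interval_search s N t HN) as (i & Hi & Hti).
{ rewrite (tn_0 T), (tn_1 T). exact Ht. }
destruct (tn_sec T i ltac:(lia)) as [P1 X1].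
destruct (tn_sec T (S i) ltac:(lia)) as [P2 X2].
destruct (tn_sec T' i ltac:(lia)) as [P3 X3].
destruct (tn_sec T' (S i) ltac:(lia)) as [P4 X4].
assert (L1 := tn_lt T i Hi). assert (L2 := tn_lt T' i Hi).
destruct (tn_arc T i (s (S i)) Hi ltac:(lra)) as [A1 _].
destruct (tn_arc T' i (s' (S i)) Hi ltac:(lra)) as [A2 _].
rewrite X1, X2 in A1. rewrite X3, X4 in A2. rewrite <- !HE in A2 by lia.
assert (Hdur : s' (S i) - s' i = s (S i) - s i) by lra.
exists (s' i + (t - s i)).
destruct (tn_arc T i t Hi Hti) as [B1 B2].
destruct (tn_arc T' i (s' i + (t - s i)) Hi ltac:(lra)) as [B3 B4].
rewrite X1 in B1, B2. rewrite X3 in B3, B4. rewrite <- HE in B3, B4 by lia.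
split; [lra|].
assert (h := near_identity_injective y0 1 _ _ (x' (s' i + (t - s i))) (y' (s' i + (t - s i))) (x t) (y t) 0 0
  (proj1 (SM (sg i))) (proj2 (SM (sg i))) (Hy' (s' i + (t - s i)) ltac:(lra)) (Hy t ltac:(lra))).
cbv beta in h.
assert (h' : Rabs (x' (s' i + (t - s i)) - x t) + Rabs (y' (s' i + (t - s i)) - y t) <= 0).
{ replace 0 with (2 * (0 + 0)) by ring. apply h.
  - replace (x' (s' i + (t - s i)) + e * p (sg i) (x' (s' i + (t - s i))) (y' (s' i + (t - s i))) - (x t + e * p (sg i) (x t) (y t))) with 0 by lra.
    rewrite Rabs_R0. lra.
  - replace (y' (s' i + (t - s i)) + e * q (sg i) (x' (s' i + (t - s i))) (y' (s' i + (t - s i))) - (y t + e * q (sg i) (x t) (y t))) with 0 by lra.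
    rewrite Rabs_R0. lra. }
revert h'. generalize (x' (s' i + (t - s i))) (y' (s' i + (t - s i))). intros a b h'.
assert (g1 := Rabs_pos (a - x t)). assert (g2 := Rabs_pos (b - y t)).
split; apply Rminus_diag_uniq; apply Rabs_eq_0; lra.
Qed.

(** The first-order displacement over a turn: each arc contributes the increment of [kappa], that is
    the integral of [fieldB] along the unperturbed arc. *)
Definition melnikov (c : zone -> nat -> R) (y0 : R) (N : nat) (xi : nat -> R -> R) (sg : nat -> zone) : R :=
  fsum (fun i => kappa (c (sg i)) (xi (S i) y0) y0 - kappa (c (sg i)) (xi i y0) y0) N.
Definition melnikov' (c : zone -> nat -> R) (y0 : R) (N : nat) (xi : nat -> R -> R) (dxi : nat -> R) (sg : nat -> zone) : R :=
  fsum (fun i => (fieldB (c (sg i)) (xi (S i) y0) y0 * dxi (S i) + fieldA (c (sg i)) (xi (S i) y0) y0)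
    - (fieldB (c (sg i)) (xi i y0) y0 * dxi i + fieldA (c (sg i)) (xi i y0) y0)) N.

Lemma fsum_ext f g n : (forall i, (i < n)%nat -> f i = g i) -> fsum f n = fsum g n.
Proof.
induction n as [|n IH]; intros H; [reflexivity|]. simpl. rewrite IH, H; auto; intros; apply H; lia.
Qed.

Lemma return_map c y0 d0 L0 e0 C N xi dxi sg p q :
  config y0 d0 L0 N xi dxi sg -> 0 < e0 -> 0 < C ->
  (forall s e, Rabs e < e0 -> first_integral (c s) y0 e C (p s e) (q s e)) ->
  exists F : R -> R -> R,
    near_id y0 F (melnikov c y0 N xi sg) (melnikov' c y0 N xi dxi sg) /\
    (exists d e1, 0 < d /\ 0 < e1 /\ forall e, 0 < Rabs e < e1 ->
      (forall eta, (forall i, (i <= N)%nat -> Rabs (eta i - y0) < d) ->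
        chain (sec_in xi sg q) (sec_out xi sg q) e N eta -> eta N = F e (eta O)) /\
      (forall eta eta', (forall i, (i <= N)%nat -> Rabs (eta i - y0) < d) ->
        chain (sec_in xi sg q) (sec_out xi sg q) e N eta ->
        (forall i, (i <= N)%nat -> Rabs (eta' i - y0) < d) ->
        chain (sec_in xi sg q) (sec_out xi sg q) e N eta' ->
        eta O = eta' O -> forall i, (i <= N)%nat -> eta i = eta' i)) /\
    (forall d, 0 < d -> exists d' e1, 0 < d' /\ 0 < e1 /\ forall e u, 0 < Rabs e < e1 ->
      Rabs (u - y0) < d' -> exists eta, eta O = u /\ eta N = F e u /\
        chain (sec_in xi sg q) (sec_out xi sg q) e N eta /\
        forall i, (i <= N)%nat -> Rabs (eta i - y0) < d).
Proof.
intros CF He0 HC HFI.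
destruct (chain_map y0 (sec_in xi sg q) (sec_out xi sg q)
  (fun i => - kappa (c (sg i)) (xi i y0) y0)
  (fun i => - (fieldB (c (sg i)) (xi i y0) y0 * dxi i + fieldA (c (sg i)) (xi i y0) y0))
  (fun i => - kappa (c (sg i)) (xi (S i) y0) y0)
  (fun i => - (fieldB (c (sg i)) (xi (S i) y0) y0 * dxi (S i) + fieldA (c (sg i)) (xi (S i) y0) y0)) N)
  as (F & HF & H1 & H2).
- intros i Hi. split.
  + apply (near_id_crossing (c (sg i)) y0 e0 C (dxi i) (p (sg i)) (q (sg i)) (xi i)); auto.
    apply (cf_strict CF). lia.
  + apply (near_id_crossing (c (sg i)) y0 e0 C (dxi (S i)) (p (sg i)) (q (sg i)) (xi (S i))); auto.
    apply (cf_strict CF). lia.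
- exists F. split; [|split; assumption].
  apply (near_id_ext _ _ _ _ _ _ HF); apply fsum_ext; intros; ring.
Qed.

Lemma periodic_shift (z : R -> C) (T : R) : (forall t, z (t + T) = z t) ->
  forall (n : Z) t, z (t + IZR n * T) = z t.
Proof.
intros H.
assert (Hn : forall (n : nat) t, z (t + INR n * T) = z t).
{ induction n as [|n IH]; intros t.
  - simpl. f_equal. ring.
  - rewrite S_INR. replace (t + (INR n + 1) * T) with ((t + INR n * T) + T) by ring. rewrite H. apply IH. }
intros n t. destruct (Z.le_gt_cases 0 n) as [h|h].
- rewrite <- (Znat.Z2Nat.id n h), <- INR_IZR_INZ. apply Hn.
- rewrite <- (Hn (Z.to_nat (- n)) (t + IZR n * T)). rewrite INR_IZR_INZ, Znat.Z2Nat.id, opp_IZR by lia.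
  f_equal. ring.
Qed.

Lemma periodic_reduce (z : R -> C) (T a t : R) : 0 < T -> (forall t, z (t + T) = z t) ->
  exists t', a <= t' <= a + T /\ z t' = z t.
Proof.
intros HT H. destruct (floor_ex ((t - a) / T)) as [n Hn].
exists (t + IZR (- n) * T). split; [|apply periodic_shift, H].
rewrite opp_IZR. assert (E : (t - a) / T * T = t - a) by (field; lra).
assert (h1 : IZR n * T <= (t - a) / T * T) by (apply Rmult_le_compat_r; lra).
assert (h2 : (t - a) / T * T < (IZR n + 1) * T) by (apply Rmult_lt_compat_r; lra).
lra.
Qed.

Record lifted_orbit (c : zone -> nat -> R) (e y0 d K : R) (g : C -> Prop) (z : R -> C) (x y : R -> R) (T : R) : Prop := {
  lo_T : 0 < T;
  lo_per : forall t, z (t + T) = z t;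
  lo_img : forall w, g w <-> exists t, z t = w;
  lo_lift : lifted c e y0 d K x y;
  lo_x0 : - PI <= x 0 <= PI;
  lo_polar : forall t, 0 <= t -> z t = polar (x t) (y t)
}.
Arguments lo_T {c e y0 d K g z x y T} _.
Arguments lo_per {c e y0 d K g z x y T} _.
Arguments lo_img {c e y0 d K g z x y T} _.
Arguments lo_lift {c e y0 d K g z x y T} _.
Arguments lo_x0 {c e y0 d K g z x y T} _.
Arguments lo_polar {c e y0 d K g z x y T} _.

Lemma periodic_orbit_lift c e y0 d K g :
  0 < d <= 1 ->
  (forall s x y, Rabs (y - y0) < 1 -> Rabs (fieldA (c s) x y) <= K /\ Rabs (fieldB (c s) x y) <= K) ->
  periodic_orbit (centered c e) g -> (forall w, g w -> in_tube y0 d w) ->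
  exists z x y T, lifted_orbit c e y0 d K g z x y T.
Proof.
intros Hd HK (z & T & HT & Htr & Hper & _ & Himg) Hin.
destruct (trajectory_lift c e y0 d K z Hd HK Htr) as (x & y & H1 & H2 & H3).
{ intros t. apply Hin, Himg. exists t. reflexivity. }
exists z, x, y, T. split; auto.
Qed.

(** The orbit winds around the center and so meets every ray. This gives the half of Hausdorff
    convergence in which the limit circle must be close to the orbit. *)
Lemma lifted_orbit_angle c e y0 d K g z x y T th :
  lifted_orbit c e y0 d K g z x y T -> K * Rabs e <= / 2 ->
  exists y1, Rabs (y1 - y0) < d /\ g (polar th y1).
Proof.
intros HO HK. assert (HL := lo_lift HO). assert (P := PI_RGT_0).
destruct (nfloor_ex (Rabs (x 0 - th))) as [k [_ Hk]]; [apply Rabs_pos|].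
(* The ray is a section with slope bound 0; enough turns are added to place the target angle ahead
   of [x 0]. *)
destruct (section_hit c e y0 d K x y (fun _ => th) 0 (2 * PI * INR (S k)) 0 HL) as (t & Ht & E).
- lra.
- rewrite Rplus_0_r, Rmult_1_r. exact HK.
- intros u _. exists 0. split; [apply (is_derive_const (V := R_NormedModule))|rewrite Rabs_R0; lra].
- lra.
- rewrite S_INR. assert (0 <= INR k) by apply pos_INR. assert (h := Rle_abs (x 0 - th)).
  generalize PI2_3_2. unfold PI2. intros. assert (1 < PI) by lra. nra.
- exists (y t). split; [apply (lf_strip HL), Ht|].
  apply (lo_img HO). exists t. rewrite (lo_polar HO t Ht).
  replace th with (x t - 2 * PI * INR (S k)) by lra. symmetry. apply polar_shift.
Qed.

(** A periodic orbit in the tube closes after some number of turns, so its heights on the initial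
    section form a periodic orbit of the return map. Such orbits coincide near a simple zero; equal
    initial heights determine all heights of each turn, hence all its points. One inclusion
    suffices, the hypotheses being symmetric. *)
Lemma periodic_orbits_coincide c y0 d0 L0 N xi dxi sg :
  config y0 d0 L0 N xi dxi sg ->
  melnikov c y0 N xi sg = 0 -> melnikov' c y0 N xi dxi sg <> 0 ->
  exists d e1, 0 < d <= d0 /\ 0 < e1 /\ forall e, 0 < Rabs e < e1 ->
    forall g g' : C -> Prop,
      periodic_orbit (centered c e) g -> (forall w, g w -> in_tube y0 d w) ->
      periodic_orbit (centered c e) g' -> (forall w, g' w -> in_tube y0 d w) ->
      forall w, g w -> g' w.
Proof.
intros CF HM HM'.
destruct (zone_field_bounded c y0) as (K & HK & BK).
destruct (first_integral_exists c y0) as (e0 & C & He0 & HC & p & q & HFI).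
destruct (return_map c y0 d0 L0 e0 C N xi dxi sg p q CF He0 HC HFI) as (F & HF & (d1 & e1 & Hd1 & He1 & H1) & _).
rewrite HM in HF.
destruct (near_id_periodic_unique y0 F _ HF HM') as (d2 & e2 & Hd2 & He2 & H2).
assert (Hd01 := cf_d CF). assert (HL0 := cf_L CF).
set (d := Rmin d0 (Rmin d1 d2)).
assert (Hd : 0 < d /\ d <= d0 /\ d <= d1 /\ d <= d2).
{ unfold d. split; [repeat apply Rmin_glb_lt; lra|].
  generalize (Rmin_l d0 (Rmin d1 d2)) (Rmin_r d0 (Rmin d1 d2)) (Rmin_l d1 d2) (Rmin_r d1 d2). lra. }
clearbody d.
assert (HKL : 0 < 2 * K * (1 + L0)) by (apply Rmult_lt_0_compat; lra).
exists d, (Rmin (Rmin e0 (Rmin e1 e2)) (Rmin (/ (2 * K * (1 + L0))) (/ (4 * C)))).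
split; [lra|]. split.
{ repeat apply Rmin_glb_lt; auto; apply Rinv_0_lt_compat; lra. }
intros e [E0 He]. apply Rmin_Rgt in He. destruct He as [Ha Hb]. apply Rmin_Rgt in Ha, Hb.
destruct Ha as [E1 Ha], Hb as [E4 E5]. apply Rmin_Rgt in Ha. destruct Ha as [E2 E3].
apply Rgt_lt in E1, E2, E3, E4, E5.
assert (HKe : K * Rabs e * (1 + L0) <= / 2).
{ replace (/ 2) with (K * / (2 * K * (1 + L0)) * (1 + L0)) by (field; lra).
  apply Rmult_le_compat_r; [lra|]. apply Rmult_le_compat_l; lra. }
assert (HCe : C * Rabs e <= / 4).
{ replace (/ 4) with (C * / (4 * C)) by (field; lra). apply Rmult_le_compat_l; lra. }
assert (FI : forall s, first_integral (c s) y0 e C (p s e) (q s e)) by (intros; apply HFI, E1).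
intros g g' Hg Hgt Hg' Hgt' w Hw.
destruct (H1 e (conj E0 E2)) as [HFc Heq]. assert (Huq := H2 e (conj E0 E3)).
destruct (periodic_orbit_lift c e y0 d K g) as (z & x & y & T & HO); auto; [lra|].
destruct (periodic_orbit_lift c e y0 d K g') as (z' & x' & y' & T' & HO'); auto; [lra|].
assert (Hseq : forall g z x y T, lifted_orbit c e y0 d K g z x y T ->
  exists sig n, (0 < n)%nat /\ 0 <= sig O /\ sig n = sig O + T /\
   (forall k, Rabs (y (sig k) - y0) < d2 /\ y (sig (S k)) = F e (y (sig k))) /\
   (forall k, y (sig (n + k)%nat) = y (sig k)) /\
   forall k, exists s, turn y0 d0 e N xi sg (fun z => p z e) (fun z => q z e) (fun t => x t - 2 * PI * INR k) y (sig k) (sig (S k)) s).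
{ clear g g' Hg Hgt Hg' Hgt' w Hw z x y T HO z' x' y' T' HO'. intros g z x y T HO.
  assert (HL := lo_lift HO). assert (HT := lo_T HO).
  assert (Hst : forall t, 0 <= t -> Rabs (y t - y0) < d) by apply (lf_strip HL).
  destruct (return_times c e y0 d d0 L0 K C N xi dxi sg (fun z => p z e) (fun z => q z e) x y CF HL
     (proj1 (proj2 Hd)) HKe FI (proj2 (lo_x0 HO))) as (sig & S1 & S2).
  destruct (S1 O) as [s00 s01]. simpl INR in s01. rewrite Rmult_0_r in s01.
  assert (Hz : polar (x (sig O)) (y (sig O)) = polar (x (sig O + T)) (y (sig O + T))).
  { rewrite <- !(lo_polar HO) by lra. symmetry. apply (lo_per HO). }
  apply polar_inj in Hz. destruct Hz as [Hz1 [n Hn]].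
  assert (Hinc : / 2 * (sig O + T - sig O) <= (x (sig O + T) - 0) - (x (sig O) - 0)).
  { apply (lifted_increasing c e y0 d K x y (fun _ => 0) L0); auto; [|lra].
    intros u _. exists 0. split; [apply (is_derive_const (V := R_NormedModule))|rewrite Rabs_R0; lra]. }
  assert (HP := PI_RGT_0).
  (* The winding number over a period is positive because [x] increases. *)
  assert (Hn0 : (0 < n)%Z).
  { apply lt_IZR. apply Rmult_lt_reg_l with (2 * PI); lra. }
  assert (HnR : INR (Z.to_nat n) = IZR n) by (rewrite INR_IZR_INZ, Znat.Z2Nat.id by lia; reflexivity).
  assert (Hret : sig (Z.to_nat n) = sig O + T).
  { destruct (S1 (Z.to_nat n)) as [g1 g2]. rewrite HnR in g2.
    assert (Hmon : forall t t', 0 <= t <= t' -> / 2 * (t' - t) <= (x t' - xi O (y t')) - (x t - xi O (y t))).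
    { intros t t' Ht. apply (lifted_increasing c e y0 d K x y (xi O) L0); auto.
      intros u Hu. apply (cf_der CF); [lia|lra]. }
    assert (g3 : x (sig O + T) - xi O (y (sig O + T)) = 2 * PI * IZR n) by (rewrite <- Hz1; lra).
    destruct (Rtotal_order (sig (Z.to_nat n)) (sig O + T)) as [hh|[hh|hh]]; [exfalso|exact hh|exfalso].
    - assert (m := Hmon (sig (Z.to_nat n)) (sig O + T) ltac:(lra)). lra.
    - assert (m := Hmon (sig O + T) (sig (Z.to_nat n)) ltac:(lra)). lra. }
  assert (HstepF : forall k, y (sig (S k)) = F e (y (sig k))).
  { intros k. destruct (S2 k) as (s & Hs).
    assert (h := HFc (fun i => y (s i))). cbv beta in h.
    rewrite (tn_0 Hs), (tn_1 Hs) in h. apply h.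
    - intros i Hi. destruct (tn_sec Hs i Hi) as [h1 _]. generalize (Hst _ h1). lra.
    - apply (turn_chain y0 d0 e N xi sg p q _ _ _ _ s Hs). }
  exists sig, (Z.to_nat n). split; [lia|]. split; [exact s00|]. split; [exact Hret|]. split; [|split; [|exact S2]].
  - intros k. split; [|apply HstepF]. generalize (Hst _ (proj1 (S1 k))). lra.
  - induction k as [|k IH].
    + rewrite Nat.add_0_r, Hret. symmetry. exact Hz1.
    + rewrite Nat.add_succ_r, !HstepF, IH. reflexivity. }
destruct (Hseq _ _ _ _ _ HO) as (sig & n & Hn & Hs0 & Hsn & Hu & Hup & Htn).
destruct (Hseq _ _ _ _ _ HO') as (sig' & n' & Hn' & Hs0' & Hsn' & Hu' & Hup' & Htn').
assert (Hmul : forall (f : nat -> R) n, (forall k, f (n + k)%nat = f k) -> forall j, f (j * n)%nat = f O).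
{ intros f m Hf. induction j as [|j IH]; [reflexivity|]. simpl. rewrite Hf. exact IH. }
assert (E00 : y (sig O) = y' (sig' O)).
(* The two orbits may wind [n] and [n'] times; the product is a common period. *)
{ apply (Huq (fun k => y (sig k)) (fun k => y' (sig' k)) (n * n')%nat); auto; [lia| |].
  - rewrite Nat.mul_comm. apply (Hmul (fun k => y (sig k))). exact Hup.
  - apply (Hmul (fun k => y' (sig' k))). exact Hup'. }
assert (Ek : forall k, y (sig k) = y' (sig' k)).
{ induction k as [|k IH]; [exact E00|]. rewrite (proj2 (Hu k)), (proj2 (Hu' k)), IH. reflexivity. }
apply (lo_img HO) in Hw. destruct Hw as [tw Htw].
destruct (periodic_reduce z T (sig O) tw (lo_T HO) (lo_per HO)) as (t & Ht & Ezt).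
rewrite <- Hsn in Ht. destruct (interval_search sig n t Hn Ht) as (k & Hk & Htk).
destruct (Htn k) as (s & Ts). destruct (Htn' k) as (s' & Ts').
assert (HL := lo_lift HO). assert (HL' := lo_lift HO').
assert (Hst : forall t, 0 <= t -> Rabs (y t - y0) < d) by apply (lf_strip HL).
assert (Hst' : forall t, 0 <= t -> Rabs (y' t - y0) < d) by apply (lf_strip HL').
assert (HEi : forall i, (i <= N)%nat -> y (s i) = y' (s' i)).
{ apply (Heq (fun i => y (s i)) (fun i => y' (s' i))).
  - intros i Hi. destruct (tn_sec Ts i Hi) as [h1 _]. generalize (Hst _ h1). lra.
  - apply (turn_chain y0 d0 e N xi sg p q _ _ _ _ s Ts).
  - intros i Hi. destruct (tn_sec Ts' i Hi) as [h1 _]. generalize (Hst' _ h1). lra.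
  - apply (turn_chain y0 d0 e N xi sg p q _ _ _ _ s' Ts').
  - rewrite (tn_0 Ts), (tn_0 Ts'). apply Ek. }
assert (Hst1 : forall t, 0 <= t -> Rabs (y t - y0) < 1) by (intros u hu; generalize (Hst u hu); lra).
assert (Hst1' : forall t, 0 <= t -> Rabs (y' t - y0) < 1) by (intros u hu; generalize (Hst' u hu); lra).
destruct (turn_overlap c y0 d0 e C N xi sg _ _ _ _ _ _ _ _ _ _ _ _ t FI HCe (cf_N CF)
   Hst1 Hst1' Ts Ts' HEi Htk) as (t' & Ht' & Ex & Ey).
apply (lo_img HO'). exists t'.
rewrite <- Htw, <- Ezt, (lo_polar HO) by lra.
rewrite (lo_polar HO') by exact Ht'. rewrite Ey. f_equal. lra.
Qed.

(** * Existence of periodic orbits *)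

(** Continuity is asked on the whole line so that arcs can be glued by one formula; [arc_moves] will
    make the closed orbit nonconstant. *)
Record arc (X : pw_field) (A : C -> Prop) (z : R -> C) (T : R) : Prop := {
  arc_T : 0 < T;
  arc_cont : forall t, continuous z t;
  arc_flow : exists ts, forall t, 0 < t < T -> ~ In t ts -> exists v, is_derive z t v /\ filippov X (z t) v;
  arc_in : forall t, 0 <= t <= T -> A (z t);
  arc_moves : exists t, 0 <= t <= T /\ z t <> z 0
}.

Lemma continuous_C_comp (z : R -> C) (f : R -> R) (t : R) :
  (forall t, continuous z t) -> continuous f t -> continuous (fun s => z (f s)) t.
Proof. intros Hz Hf. apply (continuous_comp f z); [exact Hf|apply Hz]. Qed.

Lemma continuous_C_glue (z1 z2 : R -> C) (w : C) (t : R) :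
  continuous z1 t -> continuous z2 t -> continuous (fun s => (z1 s + z2 s - w)%C) t.
Proof.
intros H1 H2. apply continuous_C_iff in H1, H2. apply continuous_C_iff.
destruct H1 as [a1 a2], H2 as [b1 b2]. split.
- apply (continuous_minus (V := R_NormedModule) (fun s => fst (z1 s) + fst (z2 s)) (fun _ => fst w)).
  + apply (continuous_plus (V := R_NormedModule) (fun s => fst (z1 s)) (fun s => fst (z2 s))); assumption.
  + apply continuous_const.
- apply (continuous_minus (V := R_NormedModule) (fun s => snd (z1 s) + snd (z2 s)) (fun _ => snd w)).
  + apply (continuous_plus (V := R_NormedModule) (fun s => snd (z1 s)) (fun s => snd (z2 s))); assumption.
  + apply continuous_const.
Qed.

Lemma continuous_min_shift a b t : continuous (fun s : R => Rmin (s - a) b) t.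
Proof.
apply (continuous_lip _ 1). intros s u. rewrite Rmult_1_l.
replace (s - u) with ((s - a) - (u - a)) by ring. apply Rmin_lip.
Qed.

Lemma continuous_max_shift a b t : continuous (fun s : R => Rmax (s - a) b) t.
Proof.
apply (continuous_lip _ 1). intros s u. rewrite Rmult_1_l.
unfold Rmax. destruct (Rle_dec (s - a) b), (Rle_dec (u - a) b); split_Rabs; lra.
Qed.

Lemma is_derive_shift (z : R -> C) (a t : R) (v : C) :
  is_derive z (t - a) v -> is_derive (fun s => z (s - a)) t v.
Proof.
intros H. apply is_derive_C_iff in H. apply is_derive_C_iff. destruct H as [H1 H2].
split.
- rewrite <- (Rmult_1_l (fst v)). apply (is_derive_comp (fun s => fst (z s)) (fun s => s - a)); [exact H1|].
  auto_derive; [exact I|ring].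
- rewrite <- (Rmult_1_l (snd v)). apply (is_derive_comp (fun s => snd (z s)) (fun s => s - a)); [exact H2|].
  auto_derive; [exact I|ring].
Qed.

Lemma arc_concat X A z1 T1 z2 T2 : arc X A z1 T1 -> arc X A z2 T2 -> z1 T1 = z2 0 ->
  exists z, arc X A z (T1 + T2) /\ z 0 = z1 0 /\ z (T1 + T2) = z2 T2.
Proof.
intros [P1 C1 (ts1 & F1) I1 (m & Hm & Hmv)] [P2 C2 (ts2 & F2) I2 _] E.
(* On each side of [T1] one summand is frozen at the common value [z1 T1 = z2 0], which the last
   term cancels, so continuity needs no case distinction. *)
set (z := fun t => (z1 (Rmin (t - 0) T1) + z2 (Rmax (t - T1) 0%R) - z2 0%R)%C).
assert (Hl : forall t, t <= T1 -> z t = z1 t).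
{ intros t Ht. unfold z. rewrite Rmin_left, Rmax_right, Rminus_0_r by lra. ring. }
assert (Hr : forall t, T1 <= t -> z t = z2 (t - T1)).
{ intros t Ht. unfold z. rewrite Rmin_right, Rmax_left, E by lra. ring. }
assert (Ht0 : z 0 = z1 0) by (apply Hl; lra).
assert (Ht1 : z (T1 + T2) = z2 T2) by (rewrite Hr by lra; f_equal; ring).
exists z. split; [|split; assumption]. split.
- lra.
- intros t. apply continuous_C_glue.
  + apply (continuous_C_comp z1 (fun t => Rmin (t - 0) T1)); [exact C1|apply continuous_min_shift].
  + apply (continuous_C_comp z2 (fun t => Rmax (t - T1) 0)); [exact C2|apply continuous_max_shift].
- exists (T1 :: ts1 ++ map (fun s => s + T1) ts2). intros t Ht Hn.
  assert (Hne : t <> T1) by (intros ->; apply Hn; left; reflexivity).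
  destruct (Rlt_le_dec t T1) as [h|h].
  + destruct (F1 t) as (v & D & G); [lra|intros hh; apply Hn; right; apply in_or_app; left; exact hh|].
    exists v. rewrite Hl by lra. split; [|exact G].
    apply (is_derive_ext_loc z1); [|exact D].
    exists (mkposreal (T1 - t) ltac:(lra)). intros s Hs. change (Rabs (s - t) < T1 - t) in Hs.
    symmetry. apply Hl. apply Rabs_lt_between in Hs. lra.
  + destruct (F2 (t - T1)) as (v & D & G); [lra| |].
    { intros hh. apply Hn. right. apply in_or_app. right. apply in_map_iff. exists (t - T1). split; [ring|exact hh]. }
    exists v. rewrite Hr by lra. split; [|exact G].
    apply (is_derive_ext_loc (fun s => z2 (s - T1))); [|apply is_derive_shift, D].
    exists (mkposreal (t - T1) ltac:(lra)). intros s Hs. change (Rabs (s - t) < t - T1) in Hs.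
    symmetry. apply Hr. apply Rabs_lt_between in Hs. lra.
- intros t Ht. destruct (Rle_dec t T1) as [h|h].
  + rewrite Hl by lra. apply I1. lra.
  + rewrite Hr by lra. apply I2. lra.
- exists m. split; [lra|]. rewrite Hl, Ht0 by lra. exact Hmv.
Qed.

Lemma arc_close X A z T : arc X A z T -> z T = z 0 ->
  exists g, periodic_orbit X g /\ forall w, g w -> A w.
Proof.
intros [HT Hc (ts & HF) HI (m & Hm & Hmv)] E.
set (fl := fun t => Int_part (t / T)).
assert (Hfl : forall t, IZR (fl t) * T <= t < IZR (fl t) * T + T).
{ intros t. destruct (base_Int_part (t / T)) as [h1 h2]. fold (fl t) in h1, h2.
  assert (e1 : t / T * T = t) by (field; lra).
  assert (g1 : IZR (fl t) * T <= t / T * T) by (apply Rmult_le_compat_r; lra).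
  assert (g2 : t / T * T < (IZR (fl t) + 1) * T) by (apply Rmult_lt_compat_r; lra). lra. }
assert (Hflu : forall t n, IZR n * T <= t < IZR n * T + T -> fl t = n).
{ intros t n h. symmetry. apply Int_part_spec. split.
  - apply Rmult_lt_reg_r with T; [exact HT|]. replace ((t / T - 1) * T) with (t - T) by (field; lra). lra.
  - apply Rmult_le_reg_r with T; [exact HT|]. replace (t / T * T) with t by (field; lra). lra. }
set (zz := fun t => z (t - IZR (fl t) * T)).
assert (Hon : forall n t, IZR n * T <= t < IZR n * T + T -> zz t = z (t - IZR n * T)).
{ intros n t h. unfold zz. rewrite (Hflu t n h). reflexivity. }
assert (Z0 : zz 0 = z 0).
{ rewrite (Hon 0%Z) by (simpl; lra). f_equal. simpl. ring. }
exists (fun w => exists t, zz t = w). split.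
2:{ intros w [t <-]. apply HI. generalize (Hfl t). lra. }
exists zz, T. split; [exact HT|]. split; [split|split; [|split]].
- intros t. set (n := fl t). assert (Hn := Hfl t). fold n in Hn.
  (* Near [t] the periodic extension is the glued union of the copies [n - 1] and [n], which covers
     the case where [t] is a multiple of [T]. *)
  apply (continuous_ext_loc _ (fun s => (z (Rmin (s - IZR (n - 1) * T) T) + z (Rmax (s - IZR n * T) 0%R) - z 0%R)%C)).
  + exists (mkposreal (Rmin (IZR n * T + T - t) T) ltac:(apply Rmin_glb_lt; lra)).
    intros s Hs. change (Rabs (s - t) < Rmin (IZR n * T + T - t) T) in Hs.
    apply Rmin_Rgt in Hs. destruct Hs as [h1 h2]. apply Rgt_lt in h1, h2. apply Rabs_lt_between in h1, h2.
    assert (En : IZR (n - 1) * T = IZR n * T - T) by (rewrite minus_IZR; ring).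
    destruct (Rlt_le_dec s (IZR n * T)) as [h|h].
    * rewrite (Hon (n - 1)%Z) by (rewrite En; lra). rewrite Rmin_left, Rmax_right by lra. 
      set (u := z (s - IZR (n - 1) * T)). change ((u + z 0%R - z 0%R)%C = u). ring.
    * rewrite (Hon n) by lra. rewrite Rmin_right, Rmax_left, E by lra.
      set (u := z (s - IZR n * T)). change ((z 0%R + u - z 0%R)%C = u). ring.
  + apply continuous_C_glue.
    * apply (continuous_C_comp z (fun s => Rmin (s - IZR (n - 1) * T) T)); [exact Hc|apply continuous_min_shift].
    * apply (continuous_C_comp z (fun s => Rmax (s - IZR n * T) 0)); [exact Hc|apply continuous_max_shift].
- exists (fun t => In (t - IZR (fl t) * T) (0 :: ts)). split.
  + intros t1 t2.
    exists (flat_map (fun k => map (fun s => s + IZR (fl t1 + Z.of_nat k) * T) (0 :: ts)) (seq 0 (S (Z.to_nat (fl t2 - fl t1))))).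
    intros t Ht HD. apply in_flat_map.
    assert (Hmono : (fl t1 <= fl t <= fl t2)%Z).
    { assert (g1 := Hfl t1). assert (g2 := Hfl t). assert (g3 := Hfl t2).
      split; apply Zorder.Znot_gt_le; intros hh; apply Z.gt_lt, Zorder.Zlt_le_succ, IZR_le in hh;
      rewrite succ_IZR in hh; apply (Rmult_le_compat_r T) in hh; lra. }
    exists (Z.to_nat (fl t - fl t1)). split; [apply in_seq; lia|].
    apply in_map_iff. exists (t - IZR (fl t) * T). split; [|exact HD].
    rewrite Znat.Z2Nat.id by lia. replace (fl t1 + (fl t - fl t1))%Z with (fl t) by ring. ring.
  + intros t Hn. set (n := fl t) in *. assert (Hn' := Hfl t). fold n in Hn'.
    assert (Hne : t - IZR n * T <> 0) by (intros h; apply Hn; left; symmetry; exact h).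
    destruct (HF (t - IZR n * T)) as (v & D & G); [lra|intros hh; apply Hn; right; exact hh|].
    exists v. rewrite (Hon n t Hn'). split; [|exact G].
    apply (is_derive_ext_loc (fun s => z (s - IZR n * T))); [|apply is_derive_shift, D].
    exists (mkposreal (Rmin (t - IZR n * T) (IZR n * T + T - t)) ltac:(apply Rmin_glb_lt; lra)).
    intros s Hs. change (Rabs (s - t) < Rmin (t - IZR n * T) (IZR n * T + T - t)) in Hs.
    apply Rmin_Rgt in Hs. destruct Hs as [h1 h2]. apply Rgt_lt in h1, h2. apply Rabs_lt_between in h1, h2.
    symmetry. apply Hon. lra.
- intros t. rewrite (Hon (fl t + 1)%Z).
  + unfold zz. f_equal. rewrite plus_IZR. ring.
  + rewrite plus_IZR. generalize (Hfl t). lra.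
- exists m. rewrite Z0, (Hon 0%Z).
  + replace (m - IZR 0 * T) with m by (simpl; ring). exact Hmv.
  + destruct (Req_dec m T) as [->|h]; [contradiction|]. simpl. lra.
- intros w. reflexivity.
Qed.

(** [level_path] is built from the fields of the zone [sg i] alone, and its velocity is that field
    because it inverts the first-integral map. It is a trajectory of the piecewise system because it
    advances relative to both bounding sections, starting on one and ending on the other, hence
    stays strictly between them. *)
Lemma chain_arc c e y0 d0 L0 K C N xi dxi sg p q i r y1 y2 :
  config y0 d0 L0 N xi dxi sg -> (i < N)%nat ->
  (forall s x y, Rabs (y - y0) < 1 -> Rabs (fieldA (c s) x y) <= K /\ Rabs (fieldB (c s) x y) <= K) ->
  K * Rabs e * (1 + L0) <= / 2 ->
  first_integral (c (sg i)) y0 e C p q -> C * Rabs e <= / 4 -> C * Rabs e * 100 <= r / 2 ->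
  0 < r <= d0 -> r < 1 -> Rabs (y1 - y0) < r / 2 -> Rabs (y2 - y0) < r / 2 ->
  y1 + e * q (xi i y1) y1 = y2 + e * q (xi (S i) y2) y2 ->
  0 < (xi (S i) y2 + e * p (xi (S i) y2) y2) - (xi i y1 + e * p (xi i y1) y1) ->
  exists z T, arc (centered c e) (in_tube y0 r) z T /\
    z 0 = polar (xi i y1) y1 /\ z T = polar (xi (S i) y2) y2.
Proof.
intros CF Hi BK HKe FI HL1 HL2 Hr Hr1 Hy1 Hy2 HE HT.
assert (Hd01 := cf_d CF). assert (HL0 := cf_L CF). assert (HP := PI_RGT_0).
destruct FI as [HN Gp Gq LP LQ _ _].
destruct (cf_range CF i y1 ltac:(lia) ltac:(lra)) as [b1 b2].
destruct (cf_range CF (S i) y2 ltac:(lia) ltac:(lra)) as [b3 b4].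
destruct (level_path y0 r (C * Rabs e) (xi i y1) y1 (xi (S i) y2) y2 (fun x y => e * p x y) (fun x y => e * q x y))
  as (x & y & Cx & Cy & X0 & Y0 & Hend & Hbox); auto; try lra.
cbv beta in Hend, Hbox.
set (T := xi (S i) y2 + e * p (xi (S i) y2) y2 - (xi i y1 + e * p (xi i y1) y1)) in *. clearbody T.
destruct (Hend HT) as [XT YT]. clear Hend.
assert (SP : small_on y0 1 (fun x y => e * p x y)) by apply (lip_on_le _ _ _ _ _ HL1 LP).
assert (SQ : small_on y0 1 (fun x y => e * q x y)) by apply (lip_on_le _ _ _ _ _ HL1 LQ).
assert (Hder : forall t, 0 < t < T ->
  is_derive x t (1 + e * fieldA (c (sg i)) (x t) (y t)) /\ is_derive y t (e * fieldB (c (sg i)) (x t) (y t))).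
{ intros t Ht. destruct (Hbox t ltac:(lra)) as (h1 & h2 & h3).
  assert (HNt : gradN (c (sg i)) e (x t) (y t) <> 0) by (apply HN; lra).
  destruct (first_integral_flow (c (sg i)) e (x t) (y t) HNt) as [f1 f2].
  apply (near_identity_inverse_derive y0 e (xi i y1 + e * p (xi i y1) y1) (y1 + e * q (xi i y1) y1) t _ _ p q
    (gradU (c (sg i)) e) (gradV (c (sg i)) e) x y); auto.
  - apply gradU_cont, HNt.
  - apply gradV_cont, HNt.
  - lra.
  - lra.
  - exists (mkposreal (Rmin t (T - t)) ltac:(apply Rmin_glb_lt; lra)). intros s Hs.
    change (Rabs (s - t) < Rmin t (T - t)) in Hs. apply Rmin_Rgt in Hs. destruct Hs as [g1 g2].
    apply Rgt_lt in g1, g2. apply Rabs_lt_between in g1, g2.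
    destruct (Hbox s ltac:(lra)) as (k1 & k2 & k3). split; [lra|]. split; assumption. }
assert (BAB : forall t, 0 <= t <= T -> Rabs (e * fieldA (c (sg i)) (x t) (y t)) <= K * Rabs e /\
   Rabs (e * fieldB (c (sg i)) (x t) (y t)) <= K * Rabs e).
{ intros t Ht. destruct (Hbox t Ht) as (h1 & _). destruct (BK (sg i) (x t) (y t)) as [g1 g2]; [lra|].
  rewrite !Rabs_mult, !(Rmult_comm (Rabs e)). split; (apply Rmult_le_compat_r; [apply Rabs_pos|assumption]). }
assert (HKe0 : 0 <= K * Rabs e) by (destruct (BAB 0) as [h _]; [lra|]; eapply Rle_trans; [apply Rabs_pos|exact h]).
assert (Hmon : forall j, (j <= N)%nat -> forall t t', 0 <= t <= t' -> t' <= T ->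
   / 2 * (t' - t) <= (x t' - xi j (y t')) - (x t - xi j (y t))).
{ intros j Hj t t' Ht Ht'. 
  assert (Dxi : forall s, 0 <= s <= T -> exists l, is_derive (xi j) (y s) l /\ Rabs l <= L0).
  { intros s Hs. destruct (Hbox s Hs) as (h1 & _). apply (cf_der CF); [exact Hj|lra]. }
  apply (derive_ge_increment (fun t => x t - xi j (y t)) (/ 2) nil); [lra| |].
  - intros s Hs. apply (continuous_minus (V := R_NormedModule) x (fun t => xi j (y t))); [apply Cx|].
    apply (continuous_comp y (xi j)); [apply Cy|]. apply (ex_derive_continuous (xi j)).
    destruct (Dxi s) as (l & g & _); [lra|]. exists l. exact g.
  - intros s Hs _. destruct (Dxi s) as (l & g1 & g2); [lra|]. destruct (Hder s) as [g3 g4]; [lra|].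
    destruct (BAB s) as [g5 g6]; [lra|].
    exists ((1 + e * fieldA (c (sg i)) (x s) (y s)) - e * fieldB (c (sg i)) (x s) (y s) * l). split.
    + apply (is_derive_minus x (fun s => xi j (y s))); [exact g3|]. apply (is_derive_comp (xi j) y); assumption.
    + assert (Rabs (e * fieldB (c (sg i)) (x s) (y s) * l) <= K * Rabs e * L0).
      { rewrite Rabs_mult. apply Rmult_le_compat; auto using Rabs_pos. }
      apply Rabs_le_between in g5, H. lra. }
assert (Hzone : forall t, 0 < t < T -> in_zone (sg i) (polar (x t) (y t))).
{ intros t Ht. destruct (Hbox t ltac:(lra)) as (h1 & _).
  apply (cf_zone CF); [exact Hi|lra|].
  assert (g1 := Hmon i ltac:(lia) 0 t ltac:(lra) ltac:(lra)). rewrite X0, Y0 in g1.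
  assert (g2 := Hmon (S i) ltac:(lia) t T ltac:(lra) ltac:(lra)). rewrite XT, YT in g2. lra. }
exists (fun t => polar (x t) (y t)), T. split; [split|split].
- exact HT.
- intros t. apply continuous_C_iff. unfold polar. cbn [fst snd].
  assert (ce : continuous (fun s => exp (y s)) t) by (apply (continuous_comp y exp); [apply Cy|apply continuous_exp]).
  assert (cc : continuous (fun s => cos (x s)) t) by (apply (continuous_comp x cos); [apply Cx|apply continuous_cos]).
  assert (cs : continuous (fun s => sin (x s)) t) by (apply (continuous_comp x sin); [apply Cx|apply continuous_sin]).
  split.
  + apply (continuous_plus (V := R_NormedModule) (fun _ => 1) (fun s => exp (y s) * cos (x s))); [apply continuous_const|].
    apply (continuous_mult (K := R_AbsRing) (fun s => exp (y s)) (fun s => cos (x s))); assumption.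
  + apply (continuous_opp (V := R_NormedModule) (fun s => exp (y s) * sin (x s))).
    apply (continuous_mult (K := R_AbsRing) (fun s => exp (y s)) (fun s => sin (x s))); assumption.
- exists nil. intros t Ht _. destruct (Hder t Ht) as [g1 g2].
  exists (polar_push (x t) (y t) (1 + e * fieldA (c (sg i)) (x t) (y t)) (e * fieldB (c (sg i)) (x t) (y t))).
  split; [|apply filippov_in_zone, Hzone, Ht].
  apply is_derive_C_iff. unfold polar, polar_push. cbn [fst snd].
  assert (e1 : ex_derive x t) by (eexists; exact g1). assert (e2 : ex_derive y t) by (eexists; exact g2).
  assert (u1 := is_derive_unique _ _ _ g1). assert (u2 := is_derive_unique _ _ _ g2).
  split; (auto_derive; [repeat split; assumption|]);
  replace (Derive (fun x0 => x x0) t) with (1 + e * fieldA (c (sg i)) (x t) (y t)) by (symmetry; exact u1);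
  replace (Derive (fun x0 => y x0) t) with (e * fieldB (c (sg i)) (x t) (y t)) by (symmetry; exact u2); ring.
- intros t Ht. exists (x t), (y t). split; [apply Hbox, Ht|reflexivity].
(* Up to time 1 the angle advances by a positive amount of at most 3/2, less than a full turn, so
   the point has moved. *)
- set (t := Rmin T 1). assert (Ht : 0 < t /\ t <= T /\ t <= 1).
  { unfold t. split; [apply Rmin_glb_lt; lra|]. split; [apply Rmin_l|apply Rmin_r]. }
  exists t. split; [lra|]. intros h. apply polar_inj in h. destruct h as [_ [n Hn]].
  assert (Hlo : / 2 * (t - 0) <= x t - x 0).
  { apply derive_ge_increment with nil; [lra|auto|]. intros s Hs _.
    exists (1 + e * fieldA (c (sg i)) (x s) (y s)). split; [apply Hder; lra|].
    destruct (BAB s ltac:(lra)) as [g _]. apply Rabs_le_between in g.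
    assert (0 <= K * Rabs e * L0) by (apply Rmult_le_pos; lra). lra. }
  assert (Hhi : - (3 / 2) * (t - 0) <= (fun s => - x s) t - (fun s => - x s) 0).
  { apply (derive_ge_increment (fun s => - x s) (- (3 / 2)) nil); [lra| |].
    - intros s _. apply (continuous_opp x), Cx.
    - intros s Hs _. exists (- (1 + e * fieldA (c (sg i)) (x s) (y s))). split; [apply (is_derive_opp x), Hder; lra|].
      destruct (BAB s ltac:(lra)) as [g _]. apply Rabs_le_between in g.
      assert (0 <= K * Rabs e * L0) by (apply Rmult_le_pos; lra). lra. }
  assert (1 < PI) by (generalize PI2_3_2; unfold PI2; lra).
  assert (h1 : (n < 0)%Z) by (apply lt_IZR; apply Rmult_lt_reg_l with (2 * PI); lra).
  assert (h2 : (-1 < n)%Z) by (apply lt_IZR; apply Rmult_lt_reg_l with (2 * PI); lra).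
  lia.
- rewrite X0, Y0. reflexivity.
- rewrite XT, YT. reflexivity.
Qed.

Lemma positive_lower_bound (f : nat -> R) (N : nat) :
  (forall i, (i < N)%nat -> 0 < f i) -> exists g, 0 < g /\ forall i, (i < N)%nat -> g <= f i.
Proof.
induction N as [|N IH]; intros H.
- exists 1. split; [lra|]. intros i Hi. lia.
- destruct IH as (g & Hg & Hb); [intros; apply H; lia|].
  exists (Rmin g (f N)). split; [apply Rmin_glb_lt; [exact Hg|apply H; lia]|].
  intros i Hi. destruct (Nat.eq_dec i N) as [->|h]; [apply Rmin_r|].
  eapply Rle_trans; [apply Rmin_l|apply Hb; lia].
Qed.

(** A fixed point of the return map gives heights that return to their initial value after a turn;
    the corresponding arcs are concatenated and close up because the last section is the first one
    shifted by [2 PI]. *)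
Lemma periodic_orbit_exists c y0 d0 L0 N xi dxi sg :
  config y0 d0 L0 N xi dxi sg ->
  melnikov c y0 N xi sg = 0 -> melnikov' c y0 N xi dxi sg <> 0 ->
  forall del, 0 < del -> exists e1, 0 < e1 /\ forall e, 0 < Rabs e < e1 ->
    exists g, periodic_orbit (centered c e) g /\ forall w, g w -> in_tube y0 del w.
Proof.
intros CF HM HM' del Hdel.
destruct (zone_field_bounded c y0) as (K & HK & BK).
destruct (first_integral_exists c y0) as (e0 & C & He0 & HC & p & q & HFI).
destruct (return_map c y0 d0 L0 e0 C N xi dxi sg p q CF He0 HC HFI) as (F & HF & _ & HE).
rewrite HM in HF.
assert (Hd01 := cf_d CF). assert (HL0 := cf_L CF).
set (r := Rmin del d0 / 2).
assert (Hr : 0 < r /\ r < del /\ r < d0).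
{ assert (0 < Rmin del d0) by (apply Rmin_glb_lt; lra). unfold r.
  generalize (Rmin_l del d0) (Rmin_r del d0). lra. }
clearbody r.
assert (Hy0 : forall d, 0 < d -> Rabs (y0 - y0) < d) by (intros; rewrite Rminus_diag, Rabs_R0; assumption).
destruct (positive_lower_bound (fun i => xi (S i) y0 - xi i y0) N) as (gam & Hgam & Bgam).
{ intros i Hi. assert (h := cf_lt CF i y0 Hi (Hy0 d0 ltac:(lra))). lra. }
(* Heights within [rho] of [y0] leave a gap of at least [gam / 2] between consecutive sections, and
   [rho <= gam / 8] then makes the travel time of every arc positive. *)
set (rho := Rmin (r / 2) (Rmin (gam / (4 * (L0 + 1))) (gam / 8))).
assert (Hrho : 0 < rho /\ rho <= r / 2 /\ rho * (4 * (L0 + 1)) <= gam /\ rho <= gam / 8).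
{ assert (h : 0 < gam / (4 * (L0 + 1))) by (apply Rdiv_lt_0_compat; lra).
  unfold rho. split; [repeat apply Rmin_glb_lt; lra|]. split; [apply Rmin_l|].
  assert (h1 := Rmin_r (r / 2) (Rmin (gam / (4 * (L0 + 1))) (gam / 8))).
  assert (h2 := Rmin_l (gam / (4 * (L0 + 1))) (gam / 8)). assert (h3 := Rmin_r (gam / (4 * (L0 + 1))) (gam / 8)).
  split; [|lra]. apply Rle_div_r; lra. }
clearbody rho.
assert (Hxl : forall j u, (j <= N)%nat -> Rabs (u - y0) < rho -> Rabs (xi j u - xi j y0) <= L0 * rho).
{ intros j u Hj Hu.
  assert (Hd : forall t, Rmin y0 u <= t <= Rmax y0 u -> exists l, is_derive (xi j) t l /\ Rabs l <= L0).
  { intros t Ht. apply (cf_der CF); [exact Hj|].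
    apply (in_strip_between y0 d0 y0 u); [apply Hy0; lra|lra|exact Ht]. }
  destruct (MVT_gen (xi j) y0 u (Derive (xi j))) as (t & Ht & E).
  - intros t Ht. destruct (Hd t) as (l & h & _); [lra|]. rewrite (is_derive_unique _ _ _ h). exact h.
  - intros t Ht. destruct (Hd t Ht) as (l & h & _).
    apply continuity_pt_filterlim, (ex_derive_continuous (xi j)). exists l. exact h.
  - rewrite E, Rabs_mult. destruct (Hd t Ht) as (l & h & hl). rewrite (is_derive_unique _ _ _ h).
    apply Rmult_le_compat; auto using Rabs_pos. lra. }
destruct (HE rho) as (d' & e2 & Hd' & He2 & Hchain); [lra|].
destruct (near_id_fixpoint_exists y0 F _ HF HM' d' Hd') as (e3 & He3 & Hfix).
assert (HKL : 0 < 2 * K * (1 + L0)) by (apply Rmult_lt_0_compat; lra).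
exists (Rmin (Rmin e0 (Rmin e2 e3)) (Rmin (/ (2 * K * (1 + L0))) (Rmin (/ (4 * C)) (r / (200 * C))))).
split.
{ repeat apply Rmin_glb_lt; auto; try (apply Rinv_0_lt_compat; lra). apply Rdiv_lt_0_compat; lra. }
intros e [E0 He]. apply Rmin_Rgt in He. destruct He as [Ha Hb]. apply Rmin_Rgt in Ha, Hb.
destruct Ha as [E1 Ha], Hb as [E4 Hb]. apply Rmin_Rgt in Ha, Hb. destruct Ha as [E2 E3], Hb as [E5 E6].
apply Rgt_lt in E1, E2, E3, E4, E5, E6.
assert (HKe : K * Rabs e * (1 + L0) <= / 2).
{ replace (/ 2) with (K * / (2 * K * (1 + L0)) * (1 + L0)) by (field; lra).
  apply Rmult_le_compat_r; [lra|]. apply Rmult_le_compat_l; lra. }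
assert (HCe : C * Rabs e <= / 4).
{ replace (/ 4) with (C * / (4 * C)) by (field; lra). apply Rmult_le_compat_l; lra. }
assert (HCr : C * Rabs e * 100 <= r / 2).
{ replace (r / 2) with (C * (r / (200 * C)) * 100) by (field; lra).
  apply Rmult_le_compat_r; [lra|]. apply Rmult_le_compat_l; lra. }
destruct (Hfix e (conj E0 E3)) as (u & Hu & Fu).
destruct (Hchain e u (conj E0 E2) Hu) as (eta & h0 & hN & hc & hb).
rewrite Fu in hN.
assert (Harc : forall i, (i < N)%nat -> exists z T, arc (centered c e) (in_tube y0 r) z T /\
  z 0 = polar (xi i (eta i)) (eta i) /\ z T = polar (xi (S i) (eta (S i))) (eta (S i))).
{ intros i Hi. assert (hi := hb i ltac:(lia)). assert (hSi := hb (S i) ltac:(lia)).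
  assert (FI := HFI (sg i) e E1).
  apply (chain_arc c e y0 d0 L0 K C N xi dxi sg (p (sg i) e) (q (sg i) e) i r); auto; try lra.
  - apply (hc i Hi).
  - assert (l1 := Hxl i (eta i) ltac:(lia) hi). assert (l2 := Hxl (S i) (eta (S i)) ltac:(lia) hSi).
    assert (g := Bgam i Hi). apply Rabs_le_between in l1, l2.
    assert (gap : gam / 2 <= xi (S i) (eta (S i)) - xi i (eta i)) by lra.
    assert (lp := fi_lp FI (xi (S i) (eta (S i))) (eta (S i)) (xi i (eta i)) (eta i) ltac:(lra) ltac:(lra)).
    cbv beta in lp.
    assert (hyy : Rabs (eta (S i) - eta i) <= 2 * rho).
    { replace (eta (S i) - eta i) with ((eta (S i) - y0) - (eta i - y0)) by ring.
      eapply Rle_trans; [apply Rabs_triang|]. rewrite Rabs_Ropp. lra. }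
    rewrite (Rabs_right (xi (S i) (eta (S i)) - xi i (eta i))) in lp by lra.
    assert (lp2 : Rabs (e * p (sg i) e (xi (S i) (eta (S i))) (eta (S i)) - e * p (sg i) e (xi i (eta i)) (eta i))
      <= / 4 * (xi (S i) (eta (S i)) - xi i (eta i) + 2 * rho)).
    { eapply Rle_trans; [exact lp|]. apply Rmult_le_compat; try lra.
      - apply Rmult_le_pos; lra.
      - generalize (Rabs_pos (eta (S i) - eta i)). lra. }
    apply Rabs_le_between in lp2. lra. }
assert (Hall : forall n, (S n <= N)%nat -> exists z T, arc (centered c e) (in_tube y0 r) z T /\
  z 0 = polar (xi O (eta O)) (eta O) /\ z T = polar (xi (S n) (eta (S n))) (eta (S n))).
{ induction n as [|n IH]; intros Hn; [apply Harc; lia|].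
  destruct IH as (z1 & T1 & A1 & B1 & C1); [lia|]. destruct (Harc (S n)) as (z2 & T2 & A2 & B2 & C2); [lia|].
  destruct (arc_concat _ _ _ _ _ _ A1 A2) as (z & A3 & B3 & C3); [rewrite C1, B2; reflexivity|].
  exists z, (T1 + T2). split; [exact A3|]. split; [rewrite B3; exact B1|rewrite C3; exact C2]. }
assert (HN := cf_N CF).
destruct (Hall (pred N)) as (z & T & Az & Bz & Cz); [lia|].
replace (S (pred N)) with N in Cz by lia.
destruct (arc_close _ _ z T Az) as (g & Hg & Hin).
- rewrite Cz, Bz, hN, h0. assert (hu := hb O ltac:(lia)). rewrite h0 in hu.
  rewrite (cf_turn CF u) by lra. apply polar_periodic.
- exists g. split; [exact Hg|]. intros w Hw. destruct (Hin w Hw) as (x & y & Hy & ->).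
  exists x, y. split; [lra|reflexivity].
Qed.

(** * Bifurcation of limit cycles *)

Definition center_orbit (y0 : R) (w : C) : Prop := exists x, w = polar x y0.

Lemma Cmod_scal (a : C) (k r : R) : Cmod a = r -> Cmod (RtoC k * a)%C = Rabs k * r.
Proof. intros Ha. rewrite Cmod_mult, Cmod_R, Ha. reflexivity. Qed.

(** At [e = 0] the three fields agree, so one adherent zone suffices for the Filippov condition on
    the unperturbed circles. Points of S3 are approached by shrinking towards [2/3], points of S1 by
    scaling outwards. *)
Lemma some_zone_adherent (z : C) : exists s, in_closure (in_zone s) z.
Proof.
destruct (Rlt_le_dec 1 (Cmod z)) as [h|h].
{ exists Zminus. apply in_zone_in_closure. exact h. }
destruct (Rle_lt_or_eq_dec _ _ h) as [h1|h1].
- destruct (Rtotal_order (Cmod (z - RtoC (2 / 3))%C) (1 / 3)) as [g|[g|g]].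
  + exists Zplus. apply in_zone_in_closure. exact g.
  + exists Zplus. intros d Hd.
    set (k := Rmin (1 / 2) d). assert (Hk : 0 < k /\ k <= 1 / 2 /\ k <= d).
    { unfold k. split; [apply Rmin_glb_lt; lra|]. split; [apply Rmin_l|apply Rmin_r]. }
    exists (RtoC (2 / 3) + RtoC (1 - k) * (z - RtoC (2 / 3)))%C. split.
    * simpl. replace (RtoC (2 / 3) + RtoC (1 - k) * (z - RtoC (2 / 3)) - RtoC (2 / 3))%C
        with (RtoC (1 - k) * (z - RtoC (2 / 3)))%C by ring.
      rewrite (Cmod_scal _ _ (1 / 3)), Rabs_right by lra. nra.
    * replace (RtoC (2 / 3) + RtoC (1 - k) * (z - RtoC (2 / 3)) - z)%C
        with (RtoC (- k) * (z - RtoC (2 / 3)))%C by (rewrite RtoC_minus, RtoC_opp; ring).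
      rewrite (Cmod_scal _ _ (1 / 3)), Rabs_left by lra. lra.
  + exists Zcenter. apply in_zone_in_closure. split; assumption.
- exists Zminus. intros d Hd. exists (RtoC (1 + d / 2) * z)%C. split.
  + simpl. rewrite (Cmod_scal _ _ 1), Rabs_right by lra. lra.
  + replace (RtoC (1 + d / 2) * z - z)%C with (RtoC (d / 2) * z)%C by (rewrite RtoC_plus; ring).
    rewrite (Cmod_scal _ _ 1), Rabs_right by lra. lra.
Qed.

Lemma center_orbit_periodic c y0 : periodic_orbit (centered c 0) (center_orbit y0).
Proof.
assert (HP := PI_RGT_0). assert (He := exp_pos y0).
exists (fun t => polar t y0), (2 * PI). split; [lra|].
assert (Hd : forall t, is_derive (fun t => polar t y0) t (polar_push t y0 1 0)).
{ intros t. apply is_derive_C_iff. unfold polar, polar_push. cbn [fst snd].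
  split; (auto_derive; [exact I|ring]). }
split; [split|split; [|split]].
- intros t. apply continuous_C_iff. assert (h := Hd t). apply is_derive_C_iff in h.
  destruct h as [h1 h2]. split.
  + apply (ex_derive_continuous (fun s => fst (polar s y0))). eexists. exact h1.
  + apply (ex_derive_continuous (fun s => snd (polar s y0))). eexists. exact h2.
- exists (fun _ => False). split; [intros t1 t2; exists nil; intros t _ []|].
  intros t _. exists (polar_push t y0 1 0). split; [apply Hd|].
  destruct (some_zone_adherent (polar t y0)) as [s Hs].
  replace (polar_push t y0 1 0) with (centered c 0 s (polar t y0)).
  + apply filippov_closure, Hs.
  + rewrite centered_polar. f_equal; ring.
- intros t. apply polar_periodic.
- exists PI. unfold polar. rewrite cos_PI, cos_0. intros h. injection h. intros _ h'. lra.
- intros w. split; intros [x h]; exists x; congruence.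
Qed.

Lemma polar_dist x y y' : Cmod (polar x y - polar x y')%C = Rabs (exp y - exp y').
Proof.
replace (polar x y - polar x y')%C with (RtoC (exp y - exp y') * (cos x, (- sin x)%R))%C.
- rewrite Cmod_mult, Cmod_R. replace (Cmod (cos x, (- sin x)%R)) with 1; [ring|].
  unfold Cmod. simpl. replace (cos x * (cos x * 1) + - sin x * (- sin x * 1)) with (Rsqr (sin x) + Rsqr (cos x)) by (unfold Rsqr; ring).
  rewrite sin2_cos2, sqrt_1. reflexivity.
- unfold polar, Cminus, Cplus, Copp, Cmult, RtoC. apply injective_projections; simpl; ring.
Qed.

Lemma polar_exists (w : C) : 0 < Cmod (w - 1)%C -> exists x, w = polar x (ln (Cmod (w - 1)%C)).
Proof.
intros H. destruct w as [a b].
assert (E : Cmod ((a, b) - 1)%C * Cmod ((a, b) - 1)%C = (a - 1) * (a - 1) + b * b).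
{ unfold Cmod. simpl. rewrite sqrt_sqrt; [ring|].
  generalize (a + - (1)) (b + - 0). intros u v. nra. }
destruct (angle_exists (a - 1) b _ H E) as (x & _ & h1 & h2).
exists x. unfold polar. rewrite exp_ln by exact H. rewrite <- h1, <- h2. f_equal. ring.
Qed.

Lemma in_tube_open y0 d1 d : 0 < d1 < d -> exists r, 0 < r /\ forall w w',
  in_tube y0 d1 w' -> Cmod (w - w')%C < r -> in_tube y0 d w.
Proof.
intros Hd.
assert (H1 : exp (y0 - d) < exp (y0 - d1)) by (apply exp_increasing; lra).
assert (H2 : exp (y0 + d1) < exp (y0 + d)) by (apply exp_increasing; lra).
assert (P1 := exp_pos (y0 - d)).
exists (Rmin (exp (y0 - d1) - exp (y0 - d)) (exp (y0 + d) - exp (y0 + d1))).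
split; [apply Rmin_glb_lt; lra|]. intros w w' (x' & y' & Hy' & ->) Hw.
apply Rmin_Rgt in Hw. destruct Hw as [g1 g2]. apply Rabs_lt_between in Hy'.
assert (E1 : exp (y0 - d1) < exp y') by (apply exp_increasing; lra).
assert (E2 : exp y' < exp (y0 + d1)) by (apply exp_increasing; lra).
assert (M1 := Cmod_sub_le (polar x' y' - 1)%C (w - 1)%C). assert (M2 := Cmod_sub_le (w - 1)%C (polar x' y' - 1)%C).
replace (w - 1 - (polar x' y' - 1))%C with (w - polar x' y')%C in M1 by ring.
replace (polar x' y' - 1 - (w - 1))%C with (polar x' y' - w)%C in M2 by ring.
rewrite (Cmod_sub_sym (polar x' y') w) in M2. rewrite polar_Cmod in M1, M2.
set (m := Cmod (w - 1)%C) in *.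
destruct (polar_exists w) as [x Hx]; [fold m; lra|]. exists x, (ln m). split; [|exact Hx].
apply Rabs_lt_between. split.
- assert (y0 - d < ln m); [|lra]. rewrite <- (ln_exp (y0 - d)). apply ln_increasing; lra.
- assert (ln m < y0 + d); [|lra]. rewrite <- (ln_exp (y0 + d)). apply ln_increasing; lra.
Qed.

Lemma periodic_orbit_ext X g g' : same_set g g' -> periodic_orbit X g -> periodic_orbit X g'.
Proof.
intros Hs (z & T & h1 & h2 & h3 & h4 & h5). exists z, T. repeat split; auto.
- apply h2. - apply h2. - intros hw. apply h5, Hs, hw. - intros hw. apply Hs, h5, hw.
Qed.

Lemma periodic_orbit_nonempty X g : periodic_orbit X g -> exists w, g w.
Proof. intros (z & T & _ & _ & _ & _ & h). exists (z 0). apply h. exists 0. reflexivity. Qed.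

(** Existence holds in arbitrarily thin tubes and uniqueness in one fixed tube, so the orbit found
    is the same for every thinness: this gives both convergence and isolation. *)
Lemma bifurcation c y0 d0 L0 N xi dxi sg :
  config y0 d0 L0 N xi dxi sg ->
  melnikov c y0 N xi sg = 0 -> melnikov' c y0 N xi dxi sg <> 0 ->
  exists g : R -> C -> Prop,
    (exists e1, 0 < e1 /\ forall e, 0 < Rabs e < e1 -> limit_cycle (centered c e) (g e)) /\
    (forall del, 0 < del -> exists e1, 0 < e1 /\ forall e, 0 < Rabs e < e1 ->
       forall w, g e w -> in_tube y0 del w) /\
    orbits_tend_to g (center_orbit y0).
Proof.
intros CF HM HM'.
destruct (periodic_orbits_coincide c y0 d0 L0 N xi dxi sg CF HM HM') as (d & e1 & Hd & He1 & HU).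
assert (HE := periodic_orbit_exists c y0 d0 L0 N xi dxi sg CF HM HM').
assert (Hd01 := cf_d CF).
destruct (zone_field_bounded c y0) as (K & HK & BK).
(* The union of all periodic orbits in the fixed tube, defined without choice and independent of the
   thinner tubes; for small [e] it is a single orbit. *)
set (g := fun e w => exists g', periodic_orbit (centered c e) g' /\ (forall w, g' w -> in_tube y0 d w) /\ g' w).
assert (Htube : forall d1 d2 w, d1 <= d2 -> in_tube y0 d1 w -> in_tube y0 d2 w).
{ intros d1 d2 w h (x & y & h1 & h2). exists x, y. split; [lra|exact h2]. }
assert (Hg : forall del, 0 < del -> exists e2, 0 < e2 /\ forall e, 0 < Rabs e < e2 ->
  periodic_orbit (centered c e) (g e) /\ forall w, g e w -> in_tube y0 del w).
{ intros del Hdel. destruct (HE (Rmin del d)) as (e2 & He2 & B); [apply Rmin_glb_lt; lra|].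
  exists (Rmin e1 e2). split; [apply Rmin_glb_lt; lra|]. intros e [h0 he]. apply Rmin_Rgt in he.
  destruct (B e (conj h0 (proj2 he))) as (g' & P' & T').
  assert (Td : forall w, g' w -> in_tube y0 d w) by (intros w hw; apply (Htube (Rmin del d)); [apply Rmin_r|apply T', hw]).
  assert (S : same_set g' (g e)).
  { intros w. split.
    - intros hw. exists g'. auto.
    - intros (g'' & P'' & T'' & hw). apply (HU e (conj h0 (proj1 he)) g'' g'); auto. }
  split; [apply (periodic_orbit_ext _ _ _ S P')|].
  intros w hw. apply (Htube (Rmin del d)); [apply Rmin_l|]. apply T', S, hw. }
exists g. split; [|split].
- destruct (Hg (d / 2)) as (e2 & He2 & B); [lra|].
  exists (Rmin e1 e2). split; [apply Rmin_glb_lt; lra|]. intros e [h0 he]. apply Rmin_Rgt in he.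
  destruct (B e (conj h0 (proj2 he))) as [P T]. split; [exact P|].
  (* The orbit lies in the tube of half width, so every orbit close to it lies in the tube where
     uniqueness holds. *)
  destruct (in_tube_open y0 (d / 2) d) as (r & Hr & Ho); [lra|].
  exists r. split; [exact Hr|]. intros g' P' W.
  assert (T' : forall w, g' w -> in_tube y0 d w).
  { intros w hw. destruct (W w hw) as (w' & h1 & h2). apply (Ho w w'); [apply T, h1|exact h2]. }
  assert (T2 : forall w, g e w -> in_tube y0 d w) by (intros w hw; apply (Htube (d / 2)); [lra|apply T, hw]).
  intros w. split; apply (HU e (conj h0 (proj1 he))); assumption.
- intros del Hdel. destruct (Hg del Hdel) as (e2 & He2 & B). exists e2. split; [exact He2|].
  intros e he. apply B, he.
- intros del Hdel.
  destruct (proj1 (filterlim_locally exp (exp y0)) (continuous_exp y0) (mkposreal del Hdel)) as [d1 Hd1].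
  assert (Hexp : forall y, Rabs (y - y0) < d1 -> Rabs (exp y - exp y0) < del) by (intros y hy; apply Hd1, hy).
  destruct (Hg (Rmin d1 d0)) as (e2 & He2 & B); [apply Rmin_glb_lt; [apply cond_pos|lra]|].
  exists (Rmin e2 (/ (2 * K))). split; [apply Rmin_glb_lt; [exact He2|apply Rinv_0_lt_compat; lra]|].
  intros e [h0 he]. apply Rmin_Rgt in he. destruct he as [he1 he2]. apply Rgt_lt in he1, he2.
  destruct (B e (conj h0 he1)) as [P T].
  assert (Hmin : forall y, Rabs (y - y0) < Rmin d1 d0 -> Rabs (y - y0) < d1).
  { intros y hy. eapply Rlt_le_trans; [exact hy|apply Rmin_l]. }
  split.
  + intros w hw. destruct (T w hw) as (x & y & hy & ->). exists (polar x y0).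
    split; [exists x; reflexivity|]. rewrite polar_dist. apply Hexp, Hmin, hy.
  + intros w [x ->].
    destruct (periodic_orbit_lift c e y0 (Rmin d1 d0) K (g e)) as (z & xx & yy & T0 & HO); auto.
    { split; [apply Rmin_glb_lt; [apply cond_pos|lra]|]. eapply Rle_trans; [apply Rmin_r|lra]. }
    destruct (lifted_orbit_angle _ _ _ _ _ _ _ _ _ _ x HO) as (y1 & hy & hg).
    { replace (/ 2) with (K * / (2 * K)) by (field; lra). apply Rmult_le_compat_l; lra. }
    exists (polar x y1). split; [exact hg|]. rewrite polar_dist, Rabs_minus_sym. apply Hexp, Hmin, hy.
Qed.

Lemma separation (ys : nat -> R) (n : nat) :
  (forall j k, (j < n)%nat -> (k < n)%nat -> j <> k -> ys j <> ys k) ->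
  exists eta, 0 < eta /\ forall j k, (j < n)%nat -> (k < n)%nat -> j <> k -> eta <= Rabs (ys j - ys k).
Proof.
intros H.
assert (Hj : forall j, exists f, (j < n)%nat -> 0 < f /\ forall k, (k < n)%nat -> j <> k -> f <= Rabs (ys j - ys k)).
{ intros j. destruct (Nat.lt_ge_cases j n) as [hj|hj]; [|exists 1; intros; lia].
  destruct (positive_lower_bound (fun k => if Nat.eq_dec j k then 1 else Rabs (ys j - ys k)) n) as (f & Hf & Bf).
  - intros k hk. destruct (Nat.eq_dec j k) as [h|h]; [lra|]. apply Rabs_pos_lt.
    generalize (H j k hj hk h). lra.
  - exists f. intros _. split; [exact Hf|]. intros k hk h. generalize (Bf k hk).
    destruct (Nat.eq_dec j k); [contradiction|auto]. }
destruct (choice _ Hj) as [f Hf].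
destruct (positive_lower_bound f n) as (eta & Heta & B); [intros i Hi; apply Hf, Hi|].
exists eta. split; [exact Heta|]. intros j k hj hk h. eapply Rle_trans; [apply B, hj|].
apply (proj2 (Hf j hj)); assumption.
Qed.

(** Distinct zeros are at least [eta] apart and each cycle is confined to a tube of half width
    [eta / 2]; the tubes are disjoint, so the cycles are distinct. *)
Lemma limit_cycles_from_zeros c (P : (C -> Prop) -> Prop) n (ys : nat -> R) :
  (forall k, (k < n)%nat -> P (center_orbit (ys k)) /\
     exists d0 L0 N xi dxi sg, config (ys k) d0 L0 N xi dxi sg /\
       melnikov c (ys k) N xi sg = 0 /\ melnikov' c (ys k) N xi dxi sg <> 0) ->
  (forall j k, (j < n)%nat -> (k < n)%nat -> j <> k -> ys j <> ys k) ->
  limit_cycles_bifurcate (centered c) P n.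
Proof.
intros H Hne. destruct (separation ys n Hne) as (eta & Heta & Hsep).
assert (Hex : forall k, exists ge : (R -> C -> Prop) * R, (k < n)%nat ->
  0 < snd ge /\ orbits_tend_to (fst ge) (center_orbit (ys k)) /\
  forall e, 0 < Rabs e < snd ge -> limit_cycle (centered c e) (fst ge e) /\
    forall w, fst ge e w -> in_tube (ys k) (eta / 2) w).
{ intros k. destruct (Nat.lt_ge_cases k n) as [hk|hk].
  2:{ exists ((fun _ _ => True), 0). intros; lia. }
  destruct (H k hk) as (_ & d0 & L0 & N & xi & dxi & sg & CF & M0 & M1).
  destruct (bifurcation c (ys k) d0 L0 N xi dxi sg CF M0 M1) as (g & (e1 & He1 & B1) & B2 & B3).
  destruct (B2 (eta / 2)) as (e2 & He2 & B4); [lra|].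
  exists (g, Rmin e1 e2). intros _. simpl. split; [apply Rmin_glb_lt; lra|]. split; [exact B3|].
  intros e [h0 he]. apply Rmin_Rgt in he. split; [apply B1|apply B4]; split; lra. }
destruct (choice _ Hex) as [ge Hge].
destruct (positive_lower_bound (fun k => snd (ge k)) n) as (e0 & He0 & B).
{ intros k hk. apply Hge, hk. }
exists (fun k => center_orbit (ys k)), (fun k => fst (ge k)), e0. split; [exact He0|]. split.
- intros k hk. split; [apply center_orbit_periodic|]. split; [apply H, hk|apply Hge, hk].
- intros e he.
  assert (Hek : forall k, (k < n)%nat -> 0 < Rabs e < snd (ge k)).
  { intros k hk. generalize (B k hk). lra. }
  split.
  + intros k hk. apply (proj2 (proj2 (Hge k hk)) e (Hek k hk)).
  + intros j k hj hk hjk S.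
    destruct (proj2 (proj2 (Hge j hj)) e (Hek j hj)) as [Lj Tj].
    destruct (proj2 (proj2 (Hge k hk)) e (Hek k hk)) as [_ Tk].
    destruct (periodic_orbit_nonempty _ _ (proj1 Lj)) as [w hw].
    destruct (Tj w hw) as (x1 & y1 & h1 & E1). destruct (Tk w (proj1 (S w) hw)) as (x2 & y2 & h2 & E2).
    rewrite E1 in E2. apply polar_inj in E2. destruct E2 as [<- _].
    assert (g := Hsep j k hj hk hjk).
    replace (ys j - ys k) with ((y1 - ys k) - (y1 - ys j)) in g by ring.
    generalize (Rabs_triang (y1 - ys k) (- (y1 - ys j))). rewrite Rabs_Ropp. unfold Rminus in g at 1. lra.
Qed.

(** * The crossing curves *)

(* [|1 + exp (y - i x)| = 1] at [cos x = - exp y / 2], and S3 is met at [cos x = - 3 exp y / 2]. *)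
Definition crossing (k y : R) : R := acos (- (k * exp y)).
Definition crossing' (k y : R) : R := k * exp y / sqrt (1 - (k * exp y)²).

Lemma crossing_derive k y : 0 < k -> k * exp y < 1 -> is_derive (crossing k) y (crossing' k y).
Proof.
intros Hk Hy. assert (He := exp_pos y). assert (Hke : 0 < k * exp y) by (apply Rmult_lt_0_compat; lra).
apply is_derive_Reals. unfold crossing, crossing'.
replace (k * exp y / sqrt (1 - (k * exp y)²)) with ((- / sqrt (1 - (- (k * exp y))²)) * (- (k * exp y))).
- apply (derivable_pt_lim_comp (fun t => - (k * exp t)) acos).
  + apply is_derive_Reals. auto_derive; [exact I|ring].
  + replace (- / sqrt (1 - (- (k * exp y))²)) with (- (1 / sqrt (1 - (- (k * exp y))²))) by (unfold Rdiv; ring).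
    replace (- (1 / sqrt (1 - (- (k * exp y))²))) with (- 1 / sqrt (1 - (- (k * exp y))²)) by (unfold Rdiv; ring).
    assert (hx : -1 < - (k * exp y) < 1) by lra.
    apply (derive_pt_eq_1 acos _ _ (derivable_pt_acos _ hx)), derive_pt_acos.
- rewrite <- Rsqr_neg. unfold Rdiv. ring.
Qed.

Lemma crossing_cos k y : 0 < k -> k * exp y < 1 -> cos (crossing k y) = - (k * exp y).
Proof.
intros Hk Hy. assert (He := exp_pos y). assert (Hke : 0 < k * exp y) by (apply Rmult_lt_0_compat; lra).
apply cos_acos. lra.
Qed.

Lemma crossing_sin k y : 0 < k -> k * exp y < 1 -> sin (crossing k y) = sqrt (1 - (k * exp y)²).
Proof.
intros Hk Hy. assert (He := exp_pos y). assert (Hke : 0 < k * exp y) by (apply Rmult_lt_0_compat; lra).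
unfold crossing. rewrite sin_acos by lra. rewrite <- Rsqr_neg. reflexivity.
Qed.

Lemma crossing_range k y : 0 < k -> k * exp y < 1 -> PI / 2 < crossing k y < PI.
Proof.
intros Hk Hy. assert (He := exp_pos y). assert (Hke : 0 < k * exp y) by (apply Rmult_lt_0_compat; lra).
assert (HP := PI_RGT_0). assert (B := acos_bound (- (k * exp y))). fold (crossing k y) in B.
assert (HC := crossing_cos k y Hk Hy).
split.
- apply Rnot_le_lt. intros h. assert (0 <= cos (crossing k y)) by (apply cos_ge_0; lra). lra.
- destruct B as [_ [h|h]]; [exact h|]. rewrite h, cos_PI in HC. lra.
Qed.

Lemma crossing_lt k k' y : 0 < k < k' -> k' * exp y < 1 -> crossing k y < crossing k' y.
Proof.
intros Hk Hy. assert (He := exp_pos y). assert (Hkk : k * exp y < k' * exp y) by (apply Rmult_lt_compat_r; lra).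
assert (B1 := crossing_range k y ltac:(lra) ltac:(lra)). assert (B2 := crossing_range k' y ltac:(lra) Hy).
assert (HP := PI_RGT_0).
apply cos_decreasing_0; try lra. rewrite !crossing_cos by lra. lra.
Qed.

Lemma Cmod_polar_sqr x y : Cmod (polar x y) * Cmod (polar x y) = 1 + exp y * (exp y + 2 * cos x).
Proof.
unfold Cmod, polar. cbn [fst snd]. rewrite sqrt_sqrt by (apply Rplus_le_le_0_compat; apply pow2_ge_0). assert (h := sin2_cos2 x). unfold Rsqr in h.
transitivity (1 + 2 * exp y * cos x + exp y * exp y * (sin x * sin x + cos x * cos x)); [simpl; ring|rewrite h; ring].
Qed.

Lemma Cmod_polar_S3_sqr x y :
  Cmod (polar x y - RtoC (2 / 3))%C * Cmod (polar x y - RtoC (2 / 3))%C = 1 / 9 + exp y * (exp y + 2 / 3 * cos x).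
Proof.
unfold Cmod. rewrite sqrt_sqrt by (apply Rplus_le_le_0_compat; apply pow2_ge_0). unfold polar, Cminus, Cplus, Copp, RtoC. cbn [fst snd].
assert (h := sin2_cos2 x). unfold Rsqr in h.
transitivity (1 / 9 + 2 / 3 * exp y * cos x + exp y * exp y * (sin x * sin x + cos x * cos x)); [simpl; field|rewrite h; ring].
Qed.

Lemma sqr_lt_iff (a b : R) : 0 <= a -> 0 <= b -> a * a < b * b -> a < b.
Proof. intros. nra. Qed.

Lemma polar_outside_S1 x y : - (exp y) < 2 * cos x -> 1 < Cmod (polar x y).
Proof.
intros H. apply sqr_lt_iff; [lra|apply Cmod_ge_0|]. rewrite Cmod_polar_sqr.
assert (0 < exp y * (exp y + 2 * cos x)) by (apply Rmult_lt_0_compat; [apply exp_pos|lra]). lra.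
Qed.

Lemma polar_inside_S1 x y : 2 * cos x < - (exp y) -> Cmod (polar x y) < 1.
Proof.
intros H. apply sqr_lt_iff; [apply Cmod_ge_0|lra|]. rewrite Cmod_polar_sqr.
assert (0 < exp y * - (exp y + 2 * cos x)) by (apply Rmult_lt_0_compat; [apply exp_pos|lra]). lra.
Qed.

Lemma polar_outside_S3 x y : - (exp y) < 2 / 3 * cos x -> 1 / 3 < Cmod (polar x y - RtoC (2 / 3))%C.
Proof.
intros H. apply sqr_lt_iff; [lra|apply Cmod_ge_0|]. rewrite Cmod_polar_S3_sqr.
assert (0 < exp y * (exp y + 2 / 3 * cos x)) by (apply Rmult_lt_0_compat; [apply exp_pos|lra]). lra.
Qed.

Lemma polar_inside_S3 x y : 2 / 3 * cos x < - (exp y) -> Cmod (polar x y - RtoC (2 / 3))%C < 1 / 3.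
Proof.
intros H. apply sqr_lt_iff; [apply Cmod_ge_0|lra|]. rewrite Cmod_polar_S3_sqr.
assert (0 < exp y * - (exp y + 2 / 3 * cos x)) by (apply Rmult_lt_0_compat; [apply exp_pos|lra]). lra.
Qed.

Lemma cos_gt_crossing k u y : 0 < k -> k * exp y < 1 -> Rabs u < crossing k y -> - (k * exp y) < cos u.
Proof.
intros Hk Hy Hu. assert (B := crossing_range k y Hk Hy). rewrite <- (crossing_cos k y Hk Hy).
assert (HP := PI_RGT_0). destruct (Rle_dec 0 u) as [h|h].
- rewrite Rabs_right in Hu by lra. apply cos_decreasing_1; lra.
- rewrite Rabs_left in Hu by lra. rewrite <- (cos_neg u). apply cos_decreasing_1; lra.
Qed.

Lemma cos_lt_crossing k u y : 0 < k -> k * exp y < 1 -> crossing k y < u -> u < 2 * PI - crossing k y ->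
  cos u < - (k * exp y).
Proof.
intros Hk Hy H1 H2. assert (B := crossing_range k y Hk Hy). rewrite <- (crossing_cos k y Hk Hy).
assert (HP := PI_RGT_0). destruct (Rle_dec u PI) as [h|h].
- apply cos_decreasing_1; lra.
- replace (cos u) with (cos (2 * PI - u)).
  + apply cos_decreasing_1; lra.
  + rewrite cos_minus, cos_2PI, sin_2PI. ring.
Qed.

Lemma cos_minus_2PI x : cos (x - 2 * PI) = cos x.
Proof. rewrite cos_minus, cos_2PI, sin_2PI. ring. Qed.

Lemma continuous_crossing' k y : 0 < k -> k * exp y < 1 -> continuity_pt (crossing' k) y.
Proof.
intros Hk Hy. assert (He := exp_pos y). assert (Hke : 0 < k * exp y) by (apply Rmult_lt_0_compat; lra).
apply continuity_pt_filterlim. apply (ex_derive_continuous (crossing' k)). unfold crossing'.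
assert (0 < 1 - (k * exp y)²) by (unfold Rsqr; nra).
auto_derive. unfold Rsqr in *. split; [lra|]. split; [|exact I]. apply Rgt_not_eq, sqrt_lt_R0.
unfold Rminus in *. lra.
Qed.

Definition branch (a s k y : R) : R := a + s * crossing k y.

Lemma branch_strip (k y0 : R) : 0 < k -> k * exp y0 < 1 ->
  exists d L, 0 < d <= 1 /\ 0 <= L /\ forall y, Rabs (y - y0) < d ->
    k * exp y < 1 /\ Rabs (crossing' k y) <= L.
Proof.
intros Hk Hy.
destruct (continuous_crossing' k y0 Hk Hy 1 Rlt_0_1) as (d1 & Hd1 & B1).
assert (Hc : continuity_pt (fun y => k * exp y) y0).
{ apply continuity_pt_filterlim, (ex_derive_continuous (fun y => k * exp y)). auto_derive. exact I. }
destruct (Hc (1 - k * exp y0)) as (d2 & Hd2 & B2); [lra|].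
exists (Rmin 1 (Rmin d1 d2)), (Rabs (crossing' k y0) + 1).
split; [split; [repeat apply Rmin_glb_lt; lra|apply Rmin_l]|].
split; [generalize (Rabs_pos (crossing' k y0)); lra|]. intros y Hyy.
apply Rmin_Rgt in Hyy. destruct Hyy as [_ Hyy]. apply Rmin_Rgt in Hyy. destruct Hyy as [g1 g2].
destruct (Req_dec y y0) as [->|Hne]; [split; [exact Hy|lra]|].
split.
- assert (h := B2 y (conj (conj I (not_eq_sym Hne)) g2)).
  change (Rabs (k * exp y - k * exp y0) < 1 - k * exp y0) in h. apply Rabs_lt_between in h. lra.
- assert (h := B1 y (conj (conj I (not_eq_sym Hne)) g1)).
  change (Rabs (crossing' k y - crossing' k y0) < 1) in h.
  replace (crossing' k y) with ((crossing' k y - crossing' k y0) + crossing' k y0) by ring.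
  eapply Rle_trans; [apply Rabs_triang|]. lra.
Qed.

Lemma branch_derive a s k y : 0 < k -> k * exp y < 1 -> is_derive (branch a s k) y (s * crossing' k y).
Proof.
intros Hk Hy. unfold branch. rewrite <- (Rplus_0_l (s * crossing' k y)).
apply (is_derive_plus (fun _ => a) (fun t => s * crossing k t)); [apply (is_derive_const (V := R_NormedModule))|].
apply (is_derive_scal (crossing k)), crossing_derive; assumption.
Qed.

Lemma branch_strict a s k y0 : 0 < k -> k * exp y0 < 1 -> strict_derive (branch a s k) y0 (s * crossing' k y0).
Proof.
intros Hk Hy. destruct (branch_strip k y0 Hk Hy) as (d & L & Hd & _ & B).
apply (strict_derive_C1 (branch a s k) (fun y => s * crossing' k y) y0 d); [lra| |].
- intros t Ht. apply branch_derive; [exact Hk|apply B, Ht].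
- apply (continuity_pt_mult (fun _ => s)); [apply continuity_pt_const; intros ? ?; reflexivity|].
  apply continuous_crossing'; assumption.
Qed.

Lemma Rabs_m1 : Rabs (-1) = 1.
Proof. rewrite Rabs_left; lra. Qed.

(* The orbit leaves the unit disk at [2 PI - crossing (1/2)] and reenters it at [2 PI + crossing (1/2)]. *)
Definition xi_S1 (i : nat) : R -> R :=
  match i with
  | 0%nat => branch (2 * PI) (- 1) (1 / 2)
  | 1%nat => branch (2 * PI) 1 (1 / 2)
  | _ => branch (4 * PI) (- 1) (1 / 2)
  end.
Definition dxi_S1 (y0 : R) (i : nat) : R :=
  match i with 0%nat => - 1 * crossing' (1 / 2) y0 | 1%nat => 1 * crossing' (1 / 2) y0 | _ => - 1 * crossing' (1 / 2) y0 end.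
Definition sg_S1 (i : nat) : zone := match i with 0%nat => Zminus | _ => Zcenter end.

(** Beyond radius 2/3 the circle around 1 misses S3, and below 2 it crosses S1. The curves stay
    below 16 because [PI <= 4]. *)
Lemma config_S1 y0 : 2 / 3 < exp y0 < 2 ->
  exists d0 L0, config y0 d0 L0 2 xi_S1 (dxi_S1 y0) sg_S1.
Proof.
intros Hy. destruct (branch_strip (1 / 2) y0) as (d1 & L & Hd1 & HL & B); [lra|lra|].
destruct (proj1 (filterlim_locally exp (exp y0)) (continuous_exp y0) (mkposreal (exp y0 - 2 / 3) ltac:(lra))) as [d2 Hd2].
assert (P := PI_RGT_0). assert (P4 := PI_4).
set (d := Rmin d1 d2).
assert (Hd : 0 < d /\ d <= d1 /\ d <= d2).
{ unfold d. split; [apply Rmin_glb_lt; [lra|apply cond_pos]|]. split; [apply Rmin_l|apply Rmin_r]. }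
clearbody d.
assert (Hb : forall y, Rabs (y - y0) < d -> 1 / 2 * exp y < 1 /\ Rabs (crossing' (1 / 2) y) <= L /\ 2 / 3 < exp y /\ PI / 2 < crossing (1 / 2) y < PI).
{ intros y hy. destruct (B y ltac:(lra)) as [h1 h2]. assert (h3 := Hd2 y (Rlt_le_trans _ _ _ hy (proj2 (proj2 Hd)))).
  change (Rabs (exp y - exp y0) < exp y0 - 2 / 3) in h3. apply Rabs_lt_between in h3.
  split; [exact h1|]. split; [exact h2|]. split; [lra|]. apply crossing_range; lra. }
exists d, L. split.
- lia.
- lra.
- exact HL.
- intros i y Hi hy. destruct (Hb y hy) as (h1 & h2 & _).
  destruct i as [|[|i]]; simpl; eexists; (split; [apply branch_derive; lra|]);
  rewrite Rabs_mult, ?Rabs_R1, ?Rabs_m1, Rmult_1_l; exact h2.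
- intros i Hi. destruct i as [|[|i]]; simpl; apply branch_strict; lra.
- intros i y Hi hy. destruct (Hb y hy) as (h1 & h2 & h3 & h4).
  destruct i as [|[|i]]; simpl; unfold branch; try lra. lia.
- intros y hy. simpl. unfold branch. ring.
- intros i y Hi hy. destruct (Hb y hy) as (h1 & h2 & h3 & h4).
  destruct i as [|[|i]]; simpl; unfold branch; lra.
- intros i x y Hi hy Hx. destruct (Hb y hy) as (h1 & h2 & h3 & h4). assert (He := exp_pos y).
  destruct i as [|[|i]]; simpl in *; unfold branch in Hx; [| |lia].
  + apply polar_outside_S1. rewrite <- cos_minus_2PI.
    assert (g := cos_gt_crossing (1 / 2) (x - 2 * PI) y ltac:(lra) h1 ltac:(apply Rabs_lt_between; lra)). lra.
  + assert (g := cos_lt_crossing (1 / 2) (x - 2 * PI) y ltac:(lra) h1 ltac:(lra) ltac:(lra)).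
    rewrite cos_minus_2PI in g. split.
    * apply polar_outside_S3. assert (b := COS_bound x). lra.
    * apply polar_inside_S1. lra.
Qed.

(** Starting at the exit from the unit disk, the orbit reenters it, enters S3, leaves S3 and leaves
    the unit disk again. *)
Definition xi_S13 (i : nat) : R -> R :=
  match i with
  | 0%nat => branch (2 * PI) (- 1) (1 / 2)
  | 1%nat => branch (2 * PI) 1 (1 / 2)
  | 2%nat => branch (2 * PI) 1 (3 / 2)
  | 3%nat => branch (4 * PI) (- 1) (3 / 2)
  | _ => branch (4 * PI) (- 1) (1 / 2)
  end.
Definition dxi_S13 (y0 : R) (i : nat) : R :=
  match i with
  | 0%nat => - 1 * crossing' (1 / 2) y0
  | 1%nat => 1 * crossing' (1 / 2) y0
  | 2%nat => 1 * crossing' (3 / 2) y0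
  | 3%nat => - 1 * crossing' (3 / 2) y0
  | _ => - 1 * crossing' (1 / 2) y0
  end.
Definition sg_S13 (i : nat) : zone :=
  match i with 0%nat => Zminus | 2%nat => Zplus | _ => Zcenter end.

Lemma config_S13 y0 : exp y0 < 2 / 3 ->
  exists d0 L0, config y0 d0 L0 4 xi_S13 (dxi_S13 y0) sg_S13.
Proof.
intros Hy. assert (He0 := exp_pos y0).
destruct (branch_strip (1 / 2) y0) as (d1 & L1 & Hd1 & HL1 & B1); [lra|lra|].
destruct (branch_strip (3 / 2) y0) as (d2 & L2 & Hd2 & HL2 & B2); [lra|lra|].
assert (P := PI_RGT_0). assert (P4 := PI_4).
set (d := Rmin d1 d2).
assert (Hd : 0 < d /\ d <= d1 /\ d <= d2).
{ unfold d. split; [apply Rmin_glb_lt; lra|]. split; [apply Rmin_l|apply Rmin_r]. }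
clearbody d.
assert (Hb : forall y, Rabs (y - y0) < d -> 1 / 2 * exp y < 1 /\ 3 / 2 * exp y < 1 /\
   Rabs (crossing' (1 / 2) y) <= L1 + L2 /\ Rabs (crossing' (3 / 2) y) <= L1 + L2 /\
   PI / 2 < crossing (1 / 2) y /\ crossing (1 / 2) y < crossing (3 / 2) y /\ crossing (3 / 2) y < PI).
{ intros y hy. destruct (B1 y ltac:(lra)) as [h1 h2]. destruct (B2 y ltac:(lra)) as [h3 h4].
  assert (g1 := crossing_range (1 / 2) y ltac:(lra) h1). assert (g2 := crossing_range (3 / 2) y ltac:(lra) h3).
  assert (g3 := crossing_lt (1 / 2) (3 / 2) y ltac:(lra) h3). repeat split; lra. }
exists d, (L1 + L2). split.
- lia.
- lra.
- lra.
- intros i y Hi hy. destruct (Hb y hy) as (h1 & h2 & h3 & h4 & _).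
  destruct i as [|[|[|[|i]]]]; simpl; eexists; (split; [apply branch_derive; lra|]);
  rewrite Rabs_mult, ?Rabs_R1, ?Rabs_m1, Rmult_1_l; assumption.
- intros i Hi. destruct i as [|[|[|[|i]]]]; simpl; apply branch_strict; lra.
- intros i y Hi hy. destruct (Hb y hy) as (h1 & h2 & h3 & h4 & h5 & h6 & h7).
  destruct i as [|[|[|[|i]]]]; simpl; unfold branch; try lra. lia.
- intros y hy. simpl. unfold branch. ring.
- intros i y Hi hy. destruct (Hb y hy) as (h1 & h2 & h3 & h4 & h5 & h6 & h7).
  destruct i as [|[|[|[|i]]]]; simpl; unfold branch; lra.
- intros i x y Hi hy Hx. destruct (Hb y hy) as (h1 & h2 & h3 & h4 & h5 & h6 & h7). assert (He := exp_pos y).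
  destruct i as [|[|[|[|i]]]]; simpl in *; unfold branch in Hx; [| | | |lia].
  + apply polar_outside_S1. rewrite <- cos_minus_2PI.
    assert (g := cos_gt_crossing (1 / 2) (x - 2 * PI) y ltac:(lra) h1 ltac:(apply Rabs_lt_between; lra)). lra.
  + assert (g := cos_lt_crossing (1 / 2) (x - 2 * PI) y ltac:(lra) h1 ltac:(lra) ltac:(lra)).
    assert (g' := cos_gt_crossing (3 / 2) (x - 2 * PI) y ltac:(lra) h2 ltac:(apply Rabs_lt_between; lra)).
    rewrite cos_minus_2PI in g, g'. split; [apply polar_outside_S3|apply polar_inside_S1]; lra.
  + assert (g := cos_lt_crossing (3 / 2) (x - 2 * PI) y ltac:(lra) h2 ltac:(lra) ltac:(lra)).
    rewrite cos_minus_2PI in g. apply polar_inside_S3. lra.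
  + assert (g := cos_lt_crossing (1 / 2) (x - 2 * PI) y ltac:(lra) h1 ltac:(lra) ltac:(lra)).
    (* On this last arc the angle is measured from [4 PI], so a second full turn is removed before
       comparing cosines. *)
    assert (g' := cos_gt_crossing (3 / 2) (x - 2 * PI - 2 * PI) y ltac:(lra) h2 ltac:(apply Rabs_lt_between; lra)).
    rewrite !cos_minus_2PI in g'. rewrite cos_minus_2PI in g. split; [apply polar_outside_S3|apply polar_inside_S1]; lra.
Qed.

Lemma crosses_only_S1_orbit y0 : 2 / 3 < exp y0 < 2 -> crosses_only_S1 (center_orbit y0).
Proof.
intros Hy. split; [split|].
- exists (polar PI y0). split; [exists PI; reflexivity|]. apply polar_inside_S1. rewrite cos_PI. lra.
- exists (polar 0 y0). split; [exists 0; reflexivity|]. apply polar_outside_S1. rewrite cos_0. lra.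
- intros z [x ->] H. unfold S3 in H.
  assert (h := polar_outside_S3 x y0). assert (b := COS_bound x). lra.
Qed.

Lemma crosses_S1_and_S3_orbit y0 : exp y0 < 2 / 3 -> crosses_S1_and_S3 (center_orbit y0).
Proof.
intros Hy. assert (He := exp_pos y0). split; split.
- exists (polar PI y0). split; [exists PI; reflexivity|]. apply polar_inside_S1. rewrite cos_PI. lra.
- exists (polar 0 y0). split; [exists 0; reflexivity|]. apply polar_outside_S1. rewrite cos_0. lra.
- exists (polar PI y0). split; [exists PI; reflexivity|]. apply polar_inside_S3. rewrite cos_PI. lra.
- exists (polar 0 y0). split; [exists 0; reflexivity|]. apply polar_outside_S3. rewrite cos_0. lra.
Qed.

(** * The Melnikov function *)

Lemma kappa_along_derive c (X : R -> R) (y dX : R) :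
  is_derive X y dX ->
  is_derive (fun t => kappa c (X t) t) y (fieldB c (X y) y * dX + fieldA c (X y) y).
Proof.
intros H. rewrite <- (Rmult_1_r (fieldA c (X y) y)).
apply (gradient_chain y 1 (kappa c) (fieldB c) (fieldA c) X (fun t => t) y dX 1).
- intros a b _. split; [apply kappa_dx|apply kappa_dy].
- rewrite Rminus_diag, Rabs_R0. lra.
- apply fieldB_cont.
- exact H.
- apply (is_derive_id (K := R_AbsRing)).
Qed.

Lemma melnikov_derive c y0 N xi dxi sg :
  (forall i, (i <= N)%nat -> is_derive (xi i) y0 (dxi i)) ->
  is_derive (fun y => melnikov c y N xi sg) y0 (melnikov' c y0 N xi dxi sg).
Proof.
induction N as [|N IH]; intros H; unfold melnikov, melnikov'; simpl.
- apply (is_derive_const (V := R_NormedModule)).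
- apply (is_derive_plus (fun y => melnikov c y N xi sg)); [apply IH; intros; apply H; lia|].
  apply (is_derive_minus (fun y => kappa (c (sg N)) (xi (S N) y) y)); apply kappa_along_derive, H; lia.
Qed.

(* Adding [g] to every linear coefficient rotates all three fields alike. *)
Definition rotated (c : zone -> nat -> R) (g : R) (s : zone) (m : nat) : R :=
  c s m + match m with 1%nat => g | _ => 0 end.

(** The linear coefficient enters [kappa] through a multiple of [x], so a common increment
    telescopes; over a full turn it contributes the constant [2 PI g]. *)
Lemma melnikov_rotated c g y N xi sg :
  melnikov (rotated c g) y N xi sg = melnikov c y N xi sg + g * (xi N y - xi O y).
Proof.
unfold melnikov. induction N as [|N IH]; simpl; [ring|].
rewrite IH. unfold kappa, rotated. ring.
Qed.

Lemma melnikov'_rotated c g y N xi dxi sg :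
  melnikov' (rotated c g) y N xi dxi sg = melnikov' c y N xi dxi sg + g * (dxi N - dxi O).
Proof.
unfold melnikov'. induction N as [|N IH]; simpl; [ring|].
rewrite IH. unfold fieldA, fieldB, rotated. ring.
Qed.

Lemma kappa_2PI_plus c x y : kappa c (2 * PI + x) y = kappa c x y + 2 * PI * c 1%nat.
Proof. unfold kappa. rewrite sin_plus, cos_plus, sin_2PI, cos_2PI. ring. Qed.

Lemma kappa_opp c x y : kappa c (- x) y = - kappa c x y.
Proof. unfold kappa. rewrite sin_neg, cos_neg. ring. Qed.

Lemma kappa_branch c k y :
  kappa c (branch (2 * PI) 1 k y) y = kappa c (crossing k y) y + 2 * PI * c 1%nat /\
  kappa c (branch (2 * PI) (-1) k y) y = - kappa c (crossing k y) y + 2 * PI * c 1%nat /\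
  kappa c (branch (4 * PI) (-1) k y) y = - kappa c (crossing k y) y + 4 * PI * c 1%nat.
Proof.
unfold branch. split; [|split].
- rewrite Rmult_1_l. apply kappa_2PI_plus.
- replace (-1 * crossing k y) with (- crossing k y) by ring. rewrite kappa_2PI_plus, kappa_opp. reflexivity.
- replace (4 * PI + -1 * crossing k y) with (2 * PI + (2 * PI + - crossing k y)) by ring.
  rewrite !kappa_2PI_plus, kappa_opp. ring.
Qed.

(** With a vanishing middle field, before rotation, the contributions of S1 and S3 decouple: [cm]
    acts only through [crossing (1/2)] and [cp] only through [crossing (3/2)]. *)
Definition zone_coef (cm cp : nat -> R) (s : zone) : nat -> R :=
  match s with Zminus => cm | Zplus => cp | Zcenter => fun _ => 0 end.

Lemma kappa_zero x y : kappa (fun _ => 0) x y = 0.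
Proof. unfold kappa. ring. Qed.

Lemma melnikov_S1 cm cp y :
  melnikov (zone_coef cm cp) y 2 xi_S1 sg_S1 = 2 * kappa cm (crossing (1 / 2) y) y.
Proof.
unfold melnikov. simpl. rewrite !kappa_zero.
destruct (kappa_branch cm (1 / 2) y) as (h1 & h2 & _). rewrite h1, h2. ring.
Qed.

Lemma melnikov_S13 cm cp y :
  melnikov (zone_coef cm cp) y 4 xi_S13 sg_S13 =
  2 * kappa cm (crossing (1 / 2) y) y - 2 * kappa cp (crossing (3 / 2) y) y + 2 * PI * cp 1%nat.
Proof.
unfold melnikov. simpl. rewrite !kappa_zero.
destruct (kappa_branch cm (1 / 2) y) as (h1 & h2 & _). destruct (kappa_branch cp (3 / 2) y) as (h3 & _ & h5).
rewrite h1, h2, h3, h5. ring.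
Qed.

Definition cubic (P : nat -> R) (u : R) : R := P 0%nat + P 1%nat * u + P 2%nat * (u * u) + P 3%nat * (u * u * u).

(* The coefficients for which [kappa] along [crossing k] has derivative [cubic P (r^2) / (r sqrt (1 - (k r)^2))], [r = exp y]. *)
Definition cubic_coef (k : R) (P : nat -> R) (m : nat) : R :=
  let c3 := P 3%nat / (4 * (k * k * k)) in
  let c2 := - (P 2%nat + 3 * k * c3) / (2 * (k * k)) in
  match m with
  | 0%nat => - P 0%nat
  | 1%nat => (P 1%nat - c2) / k
  | 2%nat => c2
  | _ => c3
  end.

(** On the crossing curve [cos x = - k r] and [sin x] is the square root [s]. After multiplication
    by [r s] only [s^2] remains, and the numerator is a cubic in [r^2] whose coefficients depend
    triangularly on the field coefficients; [cubic_coef] inverts that system. *)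
Lemma kappa_crossing_derive k P y : 0 < k -> k * exp y < 1 ->
  is_derive (fun t => kappa (cubic_coef k P) (crossing k t) t) y
    (cubic P (exp y * exp y) / (exp y * sqrt (1 - (k * exp y)²))).
Proof.
intros Hk Hy. assert (He := exp_pos y).
assert (HH := kappa_along_derive (cubic_coef k P) (crossing k) y _ (crossing_derive k y Hk Hy)).
match type of HH with is_derive _ _ ?a => replace (cubic P (exp y * exp y) / (exp y * sqrt (1 - (k * exp y)²))) with a; [exact HH|] end.
unfold fieldA, fieldB, crossing'. rewrite (crossing_cos k y Hk Hy), (crossing_sin k y Hk Hy).
assert (Hpos : 0 < 1 - (k * exp y)²).
{ assert (0 < k * exp y) by (apply Rmult_lt_0_compat; lra). unfold Rsqr. nra. }
assert (Hs := sqrt_lt_R0 _ Hpos). assert (Hss := sqrt_sqrt _ (Rlt_le _ _ Hpos)).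
rewrite exp_Ropp. revert Hs Hss He. generalize (sqrt (1 - (k * exp y)²)). intros s.
generalize (exp y). intros r Hs Hss He.
unfold Rsqr in Hss. unfold cubic, cubic_coef.
set (c3 := P 3%nat / (4 * (k * k * k))).
set (c2 := - (P 2%nat + 3 * k * c3) / (2 * (k * k))).
set (c1 := (P 1%nat - c2) / k).
assert (E3 : P 3%nat = 4 * (k * k * k) * c3) by (unfold c3; field; lra).
assert (E2 : P 2%nat = - (2 * (k * k)) * c2 - 3 * k * c3) by (unfold c2; field; lra).
assert (E1 : P 1%nat = k * c1 + c2) by (unfold c1; field; lra).
rewrite E3, E2, E1. clearbody c1 c2 c3. generalize (P 0%nat). intros P0.
apply Rmult_eq_reg_r with (r * s); [|apply Rgt_not_eq, Rmult_lt_0_compat; assumption].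
transitivity (P0 * k * k * r * r + c1 * k * r * r - c2 * k * k * r * r * r * r + c3 * (r * r) * (k * k * r * r - s * s) * (k * r * r)
  + (s * s) * (P0 + c2 * r * r - 2 * k * c3 * r * r * r * r)).
- field. split; lra.
- rewrite Hss. field. split; lra.
Qed.

(** Closeness of the derivatives makes [W], shifted to agree with [T] at [lo], stay within
    [kap (hi - lo) < eta] of [T]. Near each zero [T] has slope at least 1 in absolute value and so
    reaches size [eta] on both sides, which forces a sign change of the shifted [W]; the zero is
    simple because [kap < 1]. *)
Lemma simple_zeros (W wd T t : R -> R) (n : nat) (kap eta lo hi : R) :
  0 < eta -> 0 <= kap < 1 -> lo < hi -> kap * (hi - lo) < eta ->
  (forall x, lo <= x <= hi -> is_derive W x (wd x) /\ is_derive T x (t x) /\ Rabs (wd x - t x) <= kap) ->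
  (forall k, (k < n)%nat -> lo <= INR (S k) - eta /\ INR (S k) + eta <= hi /\ T (INR (S k)) = 0 /\
     ((forall x, INR (S k) - eta <= x <= INR (S k) + eta -> 1 <= t x) \/
      (forall x, INR (S k) - eta <= x <= INR (S k) + eta -> t x <= -1))) ->
  exists g, forall k, (k < n)%nat -> exists x,
    INR (S k) - eta <= x <= INR (S k) + eta /\ W x + g = 0 /\ wd x <> 0.
Proof.
intros Heta Hkap Hlh Hsm HD Hz. exists (T lo - W lo).
assert (Hclose : forall x, lo <= x <= hi -> Rabs (W x + (T lo - W lo) - T x) < eta).
{ intros x Hx.
  destruct (MVT_gen (fun s => W s - T s) lo x (fun s => wd s - t s)) as (z & Hz1 & E).
  - intros s Hs. rewrite Rmin_left, Rmax_right in Hs by lra. destruct (HD s) as (h1 & h2 & _); [lra|].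
    apply (is_derive_minus W T); assumption.
  - intros s Hs. rewrite Rmin_left, Rmax_right in Hs by lra. destruct (HD s) as (h1 & h2 & _); [lra|].
    apply continuity_pt_filterlim, (ex_derive_continuous (fun s => W s - T s)). eexists.
    apply (is_derive_minus W T); eassumption.
  - rewrite Rmin_left, Rmax_right in Hz1 by lra. destruct (HD z) as (_ & _ & h3); [lra|].
    replace (W x + (T lo - W lo) - T x) with ((wd z - t z) * (x - lo)) by lra.
    rewrite Rabs_mult, (Rabs_right (x - lo)) by lra. eapply Rle_lt_trans; [|exact Hsm].
    apply Rmult_le_compat; try lra. apply Rabs_pos. }
intros k Hk. destruct (Hz k Hk) as (B1 & B2 & B3 & B4). set (p := INR (S k)) in *. clearbody p.
assert (Hcont : forall x, p - eta <= x <= p + eta -> continuity_pt (fun s => W s + (T lo - W lo)) x).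
{ intros x Hx. apply continuity_pt_plus; [|apply continuity_pt_const; intros ? ?; reflexivity].
  apply continuity_pt_filterlim, (ex_derive_continuous W). destruct (HD x) as (h & _); [lra|]. eexists; exact h. }
assert (c1 := Hclose (p - eta) ltac:(lra)). assert (c2 := Hclose (p + eta) ltac:(lra)).
apply Rabs_lt_between in c1, c2.
assert (Tc : forall s, p - eta <= s <= p + eta -> continuous T s).
{ intros s Hs. apply (ex_derive_continuous T). destruct (HD s) as (_ & h & _); [lra|]. eexists; exact h. }
destruct B4 as [B4|B4].
- assert (l1 : 1 * (p - (p - eta)) <= T p - T (p - eta)).
  { apply derive_ge_increment with nil; [lra|intros; apply Tc; lra|]. intros s Hs _. exists (t s).
    split; [apply HD; lra|apply B4; lra]. }
  assert (l2 : 1 * (p + eta - p) <= T (p + eta) - T p).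
  { apply derive_ge_increment with nil; [lra|intros; apply Tc; lra|]. intros s Hs _. exists (t s).
    split; [apply HD; lra|apply B4; lra]. }
  destruct (Ranalysis5.f_interv_is_interv (fun s => W s + (T lo - W lo)) (p - eta) (p + eta) 0) as [x [Hx E]].
  + lra. + lra. + exact Hcont.
  + exists x. split; [exact Hx|]. split; [exact E|].
    destruct (HD x) as (_ & _ & h); [lra|]. apply Rabs_le_between in h. assert (h' := B4 x Hx). lra.
- assert (l1 : 1 * (p - (p - eta)) <= (fun s => - T s) p - (fun s => - T s) (p - eta)).
  { apply (derive_ge_increment (fun s => - T s) 1 nil); [lra|intros; apply (continuous_opp T), Tc; lra|]. intros s Hs _. exists (- t s).
    split; [apply (is_derive_opp T), HD; lra|]. assert (h := B4 s ltac:(lra)). lra. }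
  assert (l2 : 1 * (p + eta - p) <= (fun s => - T s) (p + eta) - (fun s => - T s) p).
  { apply (derive_ge_increment (fun s => - T s) 1 nil); [lra|intros; apply (continuous_opp T), Tc; lra|]. intros s Hs _. exists (- t s).
    split; [apply (is_derive_opp T), HD; lra|]. assert (h := B4 s ltac:(lra)). lra. }
  destruct (Ranalysis5.f_interv_is_interv (fun s => - (W s + (T lo - W lo))) (p - eta) (p + eta) 0) as [x [Hx E]].
  + lra. + lra. + intros s Hs. apply (continuity_pt_opp (fun s => W s + (T lo - W lo))), Hcont, Hs.
  + exists x. split; [exact Hx|]. split; [lra|].
    destruct (HD x) as (_ & _ & h); [lra|]. apply Rabs_le_between in h. assert (h' := B4 x Hx). lra.
Qed.

(** * Orbits crossing only S1 *)

Lemma xi_S1_derive y i : exp y < 2 -> is_derive (xi_S1 i) y (dxi_S1 y i).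
Proof. intros Hy. destruct i as [|[|i]]; simpl; apply branch_derive; lra. Qed.

Lemma xi_S13_derive y i : exp y < 2 / 3 -> is_derive (xi_S13 i) y (dxi_S13 y i).
Proof. intros Hy. destruct i as [|[|[|[|i]]]]; simpl; apply branch_derive; lra. Qed.

(** Both sides are derivatives of the same Melnikov function, one taken arc by arc, the other from
    its closed form. *)
Lemma melnikov'_S1 P cp y : exp y < 2 ->
  melnikov' (zone_coef (cubic_coef (1 / 2) P) cp) y 2 xi_S1 (dxi_S1 y) sg_S1 =
  2 * (cubic P (exp y * exp y) / (exp y * sqrt (1 - (1 / 2 * exp y)²))).
Proof.
intros Hy. assert (He := exp_pos y).
assert (H := melnikov_derive (zone_coef (cubic_coef (1 / 2) P) cp) y 2 xi_S1 (dxi_S1 y) sg_S1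
  (fun i _ => xi_S1_derive y i Hy)).
rewrite <- (is_derive_unique _ _ _ H). apply is_derive_unique.
apply (is_derive_ext (fun t => 2 * kappa (cubic_coef (1 / 2) P) (crossing (1 / 2) t) t)).
{ intros t. symmetry. apply melnikov_S1. }
apply (is_derive_scal (fun t => kappa (cubic_coef (1 / 2) P) (crossing (1 / 2) t) t)).
apply kappa_crossing_derive; lra.
Qed.

Lemma melnikov'_S13 P Q y : exp y < 2 / 3 ->
  melnikov' (zone_coef (cubic_coef (1 / 2) P) (cubic_coef (3 / 2) Q)) y 4 xi_S13 (dxi_S13 y) sg_S13 =
  2 * (cubic P (exp y * exp y) / (exp y * sqrt (1 - (1 / 2 * exp y)²)))
  - 2 * (cubic Q (exp y * exp y) / (exp y * sqrt (1 - (3 / 2 * exp y)²))).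
Proof.
intros Hy. assert (He := exp_pos y).
assert (H := melnikov_derive (zone_coef (cubic_coef (1 / 2) P) (cubic_coef (3 / 2) Q)) y 4 xi_S13 (dxi_S13 y) sg_S13
  (fun i _ => xi_S13_derive y i Hy)).
rewrite <- (is_derive_unique _ _ _ H). apply is_derive_unique.
apply (is_derive_ext (fun t => 2 * kappa (cubic_coef (1 / 2) P) (crossing (1 / 2) t) t
   - 2 * kappa (cubic_coef (3 / 2) Q) (crossing (3 / 2) t) t + 2 * PI * cubic_coef (3 / 2) Q 1%nat)).
{ intros t. symmetry. apply melnikov_S13. }
rewrite <- (Rplus_0_r (_ - _)).
apply (is_derive_plus (fun t => 2 * kappa (cubic_coef (1 / 2) P) (crossing (1 / 2) t) t
   - 2 * kappa (cubic_coef (3 / 2) Q) (crossing (3 / 2) t) t)); [|apply (is_derive_const (V := R_NormedModule))].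
apply (is_derive_minus (fun t => 2 * kappa (cubic_coef (1 / 2) P) (crossing (1 / 2) t) t)).
- apply (is_derive_scal (fun t => kappa (cubic_coef (1 / 2) P) (crossing (1 / 2) t) t)).
  apply kappa_crossing_derive; lra.
- apply (is_derive_scal (fun t => kappa (cubic_coef (3 / 2) Q) (crossing (3 / 2) t) t)).
  apply kappa_crossing_derive; lra.
Qed.

(* [exp (yy x)] is the radius of the orbit with coordinate [x]. *)
Lemma limit_cycles_from_chart (c : zone -> nat -> R) (P : (C -> Prop) -> Prop) (N n : nat)
    (xi : nat -> R -> R) (dxi : R -> nat -> R) (sg : nat -> zone)
    (yy yy' T t : R -> R) (kap eta lo hi : R) :
  0 < eta < 1 / 2 -> 0 <= kap < 1 -> lo < hi -> kap * (hi - lo) < eta ->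
  (forall x, lo <= x <= hi ->
     P (center_orbit (yy x)) /\
     (exists d0 L0, config (yy x) d0 L0 N xi (dxi (yy x)) sg) /\
     (forall i, (i <= N)%nat -> is_derive (xi i) (yy x) (dxi (yy x) i)) /\
     xi N (yy x) = xi O (yy x) + 2 * PI /\ dxi (yy x) N = dxi (yy x) O /\
     is_derive yy x (yy' x) /\ is_derive T x (t x) /\
     Rabs (melnikov' c (yy x) N xi (dxi (yy x)) sg * yy' x - t x) <= kap) ->
  (forall x x', lo <= x <= hi -> lo <= x' <= hi -> yy x = yy x' -> x = x') ->
  (forall k, (k < n)%nat -> lo <= INR (S k) - eta /\ INR (S k) + eta <= hi /\ T (INR (S k)) = 0 /\
     ((forall x, INR (S k) - eta <= x <= INR (S k) + eta -> 1 <= t x) \/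
      (forall x, INR (S k) - eta <= x <= INR (S k) + eta -> t x <= -1))) ->
  exists a b, limit_cycles_bifurcate (perturbed a b) P n.
Proof.
intros Heta Hkap Hlh Hsm HD Hinj Hz. assert (HP := PI_RGT_0).
destruct (simple_zeros (fun x => melnikov c (yy x) N xi sg)
  (fun x => melnikov' c (yy x) N xi (dxi (yy x)) sg * yy' x) T t n kap eta lo hi) as [g Hg]; auto; [lra| |].
{ intros x Hx. destruct (HD x Hx) as (_ & _ & h1 & _ & _ & h2 & h3 & h4). split; [|split; assumption].
  rewrite Rmult_comm. apply (is_derive_comp (fun y => melnikov c y N xi sg) yy); [|exact h2].
  apply melnikov_derive, h1. }
assert (Hch : forall k, exists x, (k < n)%nat -> INR (S k) - eta <= x <= INR (S k) + eta /\
   melnikov c (yy x) N xi sg + g = 0 /\ melnikov' c (yy x) N xi (dxi (yy x)) sg * yy' x <> 0).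
{ intros k. destruct (Nat.lt_ge_cases k n) as [h|h].
  - destruct (Hg k h) as [x Hx]. exists x. auto.
  - exists 0. intros; lia. }
destruct (choice _ Hch) as [x Hx].
assert (Hin : forall k, (k < n)%nat -> lo <= x k <= hi).
{ intros k hk. destruct (Hx k hk) as [h _]. destruct (Hz k hk) as (h1 & h2 & _). lra. }
(* A turn has length [2 PI], so this rotation adds exactly [g] to the Melnikov function and leaves
   its derivative unchanged. *)
exists (acoef (rotated c (g / (2 * PI)))), bcoef.
apply (limit_cycles_from_zeros (rotated c (g / (2 * PI))) P n (fun k => yy (x k))).
- intros k hk. destruct (HD (x k) (Hin k hk)) as (h0 & (d0 & L0 & h1) & _ & h2 & h3 & _).
  split; [exact h0|]. exists d0, L0, N, xi, (dxi (yy (x k))), sg. split; [exact h1|].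
  destruct (Hx k hk) as (_ & g1 & g2). split.
  + rewrite melnikov_rotated, h2. replace (g / (2 * PI) * (xi O (yy (x k)) + 2 * PI - xi O (yy (x k)))) with g by (field; lra).
    exact g1.
  + rewrite melnikov'_rotated, h3, Rminus_diag, Rmult_0_r, Rplus_0_r. intros h. apply g2. rewrite h. ring.
- intros j k hj hk hne h. apply Hinj in h; [|apply Hin, hj|apply Hin, hk].
  destruct (Hx j hj) as (g1 & _). destruct (Hx k hk) as (g2 & _). rewrite h in g1.
  (* The zeros lie within [eta < 1/2] of distinct integers and are therefore distinct. *)
  assert (hdist : 1 <= Rabs (INR (S j) - INR (S k))).
  { rewrite !INR_IZR_INZ, <- minus_IZR, <- abs_IZR. apply IZR_le. lia. }
  assert (Rabs (INR (S j) - INR (S k)) < 1) by (apply Rabs_lt_between; lra). lra.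
Qed.

(* [T4] vanishes at 1, 2, 3, 4. *)
Definition T4 (x : R) : R := 5040 - 6396 * x + 1505 * x ^ 3 - 154 * x ^ 5 + 5 * x ^ 7.
Definition t4 (x : R) : R := - 6396 + 4515 * x ^ 2 - 770 * x ^ 4 + 35 * x ^ 6.

Lemma pow_bounds a b x n : 0 <= a -> a <= x <= b -> a ^ n <= x ^ n <= b ^ n.
Proof. intros Ha Hx. split; apply pow_incr; lra. Qed.

(* [x] with [r = 2 / sqrt (1 + (del x)^2)]: near the outer end [r = 2] the four odd functions of the
   Melnikov function span, to leading order, [x, x^3, x^5, x^7]. *)
Definition chart4 (del x : R) : R := ln 2 - / 2 * ln (1 + (del * x) * (del * x)).
(** With [q = 1 + (del x)^2], the polynomial [t4] is a cubic in [q - 1] with coefficients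
    proportional to [f0, ..., f3]; divided by [q^3] it is a cubic in [4 / q], the squared radius.
    The entries expand it, the factor 64 being [4^3]. *)
Definition P4 (del : R) (m : nat) : R :=
  let f0 := - 6396 / (64 * del) in
  let f1 := 4515 / (64 * del * (del * del)) in
  let f2 := - 770 / (64 * del * (del * del) * (del * del)) in
  let f3 := 35 / (64 * del * (del * del) * (del * del) * (del * del)) in
  match m with
  | 0%nat => - 64 * f3
  | 1%nat => - (16 * f2 - 48 * f3)
  | 2%nat => - (4 * f1 - 8 * f2 + 12 * f3)
  | _ => - (f0 - f1 + f2 - f3)
  end.

Lemma P4_eval del x : 0 < del ->
  let q := 1 + (del * x) * (del * x) in
  - del * cubic (P4 del) (4 / q) = t4 x / (q * q * q).
Proof.
intros Hd q. assert (Hq : q <> 0) by (unfold q; nra).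
unfold cubic, P4, t4. 
assert (E : del * x * (del * x) = q - 1) by (unfold q; ring).
replace (x ^ 2) with ((q - 1) / (del * del)) by (rewrite <- E; field; lra).
replace (x ^ 4) with ((q - 1) * (q - 1) / (del * del * (del * del))) by (rewrite <- E; field; lra).
replace (x ^ 6) with ((q - 1) * (q - 1) * (q - 1) / (del * del * (del * del) * (del * del))) by (rewrite <- E; field; lra).
clearbody q. field. split; lra.
Qed.

Lemma chart4_exp del x : exp (chart4 del x) * exp (chart4 del x) = 4 / (1 + (del * x) * (del * x)).
Proof.
assert (Hq : 0 < 1 + (del * x) * (del * x)) by nra. unfold chart4.
rewrite <- exp_plus.
replace (ln 2 - / 2 * ln (1 + del * x * (del * x)) + (ln 2 - / 2 * ln (1 + del * x * (del * x))))
  with (ln 2 + ln 2 + - ln (1 + del * x * (del * x))) by field.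
rewrite !exp_plus, exp_Ropp, !exp_ln by lra. field. lra.
Qed.

Lemma four_cycles : exists a b, limit_cycles_bifurcate (perturbed a b) crosses_only_S1 4.
Proof.
set (del := / 1000000).
assert (Hd : 0 < del) by (unfold del; lra).
assert (Hdd : del * del = / 1000000000000) by (unfold del; lra).
(* The interval from 1/2 to 5 surrounds the zeros 1, ..., 4, and 1/1000 times its length is below
   1/128, as required of [kap] and [eta]. *)
apply (limit_cycles_from_chart (zone_coef (cubic_coef (1 / 2) (P4 del)) (fun _ => 0)) _ 2 4 xi_S1 dxi_S1 sg_S1
  (chart4 del) (fun x => - (del * del * x) / (1 + (del * x) * (del * x))) T4 t4 (/ 1000) (/ 128) (/ 2) 5);
  try lra.
- intros x Hx. set (q := 1 + (del * x) * (del * x)).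
  assert (Hxx : / 4 <= x * x <= 25) by nra.
  assert (Eq : q = 1 + / 1000000000000 * (x * x)) by (unfold q; rewrite <- Hdd; ring).
  assert (Hq : 1 < q <= 1 + / 30000000000) by lra.
  assert (He := exp_pos (chart4 del x)). assert (Hee := chart4_exp del x). fold q in Hee.
  assert (Hr4 : 4 / q * q = 4) by (field; lra).
  assert (He2 : exp (chart4 del x) < 2) by nra.
  assert (He3 : 2 / 3 < exp (chart4 del x)) by nra.
  (* The sum of the absolute values of the terms of [t4] at [x = 5]. *)
  assert (Ht : Rabs (t4 x) <= 1147396).
  { unfold t4.
    assert (h2 := pow_bounds 0 5 x 2 ltac:(lra) ltac:(lra)). assert (h4 := pow_bounds 0 5 x 4 ltac:(lra) ltac:(lra)).
    assert (h6 := pow_bounds 0 5 x 6 ltac:(lra) ltac:(lra)).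
    apply Rabs_le. lra. }
  split; [apply crosses_only_S1_orbit; lra|]. split; [apply config_S1; lra|].
  split; [intros i _; apply xi_S1_derive, He2|]. split; [unfold xi_S1, branch; ring|].
  split; [reflexivity|]. split; [|split].
  + unfold chart4. fold q. auto_derive; [fold q; lra|]. fold q. field. lra.
  + unfold T4, t4. auto_derive; [exact I|]. ring.
  + rewrite melnikov'_S1 by exact He2. fold q. rewrite Hee.
    (* The chart rationalizes the square root: [r^2 = 4 / q] gives [1 - r^2 / 4 = (del x)^2 / q]. *)
    assert (Hs : exp (chart4 del x) * sqrt (1 - (1 / 2 * exp (chart4 del x))²) = 2 * (del * x) / q).
    { rewrite <- (sqrt_Rsqr (exp (chart4 del x))) at 1 by lra. rewrite <- sqrt_mult.
      - replace ((exp (chart4 del x))² * (1 - (1 / 2 * exp (chart4 del x))²)) with (Rsqr (2 * (del * x) / q)).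
        + apply sqrt_Rsqr. apply Rle_mult_inv_pos; [|lra]. assert (0 < del * x) by (apply Rmult_lt_0_compat; lra). lra.
        + unfold Rsqr. replace (1 / 2 * exp (chart4 del x) * (1 / 2 * exp (chart4 del x))) with (/ 4 * (exp (chart4 del x) * exp (chart4 del x))) by field.
          rewrite Hee. assert (E : del * x * (del * x) = q - 1) by (unfold q; ring).
          transitivity (4 * (q - 1) / (q * q)); [rewrite <- E; field; lra|field; lra].
      - apply Rle_0_sqr.
      - unfold Rsqr. nra. }
    rewrite Hs.
    replace (2 * (cubic (P4 del) (4 / q) / (2 * (del * x) / q)) * (- (del * del * x) / q))
      with (- del * cubic (P4 del) (4 / q)) by (field; repeat split; lra).
    assert (EP := P4_eval del x Hd). cbv zeta in EP. fold q in EP. rewrite EP.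
    assert (Hq3 : 0 <= 1 - / (q * q * q) <= / 5000000000).
    { assert (q3 : q * q * q <= 1 + / 5000000000) by nra.
      assert (q3' : 1 <= q * q * q) by nra.
      assert (h : / (1 + / 5000000000) <= / (q * q * q) <= / 1) by (split; apply Rinv_le_contravar; lra).
      lra. }
    replace (t4 x / (q * q * q) - t4 x) with (- (t4 x * (1 - / (q * q * q)))) by (field; lra).
    rewrite Rabs_Ropp, Rabs_mult, (Rabs_right (1 - / (q * q * q))) by lra.
    apply Rle_trans with (1147396 * / 5000000000); [|lra].
    apply Rmult_le_compat; try lra. apply Rabs_pos.
- intros x x' Hx Hx' E.
  assert (h1 := chart4_exp del x). rewrite E, chart4_exp in h1.
  assert (q1 : 0 < 1 + del * x * (del * x)) by nra. assert (q2 : 0 < 1 + del * x' * (del * x')) by nra.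
  apply Rmult_eq_compat_r with (r := (1 + del * x * (del * x)) * (1 + del * x' * (del * x'))) in h1.
  field_simplify in h1; [|lra|lra].
  assert (h2 : (del * del) * ((x - x') * (x + x')) = 0) by lra.
  apply Rmult_integral in h2. destruct h2 as [h2|h2]; [lra|].
  apply Rmult_integral in h2. lra.
- intros k Hk.
  assert (B : forall x a b, 0 <= a -> a <= x <= b -> (a ^ 2 <= x ^ 2 <= b ^ 2) /\ (a ^ 4 <= x ^ 4 <= b ^ 4) /\ (a ^ 6 <= x ^ 6 <= b ^ 6)).
  { intros x a b ha hx. split; [|split]; apply pow_bounds; assumption. }
  unfold T4, t4. destruct k as [|[|[|[|k]]]]; [| | | |lia]; simpl INR; (split; [lra|]); (split; [lra|]); (split; [lra|]).
  + right. intros x Hx. destruct (B x (1 - / 128) (1 + / 128)) as (b1 & b2 & b3); lra.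
  + left. intros x Hx. destruct (B x (2 - / 128) (2 + / 128)) as (b1 & b2 & b3); lra.
  + right. intros x Hx. destruct (B x (3 - / 128) (3 + / 128)) as (b1 & b2 & b3); lra.
  + left. intros x Hx. destruct (B x (4 - / 128) (4 + / 128)) as (b1 & b2 & b3); lra.
Qed.

(** * Orbits crossing S1 and S3 *)

(* Taylor polynomial of [/ sqrt (1 - 4 z)], with the central binomial coefficients. *)
Definition binom_poly (z : R) : R :=
  1 + 2 * z + 6 * z ^ 2 + 20 * z ^ 3 + 70 * z ^ 4 + 252 * z ^ 5 + 924 * z ^ 6 + 3432 * z ^ 7.

(** With [s] the square root and [B] the polynomial, [(1/s - B) (1/s + B) s^2 = 1 - B^2 (1 - 4 z)].
    This is divisible by [z^8] because [B] is the Taylor polynomial of order 7, and [Rem] is the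
    quotient. *)
Lemma inv_sqrt_taylor (z : R) : 0 <= z <= / 16 ->
  Rabs (/ sqrt (1 - 4 * z) - binom_poly z) <= 400000 * z ^ 8.
Proof.
intros Hz. assert (Hpos : 0 < 1 - 4 * z) by lra.
assert (Hs := sqrt_lt_R0 _ Hpos). assert (Hss := sqrt_sqrt _ (Rlt_le _ _ Hpos)).
assert (Hpow : forall n, 0 <= z ^ n <= 1).
{ intros n. split; [apply pow_le; lra|]. rewrite <- (pow1 n). apply pow_incr. lra. }
assert (B1 : 1 <= binom_poly z).
{ unfold binom_poly. generalize (proj1 (Hpow 2%nat)) (proj1 (Hpow 3%nat)) (proj1 (Hpow 4%nat)) (proj1 (Hpow 5%nat)) (proj1 (Hpow 6%nat)) (proj1 (Hpow 7%nat)). lra. }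
set (s := sqrt (1 - 4 * z)) in *.
assert (Hs1 : 1 <= / s).
{ rewrite <- Rinv_1. apply Rinv_le_contravar; [exact Hs|]. apply Rnot_lt_le. intros h. nra. }
set (Rem := 25740 + 45760 * z + 123552 * z ^ 2 + 374400 * z ^ 3 + 1201200 * z ^ 4 + 3991680 * z ^ 5 + 13590720 * z ^ 6 + 47114496 * z ^ 7).
assert (HR : 0 <= Rem <= 40000).
{ assert (hb : forall n, 0 <= z ^ n <= (/ 16) ^ n) by (intros n; split; [apply pow_le; lra|apply pow_incr; lra]).
  assert (h1 := hb 2%nat). assert (h2 := hb 3%nat). assert (h3 := hb 4%nat). assert (h4 := hb 5%nat).
  assert (h5 := hb 6%nat). assert (h6 := hb 7%nat). unfold Rem. simpl pow in h1, h2, h3, h4, h5, h6 |- *. lra. }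
assert (Key : (/ s - binom_poly z) * ((/ s + binom_poly z) * (s * s)) = z ^ 8 * Rem).
{ transitivity (1 - binom_poly z * binom_poly z * (s * s)); [field; lra|].
  rewrite Hss. unfold binom_poly, Rem. ring. }
assert (Hden : 1 <= (/ s + binom_poly z) * (s * s)).
{ rewrite Hss. nra. }
assert (H8 := proj1 (Hpow 8%nat)).
assert (Hnn : 0 <= / s - binom_poly z).
{ apply Rnot_lt_le. intros h. assert (0 <= z ^ 8 * Rem) by (apply Rmult_le_pos; lra). nra. }
rewrite Rabs_right by lra.
assert (z ^ 8 * Rem <= z ^ 8 * 40000) by (apply Rmult_le_compat_l; lra).
assert (/ s - binom_poly z <= z ^ 8 * Rem) by (rewrite <- Key; rewrite <- (Rmult_1_r (/ s - binom_poly z)) at 1; apply Rmult_le_compat_l; lra).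
lra.
Qed.

Definition list4 (a b c d : R) (m : nat) : R := match m with 0%nat => a | 1%nat => b | 2%nat => c | _ => d end.

(** [sq1] and [sq3] are [1 / sqrt (1 - u/4)] and [1 / sqrt (1 - 9u/4)] in [u = r^2], written in the
    normalization of [binom_poly]. *)
Definition sq1 (u : R) : R := / sqrt (1 - 4 * (u / 16)).
Definition sq3 (u : R) : R := / sqrt (1 - 4 * (9 * u / 16)).

Lemma cubic_bounded P u : 0 <= u <= 1 ->
  Rabs (cubic P u) <= Rabs (P 0%nat) + Rabs (P 1%nat) + Rabs (P 2%nat) + Rabs (P 3%nat).
Proof.
intros Hu. unfold cubic. assert (h2 : 0 <= u * u <= 1) by nra. assert (h3 : 0 <= u * u * u <= 1) by nra.
assert (G : forall a v, 0 <= v <= 1 -> Rabs (a * v) <= Rabs a).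
{ intros a v hv. rewrite Rabs_mult, (Rabs_right v) by lra. generalize (Rabs_pos a). nra. }
assert (g1 := G (P 1%nat) u Hu). assert (g2 := G (P 2%nat) _ h2). assert (g3 := G (P 3%nat) _ h3).
eapply Rle_trans; [apply Rabs_triang|]. apply Rplus_le_compat; [|exact g3].
eapply Rle_trans; [apply Rabs_triang|]. apply Rplus_le_compat; [|exact g2].
eapply Rle_trans; [apply Rabs_triang|]. lra.
Qed.

Definition approximates (P Q : nat -> R) (j : nat) : Prop :=
  exists C, 0 <= C /\ forall u, 0 <= u <= / 9 ->
    Rabs (cubic P u * sq1 u + cubic Q u * sq3 u - u ^ j) <= C * u ^ 8.

(** Reduces the approximation to a polynomial identity. A cubic times a polynomial of degree 7 has
    degree 10, so three coefficients [s0, s1, s2] describe everything beyond order 7. *)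
Lemma pade_error (j : nat) (P Q : nat -> R) (s0 s1 s2 : R) :
  (forall u, cubic P u * binom_poly (u / 16) + cubic Q u * binom_poly (9 * u / 16)
     = u ^ j + u ^ 8 * (s0 + s1 * u + s2 * u ^ 2)) ->
  approximates P Q j.
Proof.
intros H.
set (CP := Rabs (P 0%nat) + Rabs (P 1%nat) + Rabs (P 2%nat) + Rabs (P 3%nat)).
set (CQ := Rabs (Q 0%nat) + Rabs (Q 1%nat) + Rabs (Q 2%nat) + Rabs (Q 3%nat)).
assert (HP : 0 <= CP).
{ unfold CP. generalize (Rabs_pos (P 0%nat)) (Rabs_pos (P 1%nat)) (Rabs_pos (P 2%nat)) (Rabs_pos (P 3%nat)). lra. }
assert (HQ : 0 <= CQ).
{ unfold CQ. generalize (Rabs_pos (Q 0%nat)) (Rabs_pos (Q 1%nat)) (Rabs_pos (Q 2%nat)) (Rabs_pos (Q 3%nat)). lra. }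
set (CS := Rabs s0 + Rabs s1 + Rabs s2).
assert (HS : 0 <= CS) by (unfold CS; generalize (Rabs_pos s0) (Rabs_pos s1) (Rabs_pos s2); lra).
exists (CP * 400000 + CQ * 400000 + CS). split.
{ assert (0 <= CP * 400000) by (apply Rmult_le_pos; lra). assert (0 <= CQ * 400000) by (apply Rmult_le_pos; lra). lra. }
intros u Hu. assert (T1 := inv_sqrt_taylor (u / 16) ltac:(lra)). assert (T2 := inv_sqrt_taylor (9 * u / 16) ltac:(lra)).
fold (sq1 u) in T1. fold (sq3 u) in T2.
assert (H8 : 0 <= u ^ 8) by (apply pow_le; lra).
assert (g1 : (u / 16) ^ 8 <= u ^ 8) by (apply pow_incr; lra).
assert (g2 : (9 * u / 16) ^ 8 <= u ^ 8) by (apply pow_incr; lra).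
replace (cubic P u * sq1 u + cubic Q u * sq3 u - u ^ j) with
  (cubic P u * (sq1 u - binom_poly (u / 16)) + cubic Q u * (sq3 u - binom_poly (9 * u / 16))
   + u ^ 8 * (s0 + s1 * u + s2 * u ^ 2)).
2:{ assert (h := H u). lra. }
assert (BP := cubic_bounded P u ltac:(lra)). assert (BQ := cubic_bounded Q u ltac:(lra)). fold CP in BP. fold CQ in BQ.
assert (BS : Rabs (s0 + s1 * u + s2 * u ^ 2) <= CS).
{ assert (h := cubic_bounded (list4 s0 s1 s2 0) u ltac:(lra)). unfold cubic, list4 in h. rewrite Rabs_R0 in h.
  replace (s0 + s1 * u + s2 * u ^ 2) with (s0 + s1 * u + s2 * (u * u) + 0 * (u * u * u)) by ring. unfold CS. lra. }
eapply Rle_trans; [apply Rabs_triang|].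
eapply Rle_trans; [apply Rplus_le_compat_r, Rabs_triang|]. rewrite !Rabs_mult, (Rabs_right (u ^ 8)) by lra.
assert (m1 : Rabs (cubic P u) * Rabs (sq1 u - binom_poly (u / 16)) <= CP * (400000 * u ^ 8)).
{ apply Rmult_le_compat; auto using Rabs_pos. lra. }
assert (m2 : Rabs (cubic Q u) * Rabs (sq3 u - binom_poly (9 * u / 16)) <= CQ * (400000 * u ^ 8)).
{ apply Rmult_le_compat; auto using Rabs_pos. lra. }
assert (m3 : u ^ 8 * Rabs (s0 + s1 * u + s2 * u ^ 2) <= u ^ 8 * CS) by (apply Rmult_le_compat_l; lra).
lra.
Qed.

(* Hermite-Pade approximants: the 8 coefficients of two cubics are determined by the Taylor coefficients of order 0, ..., 7. *)
Lemma pade_exists (j : nat) : (j < 8)%nat -> exists P Q, approximates P Q j.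
Proof.
intros Hj. destruct j as [|[|[|[|[|[|[|[|j]]]]]]]]; [| | | | | | | |lia]; do 2 eexists.
- apply (pade_error 0 (list4 (518319 / 524288) (- (177147 / 2097152)) (- (413343 / 8388608)) (334611 / 33554432))
    (list4 (5969 / 524288) (- (108873 / 2097152)) (616167 / 8388608) (- (1049031 / 33554432)))
    (- (25832738510055 / 17592186044416)) (125843131084275 / 35184372088832) (- (538124989376403 / 281474976710656))).
  intros u. unfold cubic, list4, binom_poly. field.
- apply (pade_error 1 (list4 (- (5103 / 65536)) (334611 / 262144) (- (426465 / 1048576)) (277749 / 4194304))
    (list4 (5103 / 65536) (- (92879 / 262144)) (524025 / 1048576) (- (887841 / 4194304)))
    (- (22084721923545 / 2199023255552)) (107156965216257 / 4398046511104) (- (455438809058805 / 35184372088832))).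
  intros u. unfold cubic, list4, binom_poly. field.
- apply (pade_error 2 (list4 (- (2835 / 4096)) (40095 / 16384) (- (96957 / 65536)) (136809 / 262144))
    (list4 (2835 / 4096) (- (51435 / 16384)) (288853 / 65536) (- (485829 / 262144)))
    (- (12269218293909 / 137438953472)) (59176518389505 / 274877906944) (- (249217351543017 / 2199023255552))).
  intros u. unfold cubic, list4, binom_poly. field.
- apply (pade_error 3 (list4 (- (6867 / 512)) (96471 / 2048) (- (387261 / 8192)) (432081 / 32768))
    (list4 (6867 / 512) (- (123939 / 2048)) (690741 / 8192) (- (1147789 / 32768)))
    (- (29718469028565 / 17179869184)) (141939424315557 / 34359738368) (- (588785208453585 / 274877906944))).
  intros u. unfold cubic, list4, binom_poly. field.
- apply (pade_error 4 (list4 (2695 / 16) (- (37395 / 64)) (147465 / 256) (- (148629 / 1024)))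
    (list4 (- (2695 / 16)) (48175 / 64) (- (264705 / 256)) (429889 / 1024))
    (11662965132417 / 536870912) (- (54699713978085 / 1073741824)) (220521616866837 / 8589934592)).
  intros u. unfold cubic, list4, binom_poly. field.
- apply (pade_error 5 (list4 (- (763 / 2)) (10319 / 8) (- (39189 / 32)) (37593 / 128))
    (list4 (763 / 2) (- (13371 / 8)) (71309 / 32) (- (110197 / 128)))
    (- (3301802422125 / 67108864)) (14907786036165 / 134217728) (- (56528128510425 / 1073741824))).
  intros u. unfold cubic, list4, binom_poly. field.
- apply (pade_error 6 (list4 (280) (- (926)) (1709 / 2) (- (1593 / 8)))
    (list4 (- (280)) (1206) (- (3141 / 2)) (4693 / 8))
    (151440570117 / 4194304) (- (661593226305 / 8388608)) (2407384113849 / 67108864)).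
  intros u. unfold cubic, list4, binom_poly. field.
- apply (pade_error 7 (list4 (- (64)) (208) (- (188)) (43))
    (list4 (64) (- (272)) (348) (- (127)))
    (- (4325264055 / 524288)) (18416622807 / 1048576) (- (65147620395 / 8388608))).
  intros u. unfold cubic, list4, binom_poly. field.
Qed.

Lemma cubic_linear P Q a u : cubic (fun m => P m + a * Q m) u = cubic P u + a * cubic Q u.
Proof. unfold cubic. ring. Qed.

(** Substituting [u = (del x)^2] and weighting the approximant of [u^j] by [del^(- 2 j)] makes all
    monomials of comparable size. The error of order [u^8] becomes [O(del^2)] because [j <= 7]. *)
Lemma pade_sum (E : nat -> R) (n : nat) : (n <= 8)%nat ->
  exists C, 0 <= C /\ forall del, 0 < del <= / 100 -> exists P Q : nat -> R, forall x, 0 <= x <= 10 ->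
    Rabs (cubic P (del * x * (del * x)) * sq1 (del * x * (del * x))
      + cubic Q (del * x * (del * x)) * sq3 (del * x * (del * x)) - fsum (fun j => E j * (x * x) ^ j) n)
      <= C * (del * del).
Proof.
induction n as [|n IH]; intros Hn.
- exists 0. split; [lra|]. intros del Hd. exists (fun _ => 0), (fun _ => 0). intros x _. unfold cubic. simpl.
  replace (_ - 0) with 0 by ring. rewrite Rabs_R0. lra.
- destruct IH as (C & HC & IH); [lia|]. destruct (pade_exists n ltac:(lia)) as (Pn & Qn & Cn & HCn & Hap).
  set (M := Rabs (E n) * Cn * (100 ^ 8)).
  assert (HM : 0 <= M).
  { unfold M. apply Rmult_le_pos; [apply Rmult_le_pos; [apply Rabs_pos|exact HCn]|apply pow_le; lra]. }
  exists (C + M). split; [lra|]. intros del Hd. destruct (IH del Hd) as (P & Q & HPQ).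
  set (a := E n / (del * del) ^ n).
  exists (fun m => P m + a * Pn m), (fun m => Q m + a * Qn m). intros x Hx.
  assert (h := HPQ x Hx). rewrite !cubic_linear. simpl fsum.
  set (u := del * x * (del * x)) in *.
  assert (Hdd : 0 < del * del <= / 10000) by nra.
  assert (Hxx : 0 <= x * x <= 100) by nra.
  assert (Hu : u = del * del * (x * x)) by (unfold u; ring).
  assert (Hu9 : 0 <= u <= / 9) by (rewrite Hu; nra).
  assert (hn := Hap u Hu9).
  assert (Hdn : 0 < (del * del) ^ n) by (apply pow_lt; lra).
  assert (Ea : a * u ^ n = E n * (x * x) ^ n).
  { rewrite Hu, (Rpow_mult_distr (del * del) (x * x)). unfold a. field. lra. }
  replace ((cubic P u + a * cubic Pn u) * sq1 u + (cubic Q u + a * cubic Qn u) * sq3 u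
     - (fsum (fun j => E j * (x * x) ^ j) n + E n * (x * x) ^ n))
   with ((cubic P u * sq1 u + cubic Q u * sq3 u - fsum (fun j => E j * (x * x) ^ j) n)
     + a * (cubic Pn u * sq1 u + cubic Qn u * sq3 u - u ^ n)) by (rewrite <- Ea; ring).
  eapply Rle_trans; [apply Rabs_triang|]. rewrite Rmult_plus_distr_r. apply Rplus_le_compat; [exact h|].
  rewrite Rabs_mult.
  apply Rle_trans with (Rabs a * (Cn * u ^ 8)); [apply Rmult_le_compat_l; [apply Rabs_pos|exact hn]|].
  unfold a, Rdiv. rewrite Rabs_mult, Rabs_inv, (Rabs_right ((del * del) ^ n)) by lra.
  rewrite Hu, (Rpow_mult_distr (del * del) (x * x)).
  assert (Hsplit : (del * del) ^ 8 = (del * del) ^ n * ((del * del) ^ (7 - n) * (del * del))).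
  { rewrite <- (pow_1 (del * del)) at 4. rewrite <- !pow_add. f_equal. lia. }
  rewrite Hsplit.
  replace (Rabs (E n) * / (del * del) ^ n * (Cn * ((del * del) ^ n * ((del * del) ^ (7 - n) * (del * del)) * (x * x) ^ 8)))
   with (Rabs (E n) * Cn * (x * x) ^ 8 * ((del * del) ^ (7 - n) * (del * del))) by (field; lra).
  assert (k1 : 0 <= (x * x) ^ 8 <= 100 ^ 8) by (split; [apply pow_le; lra|apply pow_incr; lra]).
  assert (k2 : 0 <= (del * del) ^ (7 - n) <= 1).
  { split; [apply pow_le; lra|]. rewrite <- (pow1 (7 - n)). apply pow_incr. lra. }
  assert (k3 : 0 <= Rabs (E n) * Cn) by (apply Rmult_le_pos; [apply Rabs_pos|exact HCn]).
  unfold M. apply Rmult_le_compat.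
  + apply Rmult_le_pos; lra.
  + apply Rmult_le_pos; lra.
  + apply Rmult_le_compat_l; lra.
  + apply Rle_trans with (1 * (del * del)); [apply Rmult_le_compat_r; lra|lra].
Qed.

(* [x * T8 x] vanishes at 1, ..., 8; its exponents are those of the leading terms of the nine functions
   spanning the Melnikov function near [r = 0]. *)
Definition T8 (x : R) : R :=
  29059430400 / x - 54486432000 + 27849029184 * x - 2601599000 * x ^ 3 + 187305118 * x ^ 5
  - 7918625 * x ^ 7 + 187187 * x ^ 9 - 2275 * x ^ 11 + 11 * x ^ 13.
(** Coefficients of [x^2] times the derivative of [T8], in powers of [x^2]. *)
Definition E8 (j : nat) : R :=
  match j with
  | 0%nat => - 29059430400
  | 1%nat => 27849029184
  | 2%nat => - 7804797000
  | 3%nat => 936525590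
  | 4%nat => - 55430375
  | 5%nat => 1684683
  | 6%nat => - 25025
  | _ => 143
  end.
Definition n8 (x : R) : R := fsum (fun j => E8 j * (x * x) ^ j) 8.

(** The coefficients [E8 j] are negative for even [j] and positive for odd [j], so each term is
    extremal at the end point selected by the parity. *)
Lemma n8_bounds a b x : 0 < a -> a <= x <= b ->
  let lo := fsum (fun j => E8 j * (if Nat.even j then (b * b) ^ j else (a * a) ^ j)) 8 in
  let hi := fsum (fun j => E8 j * (if Nat.even j then (a * a) ^ j else (b * b) ^ j)) 8 in
  lo <= n8 x <= hi.
Proof.
intros Ha Hx. unfold n8. simpl fsum. cbn [E8].
assert (h : forall j, (a * a) ^ j <= (x * x) ^ j <= (b * b) ^ j).
{ intros j. split; apply pow_incr; nra. }
assert (h1 := h 1%nat). assert (h2 := h 2%nat). assert (h3 := h 3%nat). assert (h4 := h 4%nat).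
assert (h5 := h 5%nat). assert (h6 := h 6%nat). assert (h7 := h 7%nat). 
cbn [Nat.even]. lra.
Qed.

(** In the chart [r = del x] the derivative of the Melnikov function is [(n8 x + O(del^2)) / x^2],
    where [n8 x / x^2] is the derivative of [T8]. The factors [del / 2] cancel the scaling of the
    chart, and the sign on [Q] compensates the minus with which S3 enters. *)
Lemma eight_cycles : exists a b, limit_cycles_bifurcate (perturbed a b) crosses_S1_and_S3 8.
Proof.
destruct (pade_sum E8 8 (Nat.le_refl 8)) as (C & HC & HPade).
(* The approximation error is then at most 1/4000000; divided by [x^2 >= 1/4] it stays below
   1/200000, and that times the length of the interval from 1/2 to 9 stays below 1/16384. *)
set (del := Rmin (/ 100) (/ (4000000 * (C + 1)))).
assert (Hd : 0 < del /\ del <= / 100 /\ del * (C + 1) <= / 4000000).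
{ assert (0 < / (4000000 * (C + 1))) by (apply Rinv_0_lt_compat; lra).
  unfold del. split; [apply Rmin_glb_lt; lra|]. split; [apply Rmin_l|].
  apply Rle_trans with (/ (4000000 * (C + 1)) * (C + 1)); [|right; field; lra].
  apply Rmult_le_compat_r; [lra|apply Rmin_r]. }
clearbody del. destruct Hd as (Hd & Hd1 & Hd2).
assert (HCd : C * (del * del) <= / 4000000).
{ assert (0 <= del * C) by (apply Rmult_le_pos; lra). assert (del * C <= / 4000000) by lra.
  replace (C * (del * del)) with ((del * C) * del) by ring.
  apply Rle_trans with (/ 4000000 * 1); [|lra]. apply Rmult_le_compat; lra. }
destruct (HPade del (conj Hd Hd1)) as (P & Q & HPQ).
apply (limit_cycles_from_chart
  (zone_coef (cubic_coef (1 / 2) (fun m => del / 2 * P m)) (cubic_coef (3 / 2) (fun m => - (del / 2) * Q m)))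
  _ 4 8 xi_S13 dxi_S13 sg_S13 (fun x => ln (del * x)) (fun x => / x) T8 (fun x => n8 x / (x * x))
  (/ 200000) (/ 16384) (/ 2) 9); try lra.
- intros x Hx.
  assert (Hdx : 0 < del * x) by (apply Rmult_lt_0_compat; lra).
  assert (Hdx9 : del * x <= 9 / 100) by nra.
  assert (He := exp_ln _ Hdx).
  assert (He2 : exp (ln (del * x)) < 2 / 3) by (rewrite He; lra).
  assert (Hxx : / 4 <= x * x) by nra.
  split; [apply crosses_S1_and_S3_orbit, He2|]. split; [apply config_S13, He2|].
  split; [intros i _; apply xi_S13_derive, He2|]. split; [unfold xi_S13, branch; ring|].
  split; [reflexivity|]. split; [|split].
  + auto_derive; [lra|]. field. lra.
  + unfold T8, n8. simpl fsum. cbn [E8]. auto_derive; [lra|]. field. lra.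
  + rewrite melnikov'_S13 by exact He2. rewrite He.
    assert (h := HPQ x ltac:(lra)). fold (n8 x) in h.
    set (u := del * x * (del * x)) in *.
    assert (F1 : cubic (fun m => del / 2 * P m) u = del / 2 * cubic P u) by (unfold cubic; ring).
    assert (F2 : cubic (fun m => - (del / 2) * Q m) u = - (del / 2) * cubic Q u) by (unfold cubic; ring).
    rewrite F1, F2.
    replace (1 - (1 / 2 * (del * x))²) with (1 - 4 * (u / 16)) by (unfold u, Rsqr; field).
    replace (1 - (3 / 2 * (del * x))²) with (1 - 4 * (9 * u / 16)) by (unfold u, Rsqr; field).
    assert (Hu : 0 <= u <= / 100) by (unfold u; nra).
    assert (S1 : 0 < sqrt (1 - 4 * (u / 16))) by (apply sqrt_lt_R0; lra).
    assert (S2 : 0 < sqrt (1 - 4 * (9 * u / 16))) by (apply sqrt_lt_R0; lra).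
    unfold sq1, sq3 in h.
    replace ((2 * (del / 2 * cubic P u / (del * x * sqrt (1 - 4 * (u / 16)))) - 2 * (- (del / 2) * cubic Q u / (del * x * sqrt (1 - 4 * (9 * u / 16))))) * / x - n8 x / (x * x))
      with ((cubic P u * / sqrt (1 - 4 * (u / 16)) + cubic Q u * / sqrt (1 - 4 * (9 * u / 16)) - n8 x) * / (x * x))
      by (field; repeat split; lra).
    rewrite Rabs_mult. assert (Hi : 0 < / (x * x) <= 4).
    { split; [apply Rinv_0_lt_compat; lra|]. rewrite <- (Rinv_inv 4). apply Rinv_le_contravar; lra. }
    rewrite (Rabs_right (/ (x * x))) by lra.
    apply Rle_trans with (/ 4000000 * 4); [|lra].
    apply Rmult_le_compat; try lra. apply Rabs_pos.
- intros x x' Hx Hx' E. apply ln_inv in E; [|apply Rmult_lt_0_compat; lra|apply Rmult_lt_0_compat; lra].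
  apply Rmult_eq_reg_l with del; lra.
- intros k Hk.
  assert (Hsign : forall x, 0 < x -> (x * x <= n8 x -> 1 <= n8 x / (x * x)) /\ (n8 x <= - (x * x) -> n8 x / (x * x) <= -1)).
  { intros x hx. assert (0 < x * x) by (apply Rmult_lt_0_compat; lra). split; intros h.
    - apply Rle_div_r; lra.
    - apply Rle_div_l; lra. }
  (* 81 bounds [x^2] on the whole interval, so [n8 x >= 81] gives slope at least 1. The narrow width
     1/16384 lets the termwise bounds of [n8] still decide the sign despite cancellation. *)
  assert (Hpos : forall c, 1 <= c <= 8 ->
     81 <= fsum (fun j => E8 j * (if Nat.even j then ((c + / 16384) * (c + / 16384)) ^ j else ((c - / 16384) * (c - / 16384)) ^ j)) 8 ->
     forall x, c - / 16384 <= x <= c + / 16384 -> 1 <= n8 x / (x * x)).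
  { intros c hc hb x hx. apply Hsign; [lra|].
    assert (g := n8_bounds (c - / 16384) (c + / 16384) x ltac:(lra) hx). cbv zeta in g.
    assert (x * x <= 81) by nra. lra. }
  assert (Hneg : forall c, 1 <= c <= 8 ->
     fsum (fun j => E8 j * (if Nat.even j then ((c - / 16384) * (c - / 16384)) ^ j else ((c + / 16384) * (c + / 16384)) ^ j)) 8 <= -81 ->
     forall x, c - / 16384 <= x <= c + / 16384 -> n8 x / (x * x) <= -1).
  { intros c hc hb x hx. apply Hsign; [lra|].
    assert (g := n8_bounds (c - / 16384) (c + / 16384) x ltac:(lra) hx). cbv zeta in g.
    assert (x * x <= 81) by nra. lra. }
  destruct k as [|[|[|[|[|[|[|[|k]]]]]]]]; [| | | | | | | |lia]; simpl INR;
  (split; [lra|]); (split; [lra|]); (split; [unfold T8; lra|]).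
  + right. apply (Hneg 1); [lra|]. simpl fsum. cbn [E8 Nat.even]. lra.
  + left. apply (Hpos (1 + 1)); [lra|]. simpl fsum. cbn [E8 Nat.even]. lra.
  + right. apply (Hneg (1 + 1 + 1)); [lra|]. simpl fsum. cbn [E8 Nat.even]. lra.
  + left. apply (Hpos (1 + 1 + 1 + 1)); [lra|]. simpl fsum. cbn [E8 Nat.even]. lra.
  + right. apply (Hneg (1 + 1 + 1 + 1 + 1)); [lra|]. simpl fsum. cbn [E8 Nat.even]. lra.
  + left. apply (Hpos (1 + 1 + 1 + 1 + 1 + 1)); [lra|]. simpl fsum. cbn [E8 Nat.even]. lra.
  + right. apply (Hneg (1 + 1 + 1 + 1 + 1 + 1 + 1)); [lra|]. simpl fsum. cbn [E8 Nat.even]. lra.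
  + left. apply (Hpos (1 + 1 + 1 + 1 + 1 + 1 + 1 + 1)); [lra|]. simpl fsum. cbn [E8 Nat.even]. lra.
Qed.

Theorem theoremC :
  (exists a b : zone -> nat -> R,
     limit_cycles_bifurcate (perturbed a b) crosses_only_S1 4) /\
  (exists a b : zone -> nat -> R,
     limit_cycles_bifurcate (perturbed a b) crosses_S1_and_S3 8).
Proof.
exact (conj four_cycles eight_cycles).
Qed.
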